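(* Let $d$ be a squarefree integer not equal to one, and let $K=\mathbb{Q}(\sqrt{d})$, with discriminant $\Delta_K$. Let $p$ and $q$ be two positive primes. Then the quaternion algebra $H_K(p,q)$ is a division algebra if and only if, after possibly interchanging the names of $p$ and $q$, one of the following conditions holds: (1) $p$ and $q$ are odd and distinct, and $\left(\frac{p}{q}\right)=-1$, and ($p\equiv 1 \pmod 4$ or $q\equiv 1\pmod 4$), and ($\left(\frac{\Delta_K}{p}\right)=1$ or $\left(\frac{\Delta_K}{q}\right)=1$); (2) $q=2$, and ($p\equiv 3\pmod 8$ or $p\equiv 5\pmod 8$), and ($\left(\frac{\Delta_K}{p}\right)=1$ or $d\equiv 1\pmod 8$); (3) $p$ and $q$ are odd with $p\equiv q\equiv 3\pmod 4$, and at least one of the following holds: (a) $\left(\frac{q}{p}\right)\neq 1$ and ($\left(\frac{\Delta_K}{p}\right)=1$ or $d\equiv 1\pmod 8$); (b) $\left(\frac{p}{q}\right)\neq 1$ and ($\left(\frac{\Delta_K}{q}\right)=1$ or $d\equiv 1\pmod 8$).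
   Context: For a field $F$ of characteristic $\neq 2$ and $a,b\in F\setminus\{0\}$, $H_F(a,b)$ denotes the generalized quaternion algebra over $F$ with basis $1,i,j,k$ and relations $i^2=a$, $j^2=b$, $ij=-ji=k$. Squarefree integers are nonzero and may be negative. $\left(\frac{m}{\ell}\right)$ is the Legendre symbol for an odd prime $\ell$, equal to $0$ if $\ell\mid m$. The discriminant of $\mathbb{Q}(\sqrt d)$ is $d$ if $d\equiv 1\pmod 4$ and $4d$ otherwise. *)

(* Defs.v *)
From HB Require Import structures.
From mathcomp Require Import all_boot all_order all_algebra all_field.
From mathcomp Require Import ring.

Set Implicit Arguments.
Unset Strict Implicit.
Unset Printing Implicit Defensive.

Import Order.TTheory GRing.Theory Num.Theory.
Local Open Scope ring_scope.

(* [Quat x y z t] stands for x + y i + z j + t k in H_F(a, b). The parameters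
   a and b only occur in the multiplication; H_F(a, b) is intended for nonzero
   a, b and a field of characteristic different from 2, but the structure below
   makes sense without these restrictions. *)
Record quaternion (F : fieldType) (a b : F) : Type :=
  Quat { qre : F; qi : F; qj : F; qk : F }.

Arguments Quat {F a b}.

Section QuaternionAlgebra.
Variables (F : fieldType) (a b : F).
Local Notation H := (quaternion a b).
Implicit Types (u v w : H) (c : F).

Definition quat_to_prod u := (qre u, qi u, qj u, qk u).
Definition quat_of_prod (x : F * F * F * F) : H :=
  Quat x.1.1.1 x.1.1.2 x.1.2 x.2.

Lemma quat_to_prodK : cancel quat_to_prod quat_of_prod.
Proof. by case. Qed.

HB.instance Definition _ := Choice.copy H (can_type quat_to_prodK).

Definition quat_zero : H := Quat 0 0 0 0.
Definition quat_opp u : H := Quat (- qre u) (- qi u) (- qj u) (- qk u).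
Definition quat_add u v : H :=
  Quat (qre u + qre v) (qi u + qi v) (qj u + qj v) (qk u + qk v).

Fact quat_addA : associative quat_add.
Proof. by case=> ????[????][????]; rewrite /quat_add /= !addrA. Qed.
Fact quat_addC : commutative quat_add.
Proof. by case=> x y z t [????]; congr Quat; rewrite /= addrC. Qed.
Fact quat_add0 : left_id quat_zero quat_add.
Proof. by case=> ????; rewrite /quat_add /= !add0r. Qed.
Fact quat_addN : left_inverse quat_zero quat_opp quat_add.
Proof. by case=> ????; rewrite /quat_add /= !addNr. Qed.

HB.instance Definition _ :=
  GRing.isZmodule.Build H quat_addA quat_addC quat_add0 quat_addN.

Definition quat_one : H := Quat 1 0 0 0.

(* Obtained by bilinearity from i^2 = a, j^2 = b, ij = - ji = k, which give
   k^2 = - ab, ik = - ki = a j and jk = - kj = - b i. *)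
Definition quat_mul u v : H :=
  let: Quat x0 x1 x2 x3 := u in
  let: Quat y0 y1 y2 y3 := v in
  Quat (x0 * y0 + a * (x1 * y1) + b * (x2 * y2) - a * b * (x3 * y3))
       (x0 * y1 + x1 * y0 - b * (x2 * y3) + b * (x3 * y2))
       (x0 * y2 + x2 * y0 + a * (x1 * y3) - a * (x3 * y1))
       (x0 * y3 + x3 * y0 + x1 * y2 - x2 * y1).

Fact quat_mulA : associative quat_mul.
Proof. by case=> ????[????][????]; congr Quat; ring. Qed.
Fact quat_mul1q : left_id quat_one quat_mul.
Proof. by case=> ????; congr Quat; ring. Qed.
Fact quat_mulq1 : right_id quat_one quat_mul.
Proof. by case=> ????; congr Quat; ring. Qed.
Fact quat_mulDl : left_distributive quat_mul quat_add.
Proof. by case=> ????[????][????]; congr Quat => /=; ring. Qed.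
Fact quat_mulDr : right_distributive quat_mul quat_add.
Proof. by case=> ????[????][????]; congr Quat => /=; ring. Qed.
Fact quat_one_neq0 : quat_one != 0.
Proof. by apply/eqP => -[/eqP]; rewrite oner_eq0. Qed.

HB.instance Definition _ := GRing.Zmodule_isNzRing.Build H
  quat_mulA quat_mul1q quat_mulq1 quat_mulDl quat_mulDr quat_one_neq0.

Definition quat_scale c u : H := Quat (c * qre u) (c * qi u) (c * qj u) (c * qk u).

Fact quat_scaleA c c' u : quat_scale c (quat_scale c' u) = quat_scale (c * c') u.
Proof. by congr Quat; rewrite /= mulrA. Qed.
Fact quat_scale1 : left_id 1 quat_scale.
Proof. by case=> ????; rewrite /quat_scale /= !mul1r. Qed.
Fact quat_scaleDr : right_distributive quat_scale +%R.
Proof. by move=> c u v; congr Quat; rewrite /= mulrDr. Qed.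
Fact quat_scaleDl u : {morph quat_scale^~ u : c c' / c + c'}.
Proof. by move=> c c'; congr Quat; rewrite /= mulrDl. Qed.

HB.instance Definition _ := GRing.Zmodule_isLmodule.Build F H
  quat_scaleA quat_scale1 quat_scaleDr quat_scaleDl.

Fact quat_scaleAl c u v : c *: (u * v) = c *: u * v.
Proof. by case: u v => ????[????]; congr Quat => /=; ring. Qed.

HB.instance Definition _ := GRing.Lmodule_isLalgebra.Build F H quat_scaleAl.

Fact quat_scaleAr c u v : c *: (u * v) = u * (c *: v).
Proof. by case: u v => ????[????]; congr Quat => /=; ring. Qed.

HB.instance Definition _ := GRing.Lalgebra_isAlgebra.Build F H quat_scaleAr.

Definition quat_i : H := Quat 0 1 0 0.
Definition quat_j : H := Quat 0 0 1 0.
Definition quat_k : H := Quat 0 0 0 1.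

Lemma quat_basisE u :
  u = (qre u)%:A + qi u *: quat_i + qj u *: quat_j + qk u *: quat_k.
Proof. by case: u => ????; congr Quat => /=; ring. Qed.
Lemma quat_ii : quat_i * quat_i = a%:A.
Proof. by congr Quat => /=; ring. Qed.
Lemma quat_jj : quat_j * quat_j = b%:A.
Proof. by congr Quat => /=; ring. Qed.
Lemma quat_ij : quat_i * quat_j = quat_k.
Proof. by congr Quat => /=; ring. Qed.
Lemma quat_ji : quat_j * quat_i = - quat_k.
Proof. by congr Quat => /=; ring. Qed.

End QuaternionAlgebra.

Definition division_algebra (F : fieldType) (A : algType F) : Prop :=
  forall x : A, x != 0 -> exists y : A, x * y = 1 /\ y * x = 1.

(* This excludes d = 0, since 0 ^+ 2 divides 0. *)
Definition squarefreez (d : int) : Prop :=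
  forall m : int, (m ^+ 2 %| d)%Z -> m \is a GRing.unit.

(* K = Q(s) with s a square root of d. *)
Definition is_quadratic_field (d : int) (K : fieldExtType rat) : Prop :=
  exists2 s : K, s ^+ 2 = d%:~R & <<1; s>>%VS = fullv.

Definition quadratic_disc (d : int) : int :=
  if (d == 1 %[mod 4])%Z then d else 4 * d.

(* Only meaningful for l an odd prime. *)
Definition legendre (m : int) (l : nat) : int :=
  if (l %| m)%Z then 0
  else if [exists x : 'I_l, ((x : nat)%:Z ^+ 2 == m %[mod l])%Z] then 1
  else -1.

Definition division_condition1 (d : int) (p q : nat) : Prop :=
  [/\ [/\ odd p, odd q & p != q],
      legendre p q = -1,
      p = 1 %[mod 4] \/ q = 1 %[mod 4]
    & legendre (quadratic_disc d) p = 1 \/ legendre (quadratic_disc d) q = 1].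

Definition division_condition2 (d : int) (p q : nat) : Prop :=
  [/\ q = 2%N,
      p = 3 %[mod 8] \/ p = 5 %[mod 8]
    & legendre (quadratic_disc d) p = 1 \/ (d = 1 %[mod 8])%Z].

Definition division_condition3 (d : int) (p q : nat) : Prop :=
  [/\ odd p /\ odd q,
      p = 3 %[mod 4] /\ q = 3 %[mod 4]
    & (legendre q p <> 1 /\
         (legendre (quadratic_disc d) p = 1 \/ (d = 1 %[mod 8])%Z))
      \/ (legendre p q <> 1 /\
         (legendre (quadratic_disc d) q = 1 \/ (d = 1 %[mod 8])%Z))].

Definition division_conditions (d : int) (p q : nat) : Prop :=
  [\/ division_condition1 d p q,
      division_condition2 d p q
    | division_condition3 d p q].

(* Main.v *)
(** The norm form of [H_K(p, q)] is isotropic iff, for some [m], both conics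
    [p x^2 + m q y^2 = z^2] and [d p x^2 + d m y^2 = z^2] have rational points:
    the first says that [m] may replace [q], the second that [d] is the square
    of a pure quaternion of [H_Q(p, m)].  By Legendre's theorem such an [m]
    exists as soon as its Hilbert symbols with [p] and [d] have prescribed
    values at every prime.  These prescriptions can be met locally at [l] unless
    [d] is a square in [Q_l] and [(p, q)_l = -1]; they are met globally by an
    integer of the form [+- (product of small primes) * r], where [r] is a prime
    with prescribed quadratic characters and the symbols at [r] take care of
    themselves by the product formula.  The existence of [r] is Dirichlet's
    theorem for real characters, proved here with Mertens-type finite sums.

    Hence [H_K(p, q)] is a division algebra iff some prime [l] satisfies both
    [d] in [Q_l^2] and [(p, q)_l = -1], which quadratic reciprocity turns into
    the stated conditions. *)
Require Import Defs.
From mathcomp Require Import all_boot all_order all_fingroup all_algebra all_solvable all_field.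
From mathcomp Require Import ring lra zify.
From mathcomp Require Import boolp reals sequences exp Rstruct.

Set Implicit Arguments.
Unset Strict Implicit.
Unset Printing Implicit Defensive.
Import Order.TTheory GRing.Theory Num.Theory.
Local Open Scope ring_scope.

(** * Divisor sums *)

(** No completion of the rationals occurs: [hil] is given by explicit formulas on square classes,
    and its product formula comes from bilinearity, quadratic reciprocity and the two supplements.
    The obstacle is that one integer [m] must serve two conics at every place. Giving [m] the sign
    of [d] provides both with real points, prescribed classes settle the primes up to a bound, and
    at the larger primes other than [r] all coefficients are units. Both conics are thus left with
    the same single prime [r], which is why one auxiliary prime suffices. The conditions on [r]
    involve quadratic characters only, so L(1, chi) has to be kept away from 0 only for real [chi],
    where the positivity of the divisor sums of [chi] gives an elementary argument. *)

Lemma big_divisorsE (V : nmodType) (F : nat -> V) (n N : nat) :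
  (0 < n <= N)%N ->
  \sum_(d <- divisors n) F d = \sum_(1 <= d < N.+1 | (d %| n)%N) F d.
Proof.
case/andP=> n0 nN; rewrite -[RHS]big_filter; apply: perm_big.
apply: uniq_perm; rewrite ?divisors_uniq ?filter_uniq ?iota_uniq // => d.
rewrite mem_filter mem_index_iota -dvdn_divisors // ltnS.
case: (boolP (d %| n)%N) => //= dn.
by rewrite (dvdn_gt0 n0 dn) (leq_trans (dvdn_leq n0 dn)).
Qed.

Lemma big_multiples (V : nmodType) (F : nat -> V) (d N : nat) : (0 < d)%N ->
  \sum_(1 <= n < N.+1 | (d %| n)%N) F n = \sum_(1 <= k < (N %/ d).+1) F (d * k)%N.
Proof.
move=> d0; rewrite -big_filter -[RHS](big_map (muln d) xpredT F).
apply: perm_big; apply: uniq_perm; rewrite ?filter_uniq ?iota_uniq //.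
  by rewrite map_inj_uniq ?iota_uniq // => x y /eqP; rewrite eqn_pmul2l // => /eqP.
move=> n; rewrite mem_filter mem_index_iota; apply/idP/mapP.
  case/and3P => dn n0 nN; exists (n %/ d)%N; last by rewrite mulnC divnK.
  rewrite mem_index_iota ltnS leq_div2r // andbT divn_gt0 //.
  exact: dvdn_leq.
case=> k; rewrite mem_index_iota ltnS => /andP[k0 kN] ->.
by rewrite dvdn_mulr // muln_gt0 d0 k0 ltnS mulnC -leq_divRL.
Qed.

(** A Dirichlet convolution summed up to [N] and regrouped by its first factor; it serves the
    Lambert series, the logarithm of the factorial and the Mertens sum of a character. *)
Lemma sum_divisors_swap (V : nmodType) (G : nat -> nat -> V) (N : nat) :
  \sum_(1 <= n < N.+1) \sum_(d <- divisors n) G d (n %/ d)%N =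
  \sum_(1 <= d < N.+1) \sum_(1 <= k < (N %/ d).+1) G d k.
Proof.
transitivity (\sum_(1 <= n < N.+1) \sum_(1 <= d < N.+1 | (d %| n)%N) G d (n %/ d)%N).
  rewrite !big_nat; apply: eq_bigr => n /andP[n0 nN].
  by rewrite (@big_divisorsE _ (fun d => G d (n %/ d)%N) _ N) // n0.
rewrite (exchange_big_dep_nat xpredT) /= ?[LHS]big_nat ?[RHS]big_nat //; apply: eq_bigr => d /andP[d0 dN].
rewrite (@big_multiples _ (fun n => G d (n %/ d)%N)) //.
by apply: eq_bigr => k _; rewrite mulKn.
Qed.

(** A divisor of [p ^ k.+1 * m] either has [p]-valuation at most [k] or is [p ^ k.+1] times a
    divisor of [m]. Divisor sums can then be computed by induction on the exponent. *)
Lemma perm_divisorsM_step (p k m : nat) : prime p -> (0 < m)%N -> ~~ (p %| m)%N ->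
  perm_eq (divisors (p ^ k.+1 * m))
          (divisors (p ^ k * m) ++ [seq (p ^ k.+1 * d)%N | d <- divisors m]).
Proof.
move=> pp m0 pm.
have pk j : (0 < p ^ j)%N by rewrite expn_gt0 prime_gt0.
have lm : logn p m = 0%N by apply/eqP; rewrite lognE pp m0 (negPf pm).
apply: uniq_perm; first exact: divisors_uniq.
  rewrite cat_uniq divisors_uniq map_inj_uniq ?divisors_uniq ?andbT /=; last first.
    by move=> x y /eqP; rewrite eqn_pmul2l // => /eqP.
  apply/hasPn => _ /mapP[d _ ->].
  rewrite -dvdn_divisors ?muln_gt0 ?pk //; apply/negP => /dvdn_mull.
  move/(_ 1%N); rewrite mul1n => h.
  have := dvdn_trans (dvdn_mulr d (dvdnn (p ^ k.+1))) h.
  by rewrite pfactor_dvdn ?muln_gt0 ?pk // lognM ?pk // pfactorK // lm addn0 ltnn.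
move=> d; rewrite mem_cat -!dvdn_divisors ?muln_gt0 ?pk //.
apply/idP/orP; last first.
  case; first by move=> h; apply: dvdn_trans h _; rewrite dvdn_mul // dvdn_exp2l.
  by case/mapP => e; rewrite -dvdn_divisors // => em ->; rewrite dvdn_mul.
move=> h; have d0 : (0 < d)%N by apply: dvdn_gt0 h; rewrite muln_gt0 pk.
have [e pe de] := pfactor_coprime pp d0.
have em : (e %| m)%N.
  have : (e %| p ^ k.+1 * m)%N by apply: dvdn_trans h; rewrite de dvdn_mulr.
  by rewrite Gauss_dvdr // coprime_sym coprimeXl.
case: (leqP (logn p d) k) => [lk|lk]; [left|right].
  by rewrite de mulnC dvdn_mul // dvdn_exp2l.
apply/mapP; exists e; first by rewrite -dvdn_divisors.
suff -> : k.+1 = logn p d by rewrite mulnC.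
apply/eqP; rewrite eqn_leq lk /=.
have := dvdn_leq_log p _ h; rewrite muln_gt0 pk m0 => /(_ isT).
by rewrite lognM ?pk // pfactorK // lm addn0.
Qed.

Lemma pfactor_ind (P : nat -> Prop) : P 1%N ->
  (forall p k m, prime p -> (0 < m)%N -> ~~ (p %| m)%N -> P m -> P (p ^ k * m)%N) ->
  forall n, (0 < n)%N -> P n.
Proof.
move=> P1 PS n; elim/ltn_ind: n => n IH n0.
have [->//|n1] := eqVneq n 1%N.
have n2 : (1 < n)%N by case: n n0 n1 {IH} => [|[]].
have pp := pdiv_prime n2; set p := pdiv n in pp *.
have [m pm e] := pfactor_coprime pp n0.
have m0 : (0 < m)%N by move: n0; rewrite e; case: (m).
rewrite e mulnC; apply: PS => //; first by rewrite -prime_coprime.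
apply: IH => //; rewrite [X in (_ < X)%N]e ltn_Pmulr //.
rewrite -[X in (X < _)%N](expn0 p) ltn_exp2l ?prime_gt1 //.
by rewrite logn_gt0 mem_primes pp n0 pdiv_dvd.
Qed.

(** * Positivity of the divisor sums of a real character *)

Section RealCharacter.
Variable (R : realFieldType).

Definition sign_or_zero (x : R) := [\/ x = 0, x = 1 | x = -1].

Lemma sign_or_zeroM x y : sign_or_zero x -> sign_or_zero y -> sign_or_zero (x * y).
Proof.
case=> ->; case=> ->; rewrite ?mul0r ?mulr0 ?mul1r ?mulr1 ?mulrNN ?mulr1 ?opprK;
  by [constructor 1|constructor 2|constructor 3].
Qed.

Lemma sign_or_zero_norm x : sign_or_zero x -> `|x| <= 1.
Proof. by case=> ->; rewrite ?normr0 ?normrN ?normr1 ?ler01. Qed.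

Lemma sign_or_zero_geom_ge0 x k : sign_or_zero x -> 0 <= \sum_(j < k.+1) x ^+ j.
Proof.
case=> ->.
- by apply: sumr_ge0 => j _; rewrite exprn_ge0.
- by apply: sumr_ge0 => j _; rewrite exprn_ge0.
- suff -> : \sum_(j < k.+1) (-1 : R) ^+ j = (~~ odd k)%:R by rewrite ler0n.
  elim: k => [|k IH]; first by rewrite big_ord_recr big_ord0 /= expr0 add0r.
  by rewrite big_ord_recr IH /= exprS -signr_odd; case: (odd k); 
    rewrite /= ?expr1 ?expr0; ring.
Qed.

(** After the leading 1 the terms pair up as [x ^+ j * (1 + x)] with [j] odd, which is never
    negative. *)
Lemma sign_or_zero_geom_even x k : sign_or_zero x -> 1 <= \sum_(j < k.*2.+1) x ^+ j.
Proof.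
move=> tx; rewrite big_ord_recl expr0 lerDl.
elim: k => [|k IH]; first by rewrite big_ord0.
rewrite doubleS !big_ord_recr /= -addrA; apply: addr_ge0 => //.
rewrite /bump /= !add1n [X in _ + X]exprS.
rewrite -[X in X + _]mul1r -mulrDl; case: tx => ->; rewrite ?expr1n ?addr0 ?subrr ?mul0r //.
  by rewrite expr0n mulr0.
by rewrite mulr1 addr_ge0 ?ler01.
Qed.

Variable (chi : nat -> R).
Hypothesis chi1 : chi 1%N = 1.
Hypothesis chiM : forall m n, chi (m * n)%N = chi m * chi n.
Hypothesis chiT : forall n, sign_or_zero (chi n).

Lemma charX p k : chi (p ^ k)%N = chi p ^+ k.
Proof. by elim: k => [|k IH]; rewrite ?expn0 ?expr0 // expnS chiM IH exprS. Qed.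

Lemma sum_div_char_pfactor p k m : prime p -> (0 < m)%N -> ~~ (p %| m)%N ->
  \sum_(d <- divisors (p ^ k * m)) chi d =
  (\sum_(j < k.+1) chi p ^+ j) * \sum_(d <- divisors m) chi d.
Proof.
move=> pp m0 pm; elim: k => [|k IH].
  by rewrite expn0 mul1n big_ord_recr big_ord0 /= add0r expr0 mul1r.
rewrite (perm_big _ (perm_divisorsM_step k pp m0 pm)) big_cat /= IH [in RHS]big_ord_recr /= mulrDl.
congr (_ + _); rewrite big_map big_distrr /=.
by apply: eq_bigr => d _; rewrite chiM charX.
Qed.

Lemma sum_div_char_ge0 n : (0 < n)%N -> 0 <= \sum_(d <- divisors n) chi d.
Proof.
move: n; apply: pfactor_ind; first by rewrite big_seq1 chi1 ler01.
move=> p k m pp m0 pm IH; rewrite sum_div_char_pfactor // mulr_ge0 //.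
exact: sign_or_zero_geom_ge0.
Qed.

(** All exponents being even, each local factor is a geometric sum with an odd number of terms,
    hence at least 1. *)
Lemma sum_div_char_sqr m : (0 < m)%N -> 1 <= \sum_(d <- divisors (m ^ 2)) chi d.
Proof.
move: m; apply: pfactor_ind; first by rewrite big_seq1 chi1.
move=> p k m pp m0 pm IH.
rewrite expnMn -expnM muln2 sum_div_char_pfactor ?expn_gt0 ?m0 ?Euclid_dvdX //.
  by rewrite -[1]mulr1 ler_pM ?ler01 //; apply: sign_or_zero_geom_even.
by rewrite (negPf pm).
Qed.
End RealCharacter.

(** * Non-vanishing of L(1, chi) for real characters *)

(** Summation by parts: the partial sums of [u] are bounded by [B], and the decrements of [w]
    together with its last value telescope to [w a]. *)
Lemma abel_bound (R : realFieldType) (u w : nat -> R) (B : R) (a b : nat) :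
  (forall n, (a <= n)%N -> 0 <= w n) ->
  (forall n, (a <= n)%N -> w n.+1 <= w n) ->
  (forall c, `|\sum_(a <= n < c) u n| <= B) ->
  (a <= b)%N -> `|\sum_(a <= n < b) u n * w n| <= B * w a.
Proof.
move=> w0 wd uB ab.
have -> : \sum_(a <= n < b) u n * w n = (\sum_(a <= n < b) u n) * w b +
    \sum_(a <= n < b) (\sum_(a <= m < n.+1) u m) * (w n - w n.+1).
  move: ab; elim: b => [|b IH] ab.
    by rewrite !big_geq ?mul0r ?add0r.
  case: (ltngtP a b.+1) ab => // [ab|->] _; last by rewrite !big_geq ?mul0r ?add0r.
  rewrite big_nat_recr ?IH //= [in RHS]big_nat_recr //=.
  by rewrite [X in _ = _ + X]big_nat_recr //= big_nat_recr //=; ring.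
apply: le_trans (ler_normD _ _) _.
rewrite normrM (ger0_norm (w0 _ ab)).
have h : `|\sum_(a <= n < b) (\sum_(a <= m < n.+1) u m) * (w n - w n.+1)| <=
    \sum_(a <= n < b) B * (w n - w n.+1).
  apply: le_trans (ler_norm_sum _ _ _) _.
  rewrite !big_nat; apply: ler_sum => n /andP[an nb].
  have hw : 0 <= w n - w n.+1 by rewrite subr_ge0 wd.
  by rewrite normrM (ger0_norm hw) ler_wpM2r.
apply: le_trans (lerD (ler_wpM2r (w0 _ ab) (uB b)) h) _.
rewrite -mulr_sumr -mulrDr.
suff -> : w b + \sum_(a <= n < b) (w n - w n.+1) = w a by [].
have -> : \sum_(a <= n < b) (w n - w n.+1) = - \sum_(a <= n < b) (w n.+1 - w n).
  by rewrite -sumrN; apply: eq_bigr => i _; rewrite opprB.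
by rewrite telescope_sumr //; ring.
Qed.

Lemma bernoulli_ge (R : realFieldType) (h : R) (n : nat) :
  -1 <= h -> 1 + n%:R * h <= (1 + h) ^+ n.
Proof.
move=> h1; elim: n => [|n IH]; first by rewrite mul0r addr0 expr0.
have h0 : 0 <= 1 + h by lra.
rewrite exprS; apply: le_trans (ler_wpM2l h0 IH).
have : 0 <= n%:R * h ^+ 2 by rewrite mulr_ge0 ?ler0n ?sqr_ge0.
by rewrite -natr1; lra.
Qed.

(** AM-GM on the pairs of indices [i], [d - i]. The induction removes the two extreme terms, hence
    goes down by two. *)
Lemma geom_sqr_ge (R : realFieldType) (s : R) (d : nat) : 0 <= s ->
  d.+1%:R * s ^+ d <= \sum_(i < d.+1) (s ^+ 2) ^+ i.
Proof.
move=> s0; have [k] := ubnP d; elim: k d => // k IH [|[|d]] dk.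
- by rewrite big_ord_recr big_ord0 /= !expr0 add0r mulr1.
- rewrite !big_ord_recr big_ord0 /= !expr0 add0r !expr1.
  by have := sqr_ge0 (s - 1); lra.
- have := IH d; rewrite ltnS in dk => /(_ (ltnW dk)) h.
  rewrite big_ord_recl big_ord_recr /=.
  have -> : \sum_(i < d.+1) (s ^+ 2) ^+ bump 0 i = s ^+ 2 * \sum_(i < d.+1) (s ^+ 2) ^+ i.
    by rewrite big_distrr; apply: eq_bigr => i _; rewrite /= /bump leq0n add1n exprS.
  have h2 := ler_wpM2l (sqr_ge0 s) h.
  have h3 := sqr_ge0 (s ^+ d.+2 - 1).
  rewrite expr0 /bump /= add1n -exprM mulnC exprM.
  have -> : (d.+3)%:R = d.+1%:R + 2%:R :> R by rewrite -natrD addn2.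
  have -> : s ^+ d.+2 = s ^+ 2 * s ^+ d by rewrite -exprD.
  move: h3; have -> : s ^+ d.+2 = s ^+ 2 * s ^+ d by rewrite -exprD.
  move: (s ^+ d) h2 => x; lra.
Qed.

Lemma sum_widen_le (R : realFieldType) (F : nat -> R) (m n p : nat) :
  (forall i, (n <= i)%N -> 0 <= F i) -> (m <= n)%N -> (n <= p)%N ->
  \sum_(m <= i < n) F i <= \sum_(m <= i < p) F i.
Proof.
move=> F0 mn np; rewrite (big_cat_nat (n := n) (p := p)) //= lerDl big_nat.
by apply: sumr_ge0 => i /andP[ni _]; apply: F0.
Qed.

Lemma sum_squares_le (R : realFieldType) (F : nat -> R) (K : nat) :
  (forall n, (0 < n)%N -> 0 <= F n) ->
  \sum_(1 <= m < K.+1) F (m ^ 2)%N <= \sum_(1 <= n < (K ^ 2).+1) F n.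
Proof.
move=> F0; elim: K => [|K IH]; first by rewrite !big_geq.
rewrite big_nat_recr //= [leRHS]big_nat_recr ?expn_gt0 //= lerD2r.
apply: le_trans IH _; apply: sum_widen_le => //; last by rewrite ltn_exp2r.
by move=> i; move/(leq_ltn_trans (leq0n _)); apply: F0.
Qed.

Section NonVanishing.
Variable (R : archiRealFieldType) (chi : nat -> R) (M : nat).
Hypothesis M0 : (0 < M)%N.
Hypothesis chi1 : chi 1%N = 1.
Hypothesis chiM : forall m n, chi (m * n)%N = chi m * chi n.
Hypothesis chiT : forall n, sign_or_zero (chi n).
Hypothesis chi_per : forall n, chi (n + M)%N = chi n.
Hypothesis chi_sum : \sum_(0 <= n < M) chi n = 0.

Let B : R := (2 * M)%:R.

(** Full periods cancel, so an initial sum is at most [M] in absolute value; an interval is a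
    difference of two initial sums, whence [2 * M]. *)
Lemma char_sum_bound a b : `|\sum_(a <= n < b) chi n| <= B.
Proof.
have per k n : chi (n + k * M)%N = chi n.
  by elim: k => [|k IH]; rewrite ?addn0 // mulSn addnCA addnC chi_per IH.
have S0 k : \sum_(0 <= n < k * M) chi n = 0.
  elim: k => [|k IH]; first by rewrite big_geq.
  rewrite mulSn addnC (big_cat_nat (n := k * M)) ?leq_addr //= IH add0r.
  rewrite -[X in \sum_(X <= _ < _) _]add0n big_addn addKn -[RHS]chi_sum.
  by apply: eq_bigr => n _; rewrite per.
have h N : `|\sum_(0 <= n < N) chi n| <= M%:R.
  rewrite {1}(divn_eq N M) (big_cat_nat (n := (N %/ M) * M)) ?leq_addr //= S0 add0r.
  apply: le_trans (ler_norm_sum _ _ _) _.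
  apply: le_trans (ler_sum _ (fun n _ => sign_or_zero_norm (chiT n))) _.
  by rewrite sumr_const_nat addKn ler_nat ltnW // ltn_mod.
have [ab|ab] := leqP a b; last by rewrite big_geq ?normr0 ?ler0n // ltnW.
have e : \sum_(a <= n < b) chi n = \sum_(0 <= n < b) chi n - \sum_(0 <= n < a) chi n.
  by rewrite (big_cat_nat (m := 0) (n := a) (p := b)) //= [RHS]addrC addKr.
rewrite e; apply: le_trans (ler_normB _ _) _.
by apply: le_trans (lerD (h _) (h _)) _; rewrite -natrD addnn -mul2n.
Qed.

Definition charL N : R := \sum_(1 <= n < N.+1) chi n * n%:R^-1.

Lemma charL_cauchy N N' : (N <= N')%N -> `|charL N' - charL N| <= B / N.+1%:R.
Proof.
move=> NN; rewrite /charL (big_cat_nat (n := N.+1) (p := N'.+1)) //= [X in `|X|]addrC addKr.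
apply: abel_bound => //.
- by move=> n _; rewrite invr_ge0.
- by move=> [|n] // _; rewrite lef_pV2 ?posrE ?ltr0n // ler_nat.
- by move=> c; apply: char_sum_bound.
Qed.

(* [(1 - t) \sum_d chi d t^d / (1 - t^d)] differs from the partial sum of [L(1, chi)]
   by [\sum_d chi d c_d], where [c_d = 1 / d - t^d / (1 + .. + t^(d-1))] is
   nonincreasing; hence the bound by Abel summation.  The parameter [s] avoids
   half-integral powers of [t]. *)
Lemma lambert_bound (s t : R) (N : nat) : 0 < s < 1 -> t = s ^+ 2 ->
  (1 - t) * \sum_(1 <= n < N.+1) (\sum_(d <- divisors n) chi d) * t ^+ n <=
  `|charL N| + B * (1 - t) + N%:R * t ^+ N.
Proof.
move=> /andP[s0 s1] tE.
have t0 : 0 < t by rewrite tE exprn_gt0.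
have t1 : t < 1 by rewrite tE expr_lt1 // ltW.
pose sg d := \sum_(i < d) t ^+ i.
have sgE d : (1 - t) * sg d = 1 - t ^+ d by rewrite /sg -[1 - t]opprB mulNr -subrX1 opprB.
have sg1 d : (0 < d)%N -> 1 <= sg d.
  by case: d => // d _; rewrite /sg big_ord_recl expr0 lerDl sumr_ge0 // => i _; rewrite exprn_ge0 // ltW.
pose c d := d%:R^-1 - t ^+ d / sg d.
have sgd d : d.+1%:R * s ^+ d <= sg d.+1 by rewrite /sg tE; apply: geom_sqr_ge; apply: ltW.
(* [sg d] is at least [d s^(d-1)], and [t^d = s^(2d)] is at most [s^(d-1)]. *)
have c0 d : (0 < d)%N -> 0 <= c d.
  case: d => // d _; rewrite subr_ge0 ler_pdivrMr ?(lt_le_trans ltr01 (sg1 _ _)) //.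
  rewrite mulrC ler_pdivlMr ?ltr0n // mulrC.
  apply: le_trans (sgd d); rewrite ler_wpM2l ?ler0n // tE -exprM.
  by apply: ler_wiXn2l; rewrite ?ltW //; lia.
have cd d : (0 < d)%N -> c d.+1 <= c d.
  case: d => // d _; rewrite -subr_ge0 /c.
  have g1 : 0 < sg d.+1 by apply: lt_le_trans ltr01 (sg1 _ _).
  have g2 : 0 < sg d.+2 by apply: lt_le_trans ltr01 (sg1 _ _).
  have n1 : 0 < d.+1%:R :> R by rewrite ltr0n.
  have n2 : 0 < d.+2%:R :> R by rewrite ltr0n.
  (* Since [sg (n+1) = 1 + t sg n], the difference collapses to [t^n / (sg n sg (n+1))]; the bound
     [sgd] on both factors then compares it with [1 / (n (n+1))]. *)
  have e : t ^+ d.+1 / sg d.+1 - t ^+ d.+2 / sg d.+2 = t ^+ d.+1 / (sg d.+1 * sg d.+2).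
    have e2 : sg d.+2 - t * sg d.+1 = 1.
      have -> : sg d.+2 = 1 + t * sg d.+1.
        rewrite /sg big_ord_recl expr0; congr (_ + _); rewrite big_distrr.
        by apply: eq_bigr => i _; rewrite /= /bump leq0n add1n exprS.
      ring.
    rewrite -[in RHS](mulr1 (t ^+ d.+1)) -{1}e2 [t ^+ d.+2]exprS; field.
    by rewrite !gt_eqF.
  have -> : d.+1%:R^-1 - t ^+ d.+1 / sg d.+1 - (d.+2%:R^-1 - t ^+ d.+2 / sg d.+2) =
     (d.+1%:R * d.+2%:R)^-1 - (t ^+ d.+1 / sg d.+1 - t ^+ d.+2 / sg d.+2).
    have <- : d.+1%:R^-1 - d.+2%:R^-1 = (d.+1%:R * d.+2%:R)^-1 :> R.
      have H (x : R) : 0 < x -> 0 < x + 1 -> x^-1 - (x + 1)^-1 = (x * (x + 1))^-1.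
        by move=> x0 x1; field; rewrite !gt_eqF.
      by rewrite -[d.+2%:R]natr1 H // natr1.
    ring.
  rewrite e subr_ge0 ler_pdivrMr ?mulr_gt0 // mulrC ler_pdivlMr ?mulr_gt0 //.
  have := ler_pM (mulr_ge0 (ltW n1) (exprn_ge0 d (ltW s0)))
     (mulr_ge0 (ltW n2) (exprn_ge0 d.+1 (ltW s0))) (sgd d) (sgd d.+1).
  apply: le_trans; rewrite mulrACA mulrC ler_wpM2l ?mulr_ge0 ?ler0n //.
  by rewrite -exprD tE -exprM; apply: ler_wiXn2l; rewrite ?ltW //; clear; lia.
have h1 : `|\sum_(1 <= d < N.+1) chi d * c d| <= B * (1 - t).
  have -> : 1 - t = c 1%N.
    by rewrite /c /sg big_ord_recr big_ord0 /= expr0 add0r expr1 invr1 mulr1.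
  apply: abel_bound => // c'; exact: char_sum_bound.
have -> : \sum_(1 <= n < N.+1) (\sum_(d <- divisors n) chi d) * t ^+ n =
  \sum_(1 <= d < N.+1) \sum_(1 <= k < (N %/ d).+1) chi d * t ^+ (d * k).
  rewrite -sum_divisors_swap !big_nat; apply: eq_bigr => n /andP[n0 _].
  rewrite big_distrl /= !big_seq; apply: eq_bigr => d.
  by rewrite -dvdn_divisors // => dn; rewrite mulnC divnK.
(* Cutting the inner geometric series at [N %/ d] leaves an error with exponent
   [d * (N %/ d).+1 > N], hence at most [t ^+ N] for each [d]. *)
have step d : (1 <= d < N.+1)%N ->
   (1 - t) * \sum_(1 <= k < (N %/ d).+1) chi d * t ^+ (d * k) <=
   chi d * (t ^+ d / sg d) + t ^+ N.
  case/andP=> d0 dN; rewrite -big_distrr /=.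
  have g0 : 0 < sg d by apply: lt_le_trans ltr01 (sg1 _ _).
  have -> : \sum_(1 <= k < (N %/ d).+1) t ^+ (d * k) =
     t ^+ d * \sum_(k < N %/ d) (t ^+ d) ^+ k.
    rewrite big_add1 big_mkord big_distrr; apply: eq_bigr => k _.
    by rewrite /= -exprM -exprD mulnS.
  have e : (1 - t) * \sum_(k < N %/ d) (t ^+ d) ^+ k = (1 - (t ^+ d) ^+ (N %/ d)) / sg d.
    have: (1 - t ^+ d) * \sum_(k < N %/ d) (t ^+ d) ^+ k = 1 - (t ^+ d) ^+ (N %/ d).
      by rewrite -[1 - t ^+ d]opprB mulNr -subrX1 opprB.
    move=> <-; rewrite -sgE; field; by rewrite gt_eqF.
  have -> : (1 - t) * (chi d * (t ^+ d * \sum_(k < N %/ d) (t ^+ d) ^+ k)) =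
     chi d * (t ^+ d / sg d) - chi d * (t ^+ d * (t ^+ d) ^+ (N %/ d) / sg d).
    rewrite mulrCA [(1 - t) * _]mulrCA e; ring.
  rewrite lerD2l; apply: le_trans (ler_norm _) _; rewrite normrN normrM.
  rewrite -[leRHS]mul1r ler_pM //; first exact: sign_or_zero_norm.
  rewrite ger0_norm; last by rewrite divr_ge0 ?mulr_ge0 ?exprn_ge0 // ltW.
  rewrite -exprS -exprM ler_pdivrMr // -[leLHS]mulr1 ler_pM ?exprn_ge0 ?ler01 ?sg1 // ?(ltW t0) //.
  apply: ler_wiXn2l; rewrite ?ltW // ltnW // mulnC; exact: ltn_ceil.
rewrite big_distrr /=.
apply: (@le_trans _ _ (\sum_(1 <= d < N.+1) (chi d * (t ^+ d / sg d) + t ^+ N))).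
  by rewrite !big_nat; apply: ler_sum => d /step.
rewrite big_split /= sumr_const_nat subn1 /= [leRHS]addrC -[X in _ + X]mulr_natl [leRHS]addrC lerD2r.
have -> : \sum_(1 <= d < N.+1) chi d * (t ^+ d / sg d) =
   charL N - \sum_(1 <= d < N.+1) chi d * c d.
  by rewrite /charL -sumrB; apply: eq_bigr => d _; rewrite /c; ring.
apply: lerD; first exact: ler_norm.
by apply: le_trans (ler_norm _) _; rewrite normrN.
Qed.

(** With [t = (1 + h)^-1] and [N = 2 j], Bernoulli gives [(1 + h)^N >= (j h)^2], so both terms are
    [O(1 / j)]; [C] is the resulting threshold for [j]. *)
Lemma geometric_tail_small (t e : R) (N0 : nat) : 0 < t < 1 -> 0 < e ->
  exists2 N, (N0 <= N)%N & N%:R * t ^+ N + B / N.+1%:R <= e.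
Proof.
move=> /andP[t0 t1] e0.
pose h := t^-1 - 1.
have h0 : 0 < h by rewrite subr_gt0 invf_gt1.
have tE : t = (1 + h)^-1 by rewrite /h addrC subrK invrK.
pose C := (2 / h ^+ 2 + B) / e.
have B0 : 0 <= B by rewrite ler0n.
have C0 : 0 <= C by rewrite divr_ge0 ?addr_ge0 ?divr_ge0 ?sqr_ge0 ?ler0n // ltW.
pose j := (maxn N0 (Num.Def.archi_bound C)).+1.
have j0 : 0 < j%:R :> R by rewrite ltr0n.
have Cj : C < j%:R.
  apply: lt_le_trans (archi_boundP C0) _; rewrite ler_nat; exact: leqW (leq_maxr _ _).
exists j.*2; first by rewrite /j; move: (leq_maxl N0 (Num.Def.archi_bound C)); clear; lia.
have hj : 0 < j%:R * h by rewrite mulr_gt0.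
have h1 : j.*2%:R * t ^+ j.*2 <= 2 / h ^+ 2 / j%:R.
  have b1 : (j%:R * h) ^+ 2 <= (1 + h) ^+ j.*2.
    rewrite -muln2 exprM ler_pXn2r ?nnegrE ?exprn_ge0 ?(ltW hj) //; last first.
      by rewrite addr_ge0 // ltW.
    have : -1 <= h by lra.
    by move/bernoulli_ge => /(_ j); lra.
  have h10 : 0 < 1 + h by lra.
  rewrite tE exprVn ler_pdivrMr ?exprn_gt0 //.
  have -> : j.*2%:R = 2 / h ^+ 2 / j%:R * (j%:R * h) ^+ 2 :> R.
    by rewrite -mul2n natrM; field; rewrite !gt_eqF.
  by rewrite ler_wpM2l // !divr_ge0 ?sqr_ge0 ?ler0n.
have h2 : B / j.*2.+1%:R <= B / j%:R.
  by rewrite ler_wpM2l // lef_pV2 ?posrE ?ltr0n // ler_nat leqW // -addnn leq_addr.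
apply: le_trans (lerD h1 h2) _.
by rewrite -mulrDl ler_pdivrMr // [leRHS]mulrC -ler_pdivrMr // ltW.
Qed.

(* If [L(1, chi) = 0], the Lambert series stays bounded as [t] tends to 1, while the
   squares alone make it unbounded. *)
Lemma charL_not_small : ~ forall N, `|charL N| <= B / N.+1%:R.
Proof.
move=> small.
(* [K = 2 B + 1]: after division by [1 - t], the [K] squares, each contributing at least 1/2, give
   [B + 1/2] against an upper bound of [B + 1/4]. *)
pose K := (4 * M).+1.
have K0 : 0 < K%:R :> R by rewrite ltr0n.
(* By Bernoulli this [del] keeps [t ^+ (K ^ 2) = (1 - del) ^+ (2 * K ^ 2)] at least 1/2. *)
pose del : R := (4 * K%:R ^+ 2)^-1.
have K2 : 1 <= K%:R ^+ 2 :> R by rewrite -natrX ler1n.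
have d0 : 0 < del by rewrite invr_gt0 mulr_gt0 // exprn_gt0.
have d1 : del <= 4^-1.
  by rewrite lef_pV2 ?posrE ?mulr_gt0 ?exprn_gt0 //; lra.
pose s := 1 - del; pose t := s ^+ 2.
have s01 : 0 < s < 1 by apply/andP; split; rewrite /s; lra.
have [s0 s1] := andP s01.
have t01 : 0 < t < 1 by rewrite exprn_gt0 //= expr_lt1 // ltW.
have [t0 t1] := andP t01.
have tK : 2^-1 <= t ^+ (K ^ 2).
  have : -1 <= - del by lra.
  move/bernoulli_ge => /(_ (2 * K ^ 2)%N); rewrite exprM; apply: le_trans.
  by rewrite natrM natrX mulrN /del; 
    have -> : 2 * K%:R ^+ 2 * (4 * K%:R ^+ 2)^-1 = 2^-1 :> R
      by [field; rewrite gt_eqF]; lra.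
have main N : (K ^ 2 <= N)%N ->
    (1 - t) * (K%:R * 2^-1) <= `|charL N| + B * (1 - t) + N%:R * t ^+ N.
  move=> KN; apply: le_trans (lambert_bound N s01 (erefl t)).
  rewrite ler_wpM2l ?subr_ge0 ?(ltW t1) //.
  have f0 n : (0 < n)%N -> 0 <= (\sum_(d <- divisors n) chi d) * t ^+ n.
    by move=> n0; apply: mulr_ge0; [exact: sum_div_char_ge0 | rewrite exprn_ge0 // ltW].
  have le1 : K%:R * 2^-1 <= \sum_(1 <= m < K.+1)
      (\sum_(d <- divisors (m ^ 2)) chi d) * t ^+ (m ^ 2).
    have -> : K%:R * 2^-1 = \sum_(1 <= m < K.+1) (2^-1 : R).
      by rewrite sumr_const_nat subn1 /= mulr_natl.
    rewrite !big_nat; apply: ler_sum => m /andP[m0 mK].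
    rewrite -[leLHS]mul1r ler_pM ?ler01 ?invr_ge0 ?ler0n //.
      exact: sum_div_char_sqr.
    apply: le_trans tK _; apply: ler_wiXn2l; rewrite ?ltW //.
    by rewrite leq_exp2r.
  apply: le_trans le1 _; apply: le_trans (sum_squares_le K f0) _.
  by apply: sum_widen_le => // i; move/(leq_ltn_trans (leq0n _)); apply: f0.
have e0 : 0 < (1 - t) * 4^-1 by rewrite mulr_gt0 ?subr_gt0 ?invr_gt0.
have [N KN hN] := geometric_tail_small (K ^ 2) t01 e0.
have := le_trans (main N KN) (lerD (lerD (small N) (lexx _)) (lexx _)).
have KE : K%:R = 2 * B + 1 by rewrite /B natrM /K -natr1 natrM; ring.
rewrite KE => h.
have : (1 - t) * ((2 * B + 1) / 2) <= B * (1 - t) + (1 - t) * 4^-1 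
  by apply: (le_trans h); move: hN; move: (_ * t ^+ N) (B / _) (B * (1 - t)) (_ * 4^-1) => a b c e; lra.
have : 0 < 1 - t by rewrite subr_gt0.
by move: (1 - t) B => x b x0; lra.
Qed.

(** One partial sum larger than the Cauchy error at its index keeps all later ones away from 0; the
    limit L(1, chi) never has to be named. *)
Lemma charL_away : exists2 c, 0 < c & exists N0, forall N, (N0 <= N)%N -> c <= `|charL N|.
Proof.
have /existsNP[N0 /negP] := charL_not_small; rewrite -ltNge -subr_gt0 => c0.
exists (`|charL N0| - B / N0.+1%:R) => //; exists N0 => N NN.
have h1 := charL_cauchy NN; rewrite distrC in h1.
have h2 := le_trans (lerB_dist (charL N0) (charL N)) h1.
by rewrite lerBlDr addrC -lerBlDr.
Qed.
End NonVanishing.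

(** * Von Mangoldt sums *)

Section VonMangoldt.
Variable (R : realType).
Local Notation lnn n := (ln (n%:R : R)).

Lemma lnn_ge0 n : 0 <= lnn n.
Proof. by case: n => [|n]; [rewrite ln0 | rewrite ln_ge0 ?ler1n]. Qed.

Lemma lnnM m n : (0 < m)%N -> (0 < n)%N -> lnn (m * n) = lnn m + lnn n.
Proof. by move=> m0 n0; rewrite natrM lnM // posrE ltr0n. Qed.

Lemma lnn_le m n : (m <= n)%N -> lnn m <= lnn n.
Proof.
case: m => [|m] mn; first by rewrite ln0 // lnn_ge0.
by rewrite ler_ln ?posrE ?ltr0n ?ler_nat // (leq_trans _ mn).
Qed.

Lemma lnnS n : (0 < n)%N -> lnn n.+1 <= lnn n + n%:R^-1.
Proof.
move=> n0; have h : 0 < n%:R :> R by rewrite ltr0n.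
have -> : n.+1%:R = n%:R * (1 + n%:R^-1) :> R by rewrite mulrDr mulr1 divff ?gt_eqF // natr1.
have h1 : 0 < n%:R^-1 :> R by rewrite invr_gt0.
rewrite lnM ?posrE ?addr_gt0 // lerD2l; apply: le_ln1Dx; lra.
Qed.

(* [primes n = [:: r]] holds exactly for the positive powers of [r]. *)
Definition mangoldt (n : nat) : R := if primes n is [:: r] then lnn r else 0.

Lemma mangoldt_ge0 n : 0 <= mangoldt n.
Proof. by rewrite /mangoldt; case: (primes n) => [|a [|b l]] //; apply: lnn_ge0. Qed.

Lemma mangoldt_pfactor p k : prime p -> mangoldt (p ^ k.+1) = lnn p.
Proof. by move=> pp; rewrite /mangoldt primesX // primes_prime. Qed.

Lemma mangoldt_mul p k d : prime p -> (1 < d)%N -> ~~ (p %| d)%N ->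
  mangoldt (p ^ k.+1 * d) = 0.
Proof.
move=> pp d1 pd; rewrite /mangoldt.
have d0 : (0 < d)%N by apply: ltnW.
have pk : (0 < p ^ k.+1)%N by rewrite expn_gt0 prime_gt0.
have h1 : p \in primes (p ^ k.+1 * d).
  by rewrite mem_primes pp muln_gt0 pk d0 dvdn_mulr // dvdn_exp.
have h2 : pdiv d \in primes (p ^ k.+1 * d).
  by rewrite mem_primes pdiv_prime // muln_gt0 pk d0 dvdn_mull // pdiv_dvd.
move: h1 h2; case: (primes _) => [|a [|b l]] //.
rewrite !inE => /eqP <- /eqP e; by move: pd; rewrite -e pdiv_dvd.
Qed.

Lemma sum_mangoldt n : (0 < n)%N -> \sum_(d <- divisors n) mangoldt d = lnn n.
Proof.
move: n; apply: pfactor_ind; first by rewrite big_seq1 /mangoldt /= ln1.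
move=> p k m pp m0 pm IH.
have p0 := prime_gt0 pp.
rewrite lnnM ?expn_gt0 ?p0 //.
suff -> : \sum_(d <- divisors (p ^ k * m)) mangoldt d = lnn (p ^ k) + lnn m by [].
elim: k => [|k IHk]; first by rewrite expn0 mul1n IH ln1 add0r.
rewrite (perm_big _ (perm_divisorsM_step k pp m0 pm)) big_cat /= IHk big_map.
rewrite [in RHS]expnS lnnM ?expn_gt0 ?p0 //.
suff -> : \sum_(d <- divisors m) mangoldt (p ^ k.+1 * d) = lnn p by ring.
rewrite (bigD1_seq 1%N) ?divisors_uniq ?divisor1 //= muln1 mangoldt_pfactor //.
rewrite big_seq_cond big1 ?addr0 // => d /andP[]; rewrite -dvdn_divisors // => dm d1.
rewrite mangoldt_mul //.
  by rewrite ltn_neqAle eq_sym d1 (dvdn_gt0 m0 dm).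
by apply: contra pm => pd; apply: dvdn_trans pd dm.
Qed.

Lemma mangoldt_neq0 n : mangoldt n != 0 -> 
  exists r k, [/\ prime r, n = (r ^ k.+1)%N & mangoldt n = lnn r].
Proof.
rewrite {1}/mangoldt; case E: (primes n) => [|r [|b l]]; rewrite ?eqxx // => _.
have : r \in primes n by rewrite E mem_head.
rewrite mem_primes => /and3P[pr n0 rn].
have [m rm e] := pfactor_coprime pr n0.
exists r, (logn r n).-1.
have l0 : (0 < logn r n)%N by rewrite logn_gt0 E mem_head.
suff m1 : m = 1%N.
  by split => //; [rewrite prednK // {1}e m1 mul1n | rewrite /mangoldt E].
apply/eqP; rewrite eqn_leq; apply/andP; split; last by move: n0; rewrite e; case: (m).
rewrite leqNgt; apply/negP => m1.
have : pdiv m \in primes n.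
  by rewrite mem_primes pdiv_prime // n0 e dvdn_mulr // pdiv_dvd.
rewrite E inE => /eqP pm; move: rm; rewrite prime_coprime // => /negP; apply.
by rewrite -pm pdiv_dvd.
Qed.

Definition logfact N : R := \sum_(1 <= n < N.+1) lnn n.

Lemma logfactE N : logfact N = lnn N`!.
Proof.
rewrite /logfact; elim: N => [|N IH]; first by rewrite big_geq // fact0 ln1.
by rewrite big_nat_recr //= IH factS lnnM ?fact_gt0 // addrC.
Qed.

Lemma logfact_mangoldt N : logfact N = \sum_(1 <= d < N.+1) mangoldt d * (N %/ d)%:R.
Proof.
have -> : logfact N = \sum_(1 <= n < N.+1) \sum_(d <- divisors n) mangoldt d.
  by rewrite /logfact !big_nat; apply: eq_bigr => n /andP[n0 _]; rewrite sum_mangoldt.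
rewrite (sum_divisors_swap (fun d _ => mangoldt d)).
by apply: eq_bigr => d _; rewrite sumr_const_nat subn1 /= mulr_natr.
Qed.

Definition chebyshev N : R := \sum_(1 <= n < N.+1) mangoldt n.

(** The integer [2N %/ d - 2 (N %/ d)] is nonnegative, and positive for [N < d <= 2N]. Hence the
    increment is at most the logarithm of the central binomial coefficient, which is at most
    [4 ^ N]. *)
Lemma chebyshev_double N : chebyshev N.*2 <= chebyshev N + N%:R * lnn 4.
Proof.
have h1 : chebyshev N.*2 - chebyshev N <= logfact N.*2 - logfact N - logfact N.
  have NN : (N.+1 <= N.*2.+1)%N by lia.
  have e : logfact N = \sum_(1 <= d < N.*2.+1) mangoldt d * (N %/ d)%:R.
    rewrite logfact_mangoldt [RHS](big_cat_nat (n := N.+1)) //=.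
    rewrite [X in _ = _ + X]big_nat [X in _ = _ + X]big1 ?addr0 // => i /andP[Ni _].
    by rewrite divn_small // mulr0.
  rewrite logfact_mangoldt e -!sumrB /chebyshev.
  rewrite [X in X - _](big_cat_nat (n := N.+1)) //= [leLHS]addrC addKr.
  rewrite [leRHS](big_cat_nat (n := N.+1)) //= -[leLHS]add0r; apply: lerD.
    rewrite big_nat; apply: sumr_ge0 => d /andP[d0 _]; rewrite -!mulrBr mulr_ge0 ?mangoldt_ge0 //.
    rewrite -addrA -opprD -natrD subr_ge0 ler_nat addnn -mul2n -[N.*2]mul2n.
    by rewrite leq_divRL // -mulnA leq_mul2l leq_divM.
  rewrite !big_nat; apply: ler_sum => d /andP[Nd dN].
  rewrite -!mulrBr -[leLHS]mulr1 ler_wpM2l ?mangoldt_ge0 //.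
  rewrite (@divn_small N d) // !subr0 ler1n divn_gt0; lia.
have h2 : logfact N.*2 - logfact N - logfact N <= N%:R * lnn 4.
  have /(congr1 (fun n => lnn n)) := @bin_fact N.*2 N ltac:(lia).
  have -> : (N.*2 - N = N)%N by lia.
  rewrite !lnnM ?muln_gt0 ?fact_gt0 ?bin_gt0; try lia.
  rewrite -!logfactE => <-.
  have -> : N%:R * lnn 4 = lnn (2 ^ N.*2).
    by rewrite -mul2n expnM natrX lnXn ?ltr0n // mulr_natl.
  set a := logfact N; set b := lnn 'C(_, _).
  have -> : b + (a + a) - a - a = b by ring.
  apply: lnn_le; rewrite -[2%N]/(1 + 1)%N expnDn (bigD1 (inord N)) //=.
  by rewrite inordK ?exp1n ?muln1 ?leq_addr //; lia.
lra.
Qed.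

(** Doubling reaches only the powers of two; this is why the later sums are cut at [2 ^ i]. *)
Lemma chebyshev_pow2 i : chebyshev (2 ^ i) <= (2 ^ i)%:R * lnn 4.
Proof.
elim: i => [|i IH].
  by rewrite expn0 /chebyshev big_nat1 mul1r lnn_ge0.
rewrite expnS mul2n; apply: le_trans (chebyshev_double _) _.
by rewrite -addnn natrD mulrDl lerD2r.
Qed.

Lemma mangoldt_div_unbounded (C : R) : exists i0, forall i, (i0 <= i)%N ->
  C < \sum_(1 <= n < (2 ^ i).+1) mangoldt n * n%:R^-1.
Proof.
have ln2 : 0 < lnn 2 by rewrite ln_gt0 // ltr1n.
(* The upper half of the factors of the factorial of [2 ^ i.+1] already gives [2 ^ i * (i * ln 2)],
   while its logarithm is at most [2 ^ i.+1] times the sum to be bounded. *)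
have main i : i%:R * (lnn 2 / 2) <= \sum_(1 <= n < (2 ^ i.+1).+1) mangoldt n * n%:R^-1.
  have N0 : 0 < (2 ^ i)%:R :> R by rewrite ltr0n expn_gt0.
  have h1 : (2 ^ i)%:R * (i%:R * lnn 2) <= logfact (2 ^ i.+1).
    rewrite /logfact (big_cat_nat (n := (2 ^ i).+1)) //=; last by rewrite ltnS leq_exp2l.
    rewrite -[leLHS]add0r; apply: lerD; first by apply: sumr_ge0 => n _; apply: lnn_ge0.
    have -> : (2 ^ i)%:R * (i%:R * lnn 2) =
        \sum_((2 ^ i).+1 <= n < (2 ^ i.+1).+1) i%:R * lnn 2.
      rewrite sumr_const_nat -[RHS]mulr_natl; congr (_%:R * _); rewrite expnS; lia.
    rewrite !big_nat; apply: ler_sum => n /andP[n1 n2].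
    by rewrite mulr_natl -lnXn ?ltr0n // -natrX lnn_le // ltnW.
  have h2 : logfact (2 ^ i.+1) <=
     (2 ^ i.+1)%:R * \sum_(1 <= n < (2 ^ i.+1).+1) mangoldt n * n%:R^-1.
    rewrite logfact_mangoldt big_distrr /= !big_nat; apply: ler_sum => n /andP[n0 _].
    rewrite mulrCA ler_wpM2l ?mangoldt_ge0 // ler_pdivlMr ?ltr0n //.
    by rewrite -natrM ler_nat leq_divM.
  have := le_trans h1 h2; move: (\sum_(1 <= n < _) _) => x.
  rewrite expnS natrM [2%:R * _]mulrC -[in leRHS]mulrA ler_pM2l //.
  lra.
pose j := Num.Def.archi_bound (`|C| / (lnn 2 / 2)).
have hj : `|C| < j%:R * (lnn 2 / 2).
  by rewrite -ltr_pdivrMr ?divr_gt0 // archi_boundP // divr_ge0 ?normr_ge0 ?divr_ge0 // ltW.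
exists j.+1 => -[//|i]; rewrite ltnS => ji.
apply: le_lt_trans (ler_norm _) _; apply: lt_le_trans hj _.
apply: le_trans (main i); rewrite ler_wpM2r ?ler_nat // divr_ge0 // ltW //.
Qed.

Lemma sum_geom_from2 (r J : nat) : (1 < r)%N ->
  \sum_(2 <= j < J.+1) (r%:R ^- j : R) <= (r%:R * (r%:R - 1))^-1.
Proof.
move=> r1; case: J => [|J].
  by rewrite big_geq // invr_ge0 mulr_ge0 ?ler0n // subr_ge0 ler1n ltnW.
have r2 : 2 <= r%:R :> R by rewrite ler_nat.
have x1 : 0 < r%:R :> R by lra.
have x2 : 0 < r%:R - 1 :> R by lra.
suff -> : \sum_(2 <= j < J.+2) (r%:R ^- j : R) =
    (r%:R * (r%:R - 1))^-1 * (1 - r%:R ^- J).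
  rewrite ler_piMr ?invr_ge0 ?mulr_ge0 ?(ltW x1) ?(ltW x2) //.
  by rewrite gerBl invr_ge0 exprn_ge0 // ltW.
elim: J => [|J IH]; first by rewrite big_geq // expr0 invr1 subrr mulr0.
rewrite big_nat_recr //= IH !exprS; field.
by rewrite expf_neq0 ?gt_eqF.
Qed.

(* The summand is at most [g (r - 1) - g r] with [g r = (ln r + 2) / r]. *)
Lemma sum_ln_telescope (N : nat) :
  \sum_(2 <= r < N.+1) lnn r / (r%:R * (r%:R - 1)) <= 2.
Proof.
pose g r := (lnn r + 2) / r%:R.
have step r : (0 < r)%N -> lnn r.+1 / (r.+1%:R * (r.+1%:R - 1)) <= g r - g r.+1.
  move=> r0; have x1 : 1 <= r%:R :> R by rewrite ler1n.
  rewrite -natr1 addrK ler_pdivrMr; last by rewrite mulr_gt0; lra.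
  have -> : (g r - g r.+1) * ((r%:R + 1) * r%:R) =
      (lnn r + 2) * (r%:R + 1) - (lnn r.+1 + 2) * r%:R.
    by rewrite /g -natr1; field; apply/andP; split; rewrite gt_eqF; lra.
  have h := lnnS r0; have := ler_wpM2r (ler0n R r) h.
  rewrite mulrDl mulVf; last by rewrite gt_eqF; lra.
  rewrite -natr1 in h *.
  have h2 : r%:R^-1 <= 1 :> R by rewrite invf_le1; lra.
  move: x1 h h2; set x := r%:R; move: (x^-1) => c; move: (ln (x + 1)) => a; move: (ln x) => b.
  move=> x1 h h2 h3.
  lra.
case: N => [|[|N]]; [by rewrite big_geq | by rewrite big_geq |].
have : \sum_(2 <= r < N.+3) lnn r / (r%:R * (r%:R - 1)) <= g 1%N - g N.+2.
  elim: N => [|N IH]; first by rewrite big_nat1 step.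
  rewrite big_nat_recr //=; apply: le_trans (lerD IH (step N.+2 _)) _ => //.
  lra.
have : 0 <= g N.+2.
  by apply: divr_ge0; [apply: addr_ge0; [exact: lnn_ge0 | exact: ler0n] | exact: ler0n].
rewrite {2}/g ln1 add0r divr1; lra.
Qed.

(** Proper prime powers contribute a bounded amount, so the divergence of the sum of
    [mangoldt n / n] comes from the primes. The majorant runs over all powers [r ^ j] with
    [r, j >= 2], whether [r] is prime or not. *)
Lemma mangoldt_nonprime_bound (N : nat) :
  \sum_(1 <= n < N.+1 | ~~ prime n) mangoldt n * n%:R^-1 <= 2.
Proof.
apply: le_trans (sum_ln_telescope N).
pose E n r j : R := if (n == r ^ j)%N then lnn r * r%:R ^- j else 0.
have E0 n r j : 0 <= E n r j.
  rewrite /E; case: ifP => // _; rewrite mulr_ge0 ?lnn_ge0 // invr_ge0 exprn_ge0 //.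
apply: (@le_trans _ _ (\sum_(1 <= n < N.+1) \sum_(2 <= r < N.+1) \sum_(2 <= j < N.+1) E n r j)).
  rewrite big_mkcond /= !big_nat; apply: ler_sum => n /andP[n0 nN].
  case: ifP => np; last by do 2![apply: sumr_ge0 => ? _].
  have [->|nz] := eqVneq (mangoldt n) 0.
    by rewrite mul0r; do 2![apply: sumr_ge0 => ? _].
  have [r [k [pr e ->]]] := mangoldt_neq0 nz.
  have k0 : (0 < k)%N by case: k e np => // e; rewrite e expn1 pr.
  have r1 := prime_gt1 pr.
  have rn : (r < N.+1)%N.
    by apply: leq_ltn_trans nN; rewrite e -{1}[r]expn1 leq_exp2l.
  have kn : (k.+1 < N.+1)%N by apply: leq_trans nN; rewrite ltnS e ltnW // ltn_expl.
  rewrite (bigD1_seq r) ?mem_index_iota ?iota_uniq ?r1 //=.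
  rewrite (bigD1_seq k.+1) ?mem_index_iota ?iota_uniq ?kn ?andbT //=.
  rewrite {1}/E -e eqxx -natrX -e -addrA lerDl addr_ge0 //.
    by apply: sumr_ge0.
  by apply: sumr_ge0 => ? _; apply: sumr_ge0.
rewrite exchange_big_nat /= !big_nat; apply: ler_sum => r /andP[r1 rN].
rewrite exchange_big_nat /= -[leRHS]/(_ * _).
apply: le_trans (ler_wpM2l (lnn_ge0 r) (sum_geom_from2 N r1)).
rewrite big_distrr /= !big_nat; apply: ler_sum => j /andP[j2 jN].
rewrite /E; case: (boolP ((r ^ j)%N \in index_iota 1 N.+1)) => hj.
  rewrite (bigD1_seq (r ^ j)%N) ?iota_uniq //= eqxx big1 ?addr0 // => i.
  by move/negPf ->.
rewrite big_seq big1 ?mulr_ge0 ?lnn_ge0 ?invr_ge0 ?exprn_ge0 // => i hi.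
by case: eqP => // ei; move: hj; rewrite -ei hi.
Qed.

Section LogSum.
Variable (chi : nat -> R) (M : nat).
Hypothesis M0 : (0 < M)%N.
Hypothesis chi1 : chi 1%N = 1.
Hypothesis chiM : forall m n, chi (m * n)%N = chi m * chi n.
Hypothesis chiT : forall n, sign_or_zero (chi n).
Hypothesis chi_per : forall n, chi (n + M)%N = chi n.
Hypothesis chi_sum : \sum_(0 <= n < M) chi n = 0.
Let B : R := (2 * M)%:R.

Lemma char_ln_bound : exists C : R, exists n0, forall N, (n0 <= N)%N ->
  `|\sum_(1 <= n < N.+1) chi n * (lnn n * n%:R^-1)| <= C.
Proof.
(* Beyond e the function [ln n / n] decreases, so Abel summation applies from there on. *)
pose n0 := (Num.Def.archi_bound (expR 1 : R)).+1.
have ln1' n : (n0 <= n)%N -> 1 <= lnn n.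
  move=> h; rewrite -[leLHS]expRK.
  rewrite ler_ln ?posrE ?expR_gt0 ?ltr0n ?(leq_trans _ h) //.
  apply: le_trans (ltW (archi_boundP (ltW (expR_gt0 _)))) _.
  by rewrite ler_nat ltnW // (leq_trans _ h).
have wd n : (n0 <= n)%N -> lnn n.+1 * n.+1%:R^-1 <= lnn n * n%:R^-1.
  move=> h; have n1 : (0 < n)%N by apply: leq_trans h.
  rewrite ler_pdivrMr ?ltr0n // mulrAC ler_pdivlMr ?ltr0n //.
  have := ler_wpM2r (ler0n R n) (lnnS n1); rewrite mulrDl mulVf ?pnatr_eq0 ?gtn_eqF //.
  move/le_trans; apply; rewrite -natr1 mulrDr mulr1 lerD2l; exact: ln1'.
exists (`|\sum_(1 <= n < n0) chi n * (lnn n * n%:R^-1)| + B * (lnn n0 * n0%:R^-1)), n0.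
move=> N h; rewrite (big_cat_nat (n := n0)) //=; last exact: leqW.
apply: le_trans (ler_normD _ _) _; rewrite lerD2l.
apply: abel_bound => //; last exact: leqW.
- by move=> n _; rewrite mulr_ge0 ?lnn_ge0 ?invr_ge0.
- by move=> c; apply: (char_sum_bound M0).
Qed.

(** Mertens's argument: [ln] is the convolution of [mangoldt] with 1, so the bounded sum of
    [chi n ln n / n] is that of [chi d mangoldt d / d] weighted by [charL chi (N %/ d)]. Replacing
    the weights by [charL chi N] costs at most [B / N] times [mangoldt d] for each [d], in total a
    Chebyshev bound; then one divides by [charL chi N], which stays away from 0. *)
Lemma char_mangoldt_bound : exists C : R, exists i0, forall i, (i0 <= i)%N ->
  `|\sum_(1 <= n < (2 ^ i).+1) chi n * (mangoldt n * n%:R^-1)| <= C.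
Proof.
have [c c0 [N0 hc]] := charL_away M0 chi1 chiM chiT chi_per chi_sum.
have [C1 [N1 hC1]] := char_ln_bound.
exists ((C1 + B * lnn 4) / c), (maxn N0 N1) => i hi.
set N := (2 ^ i)%N.
have iN : (i < N)%N by apply: ltn_expl.
have /hc cL : (N0 <= N)%N by lia.
have /hC1 F1 : (N1 <= N)%N by lia.
have N00 : 0 < N%:R :> R by rewrite ltr0n (leq_ltn_trans _ iN).
rewrite ler_pdivlMr //.
apply: le_trans (ler_wpM2l (normr_ge0 _) cL) _; rewrite -normrM.
have e : \sum_(1 <= n < N.+1) chi n * (lnn n * n%:R^-1) =
   \sum_(1 <= d < N.+1) chi d * (mangoldt d * d%:R^-1) * charL chi (N %/ d).
  pose G d k : R := mangoldt d * (chi (d * k)%N * ((d * k)%:R)^-1).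
  transitivity (\sum_(1 <= n < N.+1) \sum_(d <- divisors n) G d (n %/ d)%N).
    rewrite !big_nat; apply: eq_bigr => n /andP[n0 _].
    rewrite -sum_mangoldt // mulrCA big_distrl /= !big_seq; apply: eq_bigr => d.
    by rewrite -dvdn_divisors // => dn; rewrite /G mulnC divnK.
  rewrite sum_divisors_swap; apply: eq_bigr => d _.
  rewrite /charL big_distrr; apply: eq_bigr => k _.
  by rewrite /G chiM natrM invfM /=; ring.
have -> : (\sum_(1 <= n < N.+1) chi n * (mangoldt n * n%:R^-1)) * charL chi N =
  \sum_(1 <= n < N.+1) chi n * (lnn n * n%:R^-1) +
  \sum_(1 <= d < N.+1) chi d * (mangoldt d * d%:R^-1) * (charL chi N - charL chi (N %/ d)).
  rewrite e -big_split big_distrl /=; apply: eq_bigr => d _.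
  by rewrite -mulrDr addrC subrK.
apply: le_trans (ler_normD _ _) (lerD F1 _).
apply: le_trans (ler_norm_sum _ _ _) _.
apply: (@le_trans _ _ (\sum_(1 <= d < N.+1) mangoldt d * (B / N%:R))).
  rewrite !big_nat; apply: ler_sum => d /andP[d0 dN].
  have dR : 0 < d%:R :> R by rewrite ltr0n.
  rewrite normrM normrM -mulrA.
  rewrite -[leRHS]mul1r ler_pM ?mulr_ge0 //; first exact: sign_or_zero_norm.
  rewrite ger0_norm ?mulr_ge0 ?mangoldt_ge0 ?invr_ge0 ?ler0n // -mulrA.
  rewrite ler_wpM2l ?mangoldt_ge0 // mulrC ler_pdivrMr //.
  apply: le_trans (charL_cauchy M0 chiT chi_per chi_sum (leq_div N d)) _.
  rewrite mulrAC ler_pdivlMr // mulrAC ler_pdivrMr ?ltr0n // -!mulrA ler_wpM2l ?ler0n //.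
  by rewrite -natrM ler_nat ltnW // mulnC ltn_ceil.
rewrite -big_distrl /= mulrCA ler_wpM2l ?ler0n // ler_pdivrMr // mulrC.
exact: chebyshev_pow2.
Qed.
End LogSum.
End VonMangoldt.

(** * Primes with prescribed values of quadratic characters *)

Section QuadraticDirichlet.
Variables (R : realType) (I : finType) (chi : I -> nat -> R) (M n0 : nat).
Hypothesis M0 : (0 < M)%N.
Hypothesis chiM : forall i m n, chi i (m * n)%N = chi i m * chi i n.
Hypothesis chiT : forall i n, coprime n M -> chi i n = 1 \/ chi i n = -1.
Hypothesis chi_per : forall i n, chi i (n + M)%N = chi i n.
Hypothesis n0M : coprime n0 M.

Let psi (S : {set I}) n : R := if coprime n M then \prod_(i in S) chi i n else 0.

Let psiM S m n : psi S (m * n) = psi S m * psi S n.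
Proof.
rewrite /psi coprimeMl; case: (coprime m M); rewrite ?mul0r //=.
case: (coprime n M); rewrite ?mulr0 // -big_split /=.
by apply: eq_bigr => i _; rewrite chiM.
Qed.

Let psi_pm S n : coprime n M -> psi S n = 1 \/ psi S n = -1.
Proof.
rewrite /psi => nM; rewrite nM.
elim/big_ind: _ => [|x y [->|->] [->|->]|i _]; rewrite ?mul1r ?mulr1 ?mulrNN ?mulr1;
  by [left|right|apply: chiT].
Qed.

Let psiT S n : sign_or_zero (psi S n).
Proof.
case: (boolP (coprime n M)) => nM; last by rewrite /psi (negPf nM); constructor 1.
by case: (psi_pm S nM) => ->; [constructor 2|constructor 3].
Qed.

Let psi1 S : psi S 1 = 1.
Proof.
have h := psiM S 1 1; rewrite muln1 in h.
have [//|e] : psi S 1 = 1 \/ psi S 1 = -1 by apply: psi_pm; rewrite coprime1n.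
by rewrite h e mulrNN mulr1.
Qed.

Let psi_per S n : psi S (n + M) = psi S n.
Proof.
by rewrite /psi /coprime gcdnC gcdnDr gcdnC; case: ifP => // _; apply: eq_bigr => i _; rewrite chi_per.
Qed.

(** Multiplication by [n1] permutes the residues modulo [M] and changes the sign of the sum. *)
Let psi_sum S n1 : psi S n1 = -1 -> \sum_(0 <= n < M) psi S n = 0.
Proof.
move=> e; have n1M : coprime n1 M.
  move: e; rewrite /psi; case: ifP => // _ /eqP.
  by rewrite eq_sym oppr_eq0 oner_eq0.
have per k n : psi S (n + k * M) = psi S n.
  by elim: k => [|k IH]; rewrite ?addn0 // mulSn addnCA addnC psi_per IH.
rewrite big_mkord; set s := \sum_(_ < _) _.
suff : s = - s by move=> h; lra.
pose f (n : 'I_M) := Ordinal (ltn_pmod (n1 * n) M0).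
have fI : injective f.
  move=> a b /(congr1 val) /= /eqP h; apply/val_inj => /=.
  wlog ab : a b h / (b <= a)%N.
    move=> w; case/orP: (leq_total a b) => ab; last exact: w.
    by apply/esym/w => //; rewrite eq_sym.
  move: h; rewrite eqn_mod_dvd ?leq_mul2l ?ab ?orbT // -mulnBr.
  rewrite Gauss_dvdr 1?coprime_sym // => /dvdn_leq h.
  have aM := ltn_ord a; apply/eqP; rewrite eqn_leq ab andbT leqNgt; apply/negP => ba.
  have := h ltac:(lia); lia.
rewrite {1}/s (reindex_inj fI) /= -sumrN; apply: eq_bigr => n _.
have <- : psi S (n1 * n) = - psi S n by rewrite psiM e mulN1r.
by rewrite [in RHS](divn_eq (n1 * n) M) addnC per.
Qed.

Let mang := @mangoldt R.

Lemma psi_mangoldt_bound S : (exists n1, psi S n1 = -1) ->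
  exists C : R, exists i0, forall i, (i0 <= i)%N ->
  `|\sum_(1 <= n < (2 ^ i).+1) psi S n * (mang n * n%:R^-1)| <= C.
Proof.
case=> n1 e; apply: (char_mangoldt_bound M0 (psi1 S)) => //.
by apply: psi_sum e.
Qed.

(** Either [psi S] takes the value -1 and the sum is bounded, or its values are 0 and 1 and all
    terms are nonnegative. Trivial products thus never have to be told apart from the others. *)
Lemma psi_mangoldt_lower S : exists C : R, exists i0, forall i, (i0 <= i)%N ->
  C <= psi S n0 * \sum_(1 <= n < (2 ^ i).+1) psi S n * (mang n * n%:R^-1).
Proof.
have [/psi_mangoldt_bound [C [i0 h]]|no] := pselect (exists n1, psi S n1 = -1).
  exists (- C), i0 => i /h; rewrite ler_norml.
  by case: (psi_pm S n0M) => ->; lra.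
exists 0, 0%N => i _; have [->|e] := psi_pm S n0M; last by case: no; exists n0.
rewrite mul1r; apply: sumr_ge0 => n _; rewrite mulr_ge0 ?mulr_ge0 ?mangoldt_ge0 ?invr_ge0 //.
case: (psiT S n) => e; rewrite e ?ler01 //.
by case: no; exists n.
Qed.

(* Orthogonality: [\prod_i (1 + chi i n0 * chi i n)] is a combination of the products
   of the [chi i]; the ones that are trivial contribute a divergent nonnegative sum,
   the others stay bounded. *)
Theorem quadratic_dirichlet :
  exists r, [/\ prime r, coprime r M & forall i, chi i r = chi i n0].
Proof.
apply: contrapT => no.
pose A S N := \sum_(1 <= n < N.+1) psi S n * (mang n * n%:R^-1).
have mang0 n : 0 <= mang n * n%:R^-1 by rewrite mulr_ge0 ?mangoldt_ge0 ?invr_ge0.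
have lower (s : seq {set I}) : exists C : R, exists i0, forall i, (i0 <= i)%N ->
    C <= \sum_(S <- s) psi S n0 * A S (2 ^ i)%N.
  elim: s => [|S s [C [i0 h]]]; first by exists 0, 0%N => i _; rewrite big_nil.
  have [C' [i1 h']] := psi_mangoldt_lower S.
  exists (C' + C), (maxn i1 i0) => i; rewrite geq_max => /andP[i1i i0i].
  by rewrite big_cons lerD ?h ?h'.
(* At a prime [n] the sum over [S] vanishes: every [psi S n] is 0 if [n] is not coprime to [M], and
   otherwise [no] makes some factor [chi i n0 * chi i n + 1] zero. Only nonprime [n] remain. *)
have upper N : \sum_(S : {set I}) psi S n0 * A S N <= #|{set I}|%:R * 2.
  have -> : \sum_(S : {set I}) psi S n0 * A S N =
     \sum_(1 <= n < N.+1) (\sum_(S : {set I}) psi S n0 * psi S n) * (mang n * n%:R^-1).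
    under [RHS]eq_bigr do rewrite big_distrl.
    rewrite exchange_big /=; apply: eq_bigr => S _; rewrite big_distrr.
    by apply: eq_bigr => n _; rewrite /= mulrA.
  apply: le_trans (ler_wpM2l (ler0n _ _) (mangoldt_nonprime_bound R N)).
  rewrite big_distrr /= [leRHS]big_mkcond /=; apply: ler_sum => n _.
  case: ifP => [np|/negbFE pn].
    rewrite ler_wpM2r //; apply: le_trans (_ : \sum_(S : {set I}) 1 <= _).
      apply: ler_sum => S _; apply: le_trans (ler_norm _) _.
      exact/sign_or_zero_norm/sign_or_zeroM.
    by rewrite sumr_const.
  suff -> : \sum_(S : {set I}) psi S n0 * psi S n = 0 by rewrite mul0r.
  case: (boolP (coprime n M)) => nM; last first.
    by apply: big1 => S _; rewrite /psi (negPf nM) mulr0.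
  have [i hi] : exists i, chi i n <> chi i n0.
    by apply/existsNP => h; apply: no; exists n.
  transitivity (\prod_i (chi i n0 * chi i n + 1)).
    rewrite bigA_distr; apply: eq_bigr => S _.
    rewrite /psi nM n0M -big_split big_mkcond /=.
    by apply: eq_bigr => j _; case: ifP.
  rewrite (bigD1 i) //=.
  have [e|e] := chiT i nM; have [e'|e'] := chiT i n0M; rewrite e e' in hi *;
    rewrite ?mulr1 ?mul1r ?addNr ?mul0r //; by case: hi.
pose D := \sum_(1 <= n < M.+1) mang n * n%:R^-1.
(* [psi set0] is the principal character and equals 1 at every prime beyond [M]: [D] pays for the
   integers up to [M], and 2 for the nonprime ones. *)
have trivial_lower N : (M <= N)%N ->
    \sum_(1 <= n < N.+1) mang n * n%:R^-1 - D - 2 <= psi set0 n0 * A set0 N.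
  move=> MN.
  have -> : psi set0 n0 = 1 by rewrite /psi n0M big_set0.
  rewrite mul1r /A /D (big_cat_nat (n := M.+1)) //= [leLHS]addrAC.
  rewrite [X in X - _]addrC -!addrA addrCA addrA.
  rewrite [leRHS](big_cat_nat (n := M.+1)) //=.
  have h1 : 0 <= \sum_(1 <= n < M.+1) psi set0 n * (mang n * n%:R^-1).
    apply: sumr_ge0 => n _; rewrite mulr_ge0 // /psi big_set0.
    by case: ifP.
  have h2 : \sum_(M.+1 <= n < N.+1) (mang n * n%:R^-1) <=
     \sum_(M.+1 <= n < N.+1) psi set0 n * (mang n * n%:R^-1) +
     \sum_(M.+1 <= n < N.+1 | ~~ prime n) (mang n * n%:R^-1).
    rewrite [X in _ + X]big_mkcond -big_split /= !big_nat; apply: ler_sum => n /andP[Mn _].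
    case: (boolP (prime n)) => pn /=; last first.
      by rewrite lerDr mulr_ge0 // /psi big_set0; case: ifP.
    rewrite addr0 /psi big_set0 prime_coprime // gtnNdvd // mul1r //.
  have h3 : \sum_(M.+1 <= n < N.+1 | ~~ prime n) (mang n * n%:R^-1) <= 2.
    apply: le_trans (mangoldt_nonprime_bound R N).
    rewrite [leRHS](big_cat_nat (n := M.+1)) //= lerDr.
    exact: sumr_ge0.
  lra.
have [C [i0 hC]] := lower [seq S <- index_enum {set I} | S != set0].
have [i1 h1] := mangoldt_div_unbounded (#|{set I}|%:R * 2 - C + D + 2 : R).
pose i := maxn M (maxn i0 i1).
have := upper (2 ^ i)%N; rewrite (bigD1 set0) //= -big_filter.
have := hC i ltac:(rewrite /i; lia).
have := h1 i ltac:(rewrite /i; lia).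
have := trivial_lower (2 ^ i)%N ltac:(apply: leq_trans (ltnW (ltn_expl i (isT : 1 < 2)%N)); rewrite /i; lia).
rewrite -/mang; lra.
Qed.
End QuadraticDirichlet.

(** * Quadratic reciprocity *)

Lemma intr_pchar_eq0 (R : nzRingType) (p : nat) (m : int) : p \in [pchar R] ->
  (m%:~R == 0 :> R) = (p %| m)%Z.
Proof.
move=> pc; rewrite -[RHS]/(_ %| `|m|)%N (dvdn_pcharf pc).
by case: m => n; rewrite ?NegzE ?mulrNz ?oppr_eq0 ?abszN.
Qed.

Lemma finField_primitive_root (F : finFieldType) :
  exists z : F, (#|F|.-1).-primitive_root z.
Proof.
have F1 := card_finRing_gt1 F.
pose rs := enum [pred x : F | x != 0].
have cs : size rs = #|F|.-1.
  by rewrite -cardE -(cardC1 (0 : F)); apply: eq_card => x.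
have /hasP[z _ hz] : has (#|F|.-1).-primitive_root rs.
  apply: has_prim_root; rewrite ?enum_uniq ?cs // -?subn1 ?subn_gt0 //.
  apply/allP => x; rewrite mem_enum inE => x0; rewrite unity_rootE subn1.
  have := expf_card x; rewrite -[#|F|]prednK ?(ltnW F1) // exprS => e.
  by apply/eqP/(mulfI x0); rewrite mulr1.
by exists z.
Qed.

Definition fsq (F : finFieldType) (x : F) : bool := [exists y, y ^+ 2 == x].

(** The squares are the even powers of a primitive root [z], and [z ^+ h = -1]. *)
Lemma finField_euler (F : finFieldType) (u : F) : odd #|F| -> u != 0 ->
  u ^+ (#|F|./2) = (-1) ^+ (~~ fsq u).
Proof.
move=> oF u0.
have F1 := card_finRing_gt1 F.
have [z hz] := finField_primitive_root F.
set h := #|F|./2.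
have hE : #|F|.-1 = (h * 2)%N by rewrite muln2 -[#|F|]odd_double_half oF.
have h0 : (0 < h)%N by rewrite half_gt0.
rewrite hE in hz.
have cF (x : F) : x != 0 -> x ^+ (h * 2) = 1.
  move=> x0; have := expf_card x; rewrite -[#|F|]prednK ?(ltnW F1) // hE exprS => e.
  by apply/(mulfI x0); rewrite mulr1.
have zh : z ^+ h = -1.
  have : z ^+ h ^+ 2 == 1 by rewrite -exprM (prim_expr_order hz).
  rewrite sqrf_eq1 => /orP[|/eqP //]; rewrite -(prim_order_dvd hz).
  by move/dvdn_leq => /(_ h0); rewrite muln2 -addnn leqNgt -[X in (X < _)%N]addn0 ltn_add2l h0.
have [i ui] := prim_rootP hz (cF u u0).
have -> : u ^+ h = (-1) ^+ odd i by rewrite ui -exprM mulnC exprM zh signr_odd.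
congr (_ ^+ (nat_of_bool _)); apply/idP/idP => [oi|].
  apply/negP => /existsP[y /eqP yu].
  have y0 : y != 0 by apply: contraNneq u0 => y0; rewrite -yu y0 expr0n.
  have [j yj] := prim_rootP hz (cF y y0).
  move/eqP: yu; rewrite yj ui -exprM (eq_prim_root_expr hz) => /eqP e.
  have := congr1 odd e.
  have od a : odd (a %% (h * 2)) = odd a.
    by rewrite [in RHS](divn_eq a (h * 2)) oddD !oddM andbF andbF.
  by rewrite !od oddM andbF oi.
apply: contraNT => ei; apply/existsP; exists (z ^+ (i./2)).
by rewrite ui -exprM muln2 -[in X in _ == X](odd_double_half i) (negPf ei).
Qed.

Lemma signr_bool_inj (R : nzRingType) (a b : bool) : 2%:R != 0 :> R ->
  (-1) ^+ a = (-1) ^+ b :> R -> a = b.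
Proof.
move=> n2; have n1 : (1 : R) != -1 by rewrite -addr_eq0.
by case: a; case: b => //= /eqP; rewrite expr0 expr1 ?(negPf n1) // eq_sym (negPf n1).
Qed.

Lemma fsqM (F : finFieldType) (u v : F) : odd #|F| -> 2%:R != 0 :> F ->
  u != 0 -> v != 0 -> ~~ fsq (u * v) = ~~ fsq u (+) ~~ fsq v.
Proof.
move=> oF n2 u0 v0; apply: (signr_bool_inj n2).
by rewrite -finField_euler ?mulf_neq0 // signr_addb -!finField_euler // exprMn.
Qed.

Section OddPrime.
Variable l : nat.
Hypotheses (l_prime : prime l) (l_odd : odd l).

Lemma Fp_card_odd : odd #|'F_l|. Proof. by rewrite card_Fp. Qed.

Lemma Fp_intr_eq0 (m : int) : (m%:~R == 0 :> 'F_l) = (l %| m)%Z.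
Proof. exact/intr_pchar_eq0/pchar_Fp. Qed.

Lemma odd_prime_neq2 (R : nzRingType) : l \in [pchar R] -> 2%:R != 0 :> R.
Proof.
move=> lc; rewrite -(dvdn_pcharf lc) dvdn_prime2 //.
by apply/eqP => e; move: l_odd; rewrite e.
Qed.

End OddPrime.

(* For a prime [l]; a multiple of [l] counts as a residue. *)
Definition nres (l : nat) (m : int) : bool := ~~ fsq (m%:~R : 'F_l).

Lemma nresP (l : nat) (m : int) : prime l ->
  reflect (exists t : int, (l %| t ^+ 2 - m)%Z) (~~ nres l m).
Proof.
move=> pl; rewrite /nres negbK; apply: (iffP existsP) => [[y /eqP e]|[t]].
  exists (y : nat)%:Z; rewrite -Fp_intr_eq0 // rmorphB rmorphXn /= -e.
  by rewrite [_%:~R](_ : _ = y) ?subrr // -[RHS]natr_Zp -pmulrn.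
rewrite -Fp_intr_eq0 // rmorphB rmorphXn /= subr_eq0 => e.
by exists t%:~R.
Qed.

Section Residues.
Variable l : nat.
Hypotheses (l_prime : prime l) (l_odd : odd l).
Implicit Types m n : int.

Lemma nresM m n : ~~ (l %| m)%Z -> ~~ (l %| n)%Z -> nres l (m * n) = nres l m (+) nres l n.
Proof.
move=> lm ln; rewrite /nres rmorphM /= fsqM ?Fp_intr_eq0 ?Fp_card_odd //.
exact/(odd_prime_neq2 l_prime l_odd)/pchar_Fp.
Qed.

Lemma nres_eqmod m n : (l %| m - n)%Z -> nres l m = nres l n.
Proof.
by rewrite -Fp_intr_eq0 // rmorphB subr_eq0 => /eqP e; rewrite /nres /= e.
Qed.

Lemma nres_sqr m : nres l (m ^+ 2) = false.
Proof. by apply/negbTE/nresP => //; exists m; rewrite subrr dvdz0. Qed.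

Lemma nres_eulerZ m : ~~ (l %| m)%Z -> (l %| m ^+ l./2 - (-1) ^+ nres l m)%Z.
Proof.
move=> lm; rewrite -Fp_intr_eq0 // rmorphB !rmorphXn /= rmorphN rmorph1.
have := @finField_euler _ (m%:~R : 'F_l); rewrite card_Fp // Fp_intr_eq0 //.
by move=> ->; rewrite // subrr.
Qed.

Lemma nres_euler (R : nzRingType) m : l \in [pchar R] -> ~~ (l %| m)%Z ->
  m%:~R ^+ l./2 = (-1) ^+ nres l m :> R.
Proof.
move=> lR /nres_eulerZ; rewrite -(intr_pchar_eq0 _ lR) rmorphB !rmorphXn /=.
by rewrite rmorphN rmorph1 subr_eq0 => /eqP.
Qed.

Lemma nresN1 : nres l (-1) = (l %% 4 == 3)%N.
Proof.
have lR := pchar_Fp l_prime; have n2 := odd_prime_neq2 l_prime l_odd lR.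
apply: (signr_bool_inj n2).
rewrite -(nres_euler lR) ?rmorphN ?rmorph1; last first.
  by rewrite -Fp_intr_eq0 // rmorphN rmorph1 oppr_eq0 oner_eq0.
rewrite -[LHS]signr_odd; suff -> : odd l./2 = (l %% 4 == 3)%N by [].
have := l_odd; lia.
Qed.

End Residues.

(** As 8 divides [p ^ 2 - 1], the field with [p ^ 2] elements contains a primitive 8th root of unity
    [w]. Then [t = w + w ^+ 7] is a square root of 2, and [t ^+ p = w ^+ p + w ^+ (7 * p)] is [t] or
    [- t] according to [p] modulo 8. *)
Lemma nres2 (p : nat) : prime p -> odd p ->
  nres p 2 = ((p %% 8 == 3) || (p %% 8 == 5))%N.
Proof.
move=> pp op.
have [F pF cF] := pPrimePowerField pp (isT : 0 < 2)%N.
have [z hz] := finField_primitive_root F.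
have p1 := prime_gt1 pp.
have d8 : (8 %| #|F|.-1)%N.
  rewrite cF -subn1; have := op; clear -p1 => op.
  have -> : (p ^ 2 - 1 = (p - 1) * (p + 1))%N by rewrite -[1%N in LHS]/(1 ^ 2)%N subn_sqr.
  have [k ->] : exists k, p = k.*2.+1.
    by exists p./2; rewrite -[LHS]odd_double_half op.
  have : (2 %| k * k.+1)%N by rewrite dvdn2 oddM /=; case: (odd k).
  move=> /dvdnP[m hm]; apply/dvdnP; exists m; nia.
have hw := dvdn_prim_root hz d8; move: (z ^+ _) hw => w hw.
have w4 : w ^+ 4 = -1.
  have : w ^+ 4 ^+ 2 == 1 by rewrite -exprM (prim_expr_order hw).
  by rewrite sqrf_eq1 -(prim_order_dvd hw) => /orP[|/eqP].
pose t := w + w ^+ 7.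
have t2 : t ^+ 2 = 2%:R.
  have -> : t ^+ 2 = w ^+ 2 + 2%:R * (w ^+ 4) ^+ 2 + (w ^+ 4) ^+ 3 * w ^+ 2 by rewrite /t; ring.
  rewrite w4; ring.
have n2 := odd_prime_neq2 pp op pF.
have t0 : t != 0 by apply: contraNneq n2 => e; rewrite -t2 e expr0n.
apply: (signr_bool_inj n2).
rewrite -(nres_euler pp op pF); last by rewrite -(intr_pchar_eq0 _ pF).
rewrite -[2%:~R]/(2%:R) -t2 -exprM; apply: (mulfI t0); rewrite -exprS.
have -> : (2 * p./2).+1 = p by rewrite mul2n -[RHS]odd_double_half op.
rewrite -(pFrobenius_autE pF) rmorphD /= !pFrobenius_autE -exprM mulnC.
rewrite -(prim_expr_mod hw p) -(prim_expr_mod hw (p * 7)) -modnMml.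
have : (p %% 8 < 8)%N by rewrite ltn_mod.
have : odd (p %% 8) by move: op; clear; lia.
have w8 : w ^+ 8 = 1 by rewrite (prim_expr_order hw).
have e5 : w ^+ 5 = - w by rewrite exprS w4 mulrN1.
have e7 : w ^+ 7 = - w ^+ 3 by rewrite (exprD w 4 3) w4 mulN1r.
case: (p %% 8)%N => [|[|[|[|[|[|[|[|//]]]]]]]] //= _ _; rewrite ?expr0 ?expr1 mulrC /t.
- by rewrite mul1r.
- by rewrite -[(3 * 7 %% 8)%N]/5%N e5 e7 mulN1r opprD opprK addrC.
- by rewrite -[(5 * 7 %% 8)%N]/3%N e5 e7 mulN1r opprD opprK.
- by rewrite !mul1r addrC.
Qed.

(** * Gauss sums in characteristic p *)

Section GaussSum.
Variables (p q : nat) (F : fieldType) (w : F).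
Hypotheses (p_prime : prime p) (p_odd : odd p) (pF : p \in [pchar F]).
Hypotheses (q_prime : prime q) (q_odd : odd q) (hw : q.-primitive_root w).

Let chi (a : 'F_q) : F := if a == 0 then 0 else (-1) ^+ (~~ fsq a).
Let e (a : 'F_q) : F := w ^+ (a : nat).
Let tau : F := \sum_a chi a * e a.

Let q2 : 2%:R != 0 :> 'F_q.
Proof. exact/(odd_prime_neq2 q_prime q_odd)/pchar_Fp. Qed.

Let f2 : 2%:R != 0 :> F.
Proof. exact: (odd_prime_neq2 p_prime p_odd). Qed.

Let chiM a b : chi (a * b) = chi a * chi b.
Proof.
rewrite /chi mulf_eq0; have [->|a0] := eqVneq a 0; first by rewrite ?eqxx /= mul0r.
have [->|b0] := eqVneq b 0; first by rewrite ?eqxx ?orbT /= mulr0.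
by rewrite ?(negPf a0) ?(negPf b0) /= fsqM ?Fp_card_odd // signr_addb.
Qed.

Let chi_sq a : a != 0 -> chi a ^+ 2 = 1.
Proof. by move=> a0; rewrite /chi (negPf a0) sqrr_sign. Qed.

Let chi_int (m : int) : ~~ (q %| m)%Z -> chi m%:~R = (-1) ^+ nres q m.
Proof. by move=> qm; rewrite /chi Fp_intr_eq0 // (negPf qm). Qed.

Let eD a b : e (a + b) = e a * e b.
Proof. by rewrite /e -exprD -[RHS](prim_expr_mod hw) -[in X in (_ %% X)%N](Fp_cast q_prime). Qed.

Let e_nat n : e n%:R = w ^+ n.
Proof. by rewrite /e val_Fp_nat // (prim_expr_mod hw). Qed.

Let sum_chi : \sum_a chi a = 0.
Proof.
have [z hz] := finField_primitive_root 'F_q.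
have q1 := prime_gt1 q_prime.
have z0 : z != 0.
  rewrite (prim_root_eq0 hz) card_Fp // -lt0n; move: q1; clear; lia.
have zn : chi z = -1.
  rewrite /chi (negPf z0).
  have := finField_euler (Fp_card_odd q_prime q_odd) z0.
  case: (fsq z) => //= /eqP; rewrite expr0 -(prim_order_dvd hz) card_Fp //.
  by move/dvdn_leq; move: q1 q_odd; clear; lia.
have : \sum_a chi a = - \sum_a chi a.
  rewrite {1}(reindex_inj (mulfI z0)) /= -sumrN; apply: eq_bigr => a _.
  by rewrite chiM zn mulN1r.
move/eqP; rewrite -addr_eq0 -mulr2n -mulr_natl mulf_eq0 (negPf f2) /=.
by move/eqP.
Qed.

Let sum_e c : \sum_a e (a * c) = if c == 0 then q%:R else 0.
Proof.
have [->|c0] := eqVneq c 0.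
  under eq_bigr do rewrite mulr0 /e expr0.
  by rewrite sumr_const card_Fp.
have -> : \sum_a e (a * c) = \sum_a e a by rewrite [RHS](reindex_inj (mulIf c0)).
have : w * \sum_a e a = \sum_a e a.
  rewrite [RHS](reindex_inj (addrI 1)) /= big_distrr; apply: eq_bigr => a _ /=.
  by rewrite eD; congr (_ * _); rewrite -[LHS]expr1 -e_nat.
move/eqP; rewrite -subr_eq0 -[X in _ - X]mul1r -mulrBl mulf_eq0 subr_eq0 => /orP[|/eqP//].
rewrite -[w]expr1 -(prim_order_dvd hw) => /dvdn_leq h.
by have := leq_ltn_trans (h isT) (prime_gt1 q_prime); rewrite ltnn.
Qed.

(** Writing the second index as [a * c], the inner sum of [e (a * (1 + c))] over [a != 0] is [q - 1]
    for [c = -1] and [-1] otherwise. *)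
Let tau2 : tau ^+ 2 = (-1) ^+ nres q (-1) * q%:R.
Proof.
have -> : tau ^+ 2 = \sum_(a | a != 0) \sum_c chi c * e (a * (1 + c)).
  have c0 : chi 0 = 0 by rewrite /chi eqxx.
  rewrite expr2 {1}/tau (bigD1 0) //= c0 mul0r add0r big_distrl /=.
  apply: eq_bigr => a a0.
  rewrite /tau (reindex_inj (mulfI a0)) /= big_distrr /=; apply: eq_bigr => c _.
  by rewrite mulrACA chiM [chi a * (_ * _)]mulrA -expr2 chi_sq // mul1r mulrDr mulr1 eD.
rewrite exchange_big /=.
have step c : \sum_(a | a != 0) chi c * e (a * (1 + c)) =
    (if c == -1 then chi c * q%:R else 0) - chi c.
  rewrite -big_distrr /=.
  have := sum_e (1 + c); rewrite (bigD1 0) //= mul0r {1}/e expr0 addrC.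
  move/(canRL (addrK _)) => ->; rewrite [1 + c]addrC addr_eq0 mulrBr mulr1.
  by case: ifP; rewrite ?mulr0.
under eq_bigr do rewrite step.
rewrite sumrB sum_chi subr0 -big_mkcond big_pred1_eq -chi_int ?rmorphN //.
by rewrite -Fp_intr_eq0 // rmorphN oppr_eq0 oner_eq0.
Qed.

Let tauX : ~~ (q %| p)%N -> tau ^+ p = (-1) ^+ nres q p * tau.
Proof.
move=> qp; rewrite -(pFrobenius_autE pF) rmorph_sum big_distrr /=.
have pq : (p%:R : 'F_q) != 0 by rewrite -(dvdn_pcharf (pchar_Fp q_prime)).
rewrite [RHS](reindex_inj (mulfI pq)) /=; apply: eq_bigr => a _.
rewrite chiM -[p%:R]/(p%:~R) chi_int // !mulrA -expr2 sqrr_sign mul1r.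
rewrite pFrobenius_autE exprMn; congr (_ * _).
  by rewrite /chi; case: ifP; rewrite ?expr0n ?gtn_eqF ?prime_gt0 // exprAC -[(-1) ^+ p]signr_odd p_odd expr1.
have -> : p%:R * a = (p * a)%:R by rewrite natrM natr_Zp.
by rewrite e_nat /e -exprM mulnC.
Qed.

(** [tau ^+ p] is computed twice: Frobenius gives [tau] times the symbol of [p] modulo [q], and
    Euler's criterion gives [tau] times the symbol of [tau ^+ 2] modulo [p]. *)
Lemma gauss_reciprocity : p != q -> nres p ((-1) ^+ nres q (-1) * q%:Z) = nres q p.
Proof.
move=> pq.
have qp : ~~ (q %| p)%N by rewrite dvdn_prime2 // eq_sym.
have qF : q%:R != 0 :> F by rewrite -(dvdn_pcharf pF) dvdn_prime2.
have t0 : tau != 0.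
  by apply: contraNneq qF => e0; move/eqP: tau2; rewrite e0 expr0n eq_sym mulf_eq0 signr_eq0.
apply: (signr_bool_inj f2).
rewrite -(nres_euler p_prime p_odd pF) -?(intr_pchar_eq0 _ pF); last first.
  by rewrite rmorphM rmorphXn rmorphN rmorph1 /= mulf_neq0 ?signr_eq0.
rewrite rmorphM rmorphXn rmorphN rmorph1 /= -[q%:~R]/(q%:R) -tau2 -exprM.
apply: (mulIf t0); rewrite -tauX // -exprSr mul2n.
by rewrite -[in RHS](odd_double_half p) p_odd.
Qed.

End GaussSum.

Lemma quadratic_reciprocity (p q : nat) : prime p -> odd p -> prime q -> odd q -> p != q ->
  nres p q (+) nres q p = (p %% 4 == 3)%N && (q %% 4 == 3)%N.
Proof.
move=> pp op pq oq npq.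
have k0 : (0 < q.-1)%N by have := prime_gt1 pq; lia.
(* By Fermat, [q] divides [p ^ q.-1 - 1], so this field contains a primitive [q]-th root of
   unity. *)
have [F pF cF] := pPrimePowerField pp k0.
have [z hz] := finField_primitive_root F.
have dq : (q %| #|F|.-1)%N.
  rewrite cF -subn1 -eqn_mod_dvd ?expn_gt0 ?prime_gt0 // -(totient_prime pq).
  by rewrite Euler_exp_totient // coprime_sym prime_coprime // dvdn_prime2 // eq_sym.
have := gauss_reciprocity pp op pF pq oq (dvdn_prim_root hz dq) npq.
have qp : ~~ (p %| q%:Z)%Z by rewrite -[X in ~~ X]/(p %| q)%N dvdn_prime2.
have n1 b : ~~ (p %| (-1) ^+ b)%Z.
  by rewrite -Fp_intr_eq0 // rmorphXn rmorphN rmorph1 /= signr_eq0.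
rewrite nresM // => <-; rewrite addbCA addbb addbF (nresN1 pq oq).
case: (q %% 4 == 3)%N; rewrite /= ?andbT ?andbF ?expr1 ?nresN1 //.
by rewrite expr0; have := nres_sqr pp 1; rewrite expr1n.
Qed.

(** * Local square classes and the Hilbert product formula *)

(* The unit part of [a <> 0] at a prime [l]. *)
Definition upart (l : nat) (a : int) : int := (a %/ (l ^ logn l `|a|)%:Z)%Z.

Lemma dvdz_primeM (l : nat) (a b : int) : prime l -> (l %| a * b)%Z = (l %| a)%Z || (l %| b)%Z.
Proof. by move=> pl; rewrite !dvdzE abszM /= Euclid_dvdM. Qed.

Lemma dvdz_primeX (l : nat) (a : int) n : prime l -> (0 < n)%N -> (l %| a ^+ n)%Z = (l %| a)%Z.
Proof. by move=> pl n0; rewrite !dvdzE abszX /= Euclid_dvdX // n0 andbT. Qed.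

Lemma upartE l a : a = upart l a * (l ^ logn l `|a|)%:Z.
Proof. by rewrite divzK // dvdzE /= pfactor_dvdnn. Qed.

Lemma upart_unit l a : prime l -> a != 0 -> ~~ (l %| upart l a)%Z.
Proof.
move=> pl a0; apply/negP => h.
have : (l ^ (logn l `|a|).+1 %| `|a|)%N.
  by rewrite {2}(upartE l a) abszM /= expnS dvdn_mul // -dvdzE.
by rewrite pfactor_dvdn ?absz_gt0 // ltnn.
Qed.

Lemma logn_unit l k (u : int) : prime l -> ~~ (l %| u)%Z ->
  logn l `|u * (l ^ k)%:Z| = k.
Proof.
move=> pl lu; have u0 : (0 < `|u|)%N by rewrite absz_gt0; apply: contraNneq lu => ->.
rewrite abszM absz_nat lognM ?u0 ?expn_gt0 ?prime_gt0 // pfactorK // lognE pl u0 /=.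
by rewrite dvdzE in lu; rewrite (negPf lu).
Qed.

Lemma upart_unitM l k (u : int) : prime l -> ~~ (l %| u)%Z -> upart l (u * (l ^ k)%:Z) = u.
Proof.
move=> pl lu; rewrite /upart logn_unit // mulzK //.
by rewrite lt0n_neq0 // expn_gt0 prime_gt0.
Qed.

(* A class of [Q_l^* / Q_l^*2]: the parity of the valuation and, for the unit part,
   its quadratic residue bit (second component, third one unused) if [l] is odd,
   its classes [eps4] and [omega8] if [l = 2]. *)
Definition sqclass := (bool * bool * bool)%type.
Definition sqc0 : sqclass := (false, false, false).
Definition sqcD (c c' : sqclass) : sqclass :=
  (c.1.1 (+) c'.1.1, c.1.2 (+) c'.1.2, c.2 (+) c'.2).

Definition eps4 (u : int) : bool := (u %% 4)%Z == 3.
Definition omega8 (u : int) : bool := ((u %% 8)%Z == 3) || ((u %% 8)%Z == 5).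

Definition cl (l : nat) (a : int) : sqclass :=
  let u := upart l a in
  (odd (logn l `|a|), if l == 2 then eps4 u else nres l u, (l == 2) && omega8 u).

(* The Hilbert symbol as an additive form: [hil l a b] means [(a, b)_l = -1]. *)
Definition bil (l : nat) (c c' : sqclass) : bool :=
  if l == 2 then (c.1.2 && c'.1.2) (+) (c.1.1 && c'.2) (+) (c'.1.1 && c.2)
  else (c.1.1 && c'.1.1 && nres l (-1)) (+) (c.1.1 && c'.1.2) (+) (c'.1.1 && c.1.2).

Definition hil (l : nat) (a b : int) : bool := bil l (cl l a) (cl l b).

Lemma sqcDC : commutative sqcD.
Proof. by move=> [[a b] c] [[a' b'] c']; rewrite /sqcD /= !(addbC a, addbC b, addbC c). Qed.

Lemma sqcDD c : sqcD c c = sqc0.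
Proof. by case: c => [[a b] c]; rewrite /sqcD /= !addbb. Qed.

Lemma sqcD0 c : sqcD c sqc0 = c.
Proof. by case: c => [[a b] c]; rewrite /sqcD /= !addbF. Qed.

Lemma bilC l : commutative (bil l).
Proof.
move=> [[a b] c] [[a' b'] c']; rewrite /bil /=.
by case: (l == 2); case: a; case: b; case: c; case: a'; case: b'; case: c'; case: (nres l (-1)).
Qed.

Lemma bilDl l c1 c2 c3 : bil l (sqcD c1 c2) c3 = bil l c1 c3 (+) bil l c2 c3.
Proof.
move: c1 c2 c3 => [[a b] c] [[a' b'] c'] [[a'' b''] c'']; rewrite /bil /sqcD /=.
case: (l == 2).
  by case: a; case: b; case: c; case: a'; case: b'; case: c'; case: a''; case: b''; case: c''.
by case: a; case: b; case: a'; case: b'; case: a''; case: b''; case: (nres l (-1)).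
Qed.

Lemma bilDr l c1 c2 c3 : bil l c3 (sqcD c1 c2) = bil l c3 c1 (+) bil l c3 c2.
Proof. by rewrite bilC bilDl !(bilC l c3). Qed.

Lemma bil0l l c : bil l sqc0 c = false.
Proof. by have := bilDl l sqc0 sqc0 c; rewrite sqcD0 addbb. Qed.

Lemma bil0r l c : bil l c sqc0 = false.
Proof. by rewrite bilC bil0l. Qed.

Lemma oddz_mod2 (u : int) : ~~ (2 %| u)%Z -> (u %% 2)%Z = 1.
Proof. by move/dvdz_mod0P; lia. Qed.

Lemma eps4M u v : ~~ (2 %| u)%Z -> ~~ (2 %| v)%Z -> eps4 (u * v) = eps4 u (+) eps4 v.
Proof.
move=> /oddz_mod2 u2 /oddz_mod2 v2; rewrite /eps4 -modzMm.
have : ((u %% 4)%Z = 1) \/ ((u %% 4)%Z = 3) by lia.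
have : ((v %% 4)%Z = 1) \/ ((v %% 4)%Z = 3) by lia.
by case=> ->; case=> ->.
Qed.

Lemma omega8M u v : ~~ (2 %| u)%Z -> ~~ (2 %| v)%Z -> omega8 (u * v) = omega8 u (+) omega8 v.
Proof.
move=> /oddz_mod2 u2 /oddz_mod2 v2; rewrite /omega8 -modzMm.
have : (u %% 8)%Z = 1 \/ (u %% 8)%Z = 3 \/ (u %% 8)%Z = 5 \/ (u %% 8)%Z = 7 by lia.
have : (v %% 8)%Z = 1 \/ (v %% 8)%Z = 3 \/ (v %% 8)%Z = 5 \/ (v %% 8)%Z = 7 by lia.
by case=> [->|[->|[->|->]]]; case=> [->|[->|[->|->]]].
Qed.

Section LocalClass.
Variable l : nat.
Hypothesis l_prime : prime l.

Lemma cl_eqmod (k : nat) (u : int) : ~~ (l %| u)%Z ->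
  cl l (u * (l ^ k)%:Z) = (odd k, if l == 2 then eps4 u else nres l u, (l == 2) && omega8 u).
Proof. by move=> lu; rewrite /cl upart_unitM // logn_unit. Qed.

Lemma cl_unit u : ~~ (l %| u)%Z ->
  cl l u = (false, if l == 2 then eps4 u else nres l u, (l == 2) && omega8 u).
Proof. by move=> lu; rewrite -[u in LHS]mulr1 -[1]/((l ^ 0)%:Z) cl_eqmod. Qed.

Lemma prime_neq2_odd : l != 2 -> odd l.
Proof. by move=> l2; have [e|//] := even_prime l_prime; rewrite e in l2. Qed.

Lemma clM a b : a != 0 -> b != 0 -> cl l (a * b) = sqcD (cl l a) (cl l b).
Proof.
move=> a0 b0.
have ua := upart_unit l_prime a0; have ub := upart_unit l_prime b0.
have e : a * b = upart l a * upart l b * (l ^ (logn l `|a| + logn l `|b|))%:Z.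
  by rewrite {1}(upartE l a) {1}(upartE l b) expnD PoszM mulrACA.
have uab : ~~ (l %| upart l a * upart l b)%Z by rewrite dvdz_primeM // negb_or ua.
rewrite e cl_eqmod // oddD /cl /sqcD /=.
have [l2|l2] := eqVneq l 2.
  by rewrite l2 in ua ub *; rewrite eps4M // omega8M.
by rewrite nresM // prime_neq2_odd.
Qed.

Lemma cl_sqr a : a != 0 -> cl l (a ^+ 2) = sqc0.
Proof. by move=> a0; rewrite expr2 clM // sqcDD. Qed.

Lemma cl1 : cl l 1 = sqc0.
Proof. by rewrite -(cl_sqr (oner_neq0 _)) expr1n. Qed.

Lemma cl_self : cl l l%:Z = (true, false, false).
Proof.
have l1 : ~~ (l %| 1)%Z by rewrite dvdz1 neq_ltn prime_gt1 ?orbT.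
have -> : l%:Z = 1 * (l ^ 1)%:Z by rewrite mul1r expn1.
rewrite cl_eqmod //=.
have := cl1; rewrite cl_unit // => -[-> ->]; by [].
Qed.

Lemma cl_prime_neq (r : nat) : prime r -> l != r ->
  cl l r%:Z = (false, if l == 2 then eps4 r else nres l r, (l == 2) && omega8 r).
Proof. by move=> pr lr; rewrite cl_unit // dvdzE /= dvdn_prime2. Qed.

Lemma dvdzN1 : ~~ (l %| -1)%Z.
Proof. by rewrite dvdzE /= dvdn1 neq_ltn prime_gt1 ?orbT. Qed.

Lemma clN1 : cl l (-1) = (false, if l == 2 then true else nres l (-1), false).
Proof. by rewrite cl_unit ?dvdzN1 //; case: (l == 2). Qed.

(** Additive form of the symbol identity [(c, -c) = 1]. *)
Lemma bil_self c : bil l c c = bil l c (cl l (-1)).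
Proof.
rewrite clN1 /bil /=; case: c => [[a b] c] /=.
by case: (l == 2); case: a; case: b; case: c; case: (nres l (-1)).
Qed.

Lemma hilC a b : hil l a b = hil l b a.
Proof. exact: bilC. Qed.

Lemma hilMl a b c : a != 0 -> b != 0 -> hil l (a * b) c = hil l a c (+) hil l b c.
Proof. by move=> a0 b0; rewrite /hil clM // bilDl. Qed.

Lemma hilMr a b c : a != 0 -> b != 0 -> hil l c (a * b) = hil l c a (+) hil l c b.
Proof. by move=> a0 b0; rewrite /hil clM // bilDr. Qed.

Lemma hil_self a : a != 0 -> hil l a a = hil l a (-1).
Proof. by rewrite /hil bil_self. Qed.

Lemma hilN a : a != 0 -> hil l a (- a) = false.
Proof. by move=> a0; rewrite -mulN1r hilMr // hil_self // addbb. Qed.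

Lemma hil_sqrMr a b c : b != 0 -> c != 0 -> hil l a (b ^+ 2 * c) = hil l a c.
Proof. by move=> b0 c0; rewrite hilMr ?expf_neq0 // /hil cl_sqr // bil0r. Qed.

Lemma hil_unit a b : l != 2 -> ~~ (l %| a)%Z -> ~~ (l %| b)%Z -> hil l a b = false.
Proof. by move=> l2 la lb; rewrite /hil !cl_unit // /bil (negPf l2). Qed.

End LocalClass.

(** * The product formula *)

Definition hilsum (N : nat) (a b : int) : bool :=
  \big[addb/false]_(l <- [seq l <- iota 0 N.+1 | prime l]) hil l a b.

Definition prime_bound (N : nat) (a : int) := forall l, prime l -> (l %| a)%Z -> (l <= N)%N.

Lemma hilsum_supp N a b (S : seq nat) : uniq S ->
  all (fun l => prime l && (l <= N)%N) S ->
  (forall l, prime l -> l \notin S -> hil l a b = false) ->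
  hilsum N a b = \big[addb/false]_(l <- S) hil l a b.
Proof.
move=> uS /allP aS z; rewrite /hilsum.
transitivity (\big[addb/false]_(l <- [seq l <- iota 0 N.+1 | prime l] | l \in S) hil l a b).
  rewrite [RHS]big_mkcond !big_seq /=; apply: eq_bigr => l.
  by rewrite mem_filter => /andP[pl _]; case: ifP => // /negbT /(z l pl).
rewrite -big_filter; apply: perm_big; apply: uniq_perm; rewrite ?filter_uniq ?iota_uniq //.
move=> l; rewrite !mem_filter mem_iota /= add0n ltnS.
by case lS: (l \in S) => //=; have /andP[-> ->] := aS _ lS.
Qed.

Lemma int_prime_ind (Q : int -> Prop) : Q (-1) -> (forall p : nat, prime p -> Q p%:Z) ->
  (forall a b, a != 0 -> b != 0 -> Q a -> Q b -> Q (a * b)) ->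
  forall a, a != 0 -> Q a.
Proof.
move=> QN Qp QM.
have Q1 : Q 1 by have := QM (-1) (-1) isT isT QN QN; rewrite mulrNN mulr1.
have Qn : forall n : nat, (0 < n)%N -> Q n%:Z.
  elim/ltn_ind => n IH n0; have [->//|n1] := eqVneq n 1%N.
  have n2 : (1 < n)%N by rewrite ltn_neqAle eq_sym n1.
  have := pdiv_dvd n; have pp := pdiv_prime n2.
  move: (pdiv n) pp => p pp /dvdnP[m e].
  have m0 : (0 < m)%N by move: n0; rewrite e muln_gt0 => /andP[].
  rewrite e PoszM; apply: QM; [by lia | by have := prime_gt0 pp; lia | | exact: Qp].
  by apply: IH => //; rewrite e ltn_Pmulr ?prime_gt1.
case=> n a0; first by apply: Qn; rewrite lt0n.
by rewrite NegzE -mulN1r; apply: QM => //; apply: Qn.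
Qed.

Lemma eps4_nat (n : nat) : eps4 n = (n %% 4 == 3)%N.
Proof. by rewrite /eps4; lia. Qed.

Lemma omega8_nat (n : nat) : omega8 n = ((n %% 8 == 3) || (n %% 8 == 5))%N.
Proof. by rewrite /omega8; lia. Qed.

Lemma odd_eqmod8 (m n : nat) : (m = n %[mod 8])%N -> odd m = odd n.
Proof. lia. Qed.

Lemma eps4_eqmod8 (m n : nat) : (m = n %[mod 8])%N -> eps4 m = eps4 n.
Proof. by rewrite !eps4_nat; lia. Qed.

Lemma omega8_eqmod8 (m n : nat) : (m = n %[mod 8])%N -> omega8 m = omega8 n.
Proof. by rewrite !omega8_nat => ->. Qed.

Lemma odd_eq1mod4 (n : nat) : odd n -> (n = 1 %[mod 4])%N <-> ~~ eps4 n.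
Proof. by rewrite eps4_nat; split; lia. Qed.

Lemma odd_eq3mod4 (n : nat) : odd n -> (n = 3 %[mod 4])%N <-> eps4 n.
Proof. by rewrite eps4_nat; split; lia. Qed.

(** Two distinct odd primes are quadratic reciprocity, an odd prime and 2 the second supplement, an
    odd prime with itself the first supplement. *)
Lemma hilsum_prime_prime N (p q : nat) : (2 <= N)%N -> prime p -> prime q ->
  (p <= N)%N -> (q <= N)%N -> hilsum N p q = false.
Proof.
move=> N2 pp pq pN qN.
have supp l : prime l -> l \notin [:: 2; p; q] -> hil l p q = false.
  move=> pl; rewrite !inE !negb_or => /and3P[l2 lp lq].
  by rewrite hil_unit // dvdzE /= dvdn_prime2.
wlog qp : p q pp pq pN qN supp / (q != 2 -> p != 2).
  move=> w; have [p2|p2] := eqVneq p 2; last by apply: w.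
  rewrite /hilsum (eq_big_seq (fun l => hil l q p)); last by move=> l _; rewrite /hil bilC.
  apply: (w q p) => //; last by rewrite p2 eqxx.
  move=> l pl h; rewrite hilC; apply: supp => //; move: h.
  by rewrite !inE [(l == q) || _]orbC.
have [q2|q2] := eqVneq q 2.
  rewrite q2 in supp pq qN *; have [p2|p2] := eqVneq p 2.
    rewrite p2 in supp *; rewrite (@hilsum_supp _ _ _ [:: 2]) //= ?N2 //.
      by rewrite big_seq1 /hil cl_self.
    by move=> l pl; rewrite inE => h; apply: supp => //; rewrite !inE (negPf h).
  have op := prime_neq2_odd pp p2.
  rewrite (@hilsum_supp _ _ _ [:: 2; p]) //= ?inE 1?eq_sym ?p2 ?N2 ?pp ?pN //; last first.
    by move=> l pl; rewrite !inE negb_or => /andP[h h']; apply: supp; rewrite // !inE (negPf h) (negPf h').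
  rewrite big_cons big_seq1 /hil !cl_self // !cl_prime_neq ?(eq_sym 2) //.
  by rewrite /bil /= (negPf p2) /= nres2 // omega8_nat andbF !addbF /= addbb.
have p2 := qp q2.
have op := prime_neq2_odd pp p2; have oq := prime_neq2_odd pq q2.
have [e|pnq] := eqVneq p q.
  rewrite -e in supp *.
  rewrite (@hilsum_supp _ _ _ [:: 2; p]) //= ?inE 1?eq_sym ?p2 ?N2 ?pp ?pN //; last first.
    by move=> l pl; rewrite !inE negb_or => /andP[h h']; apply: supp; rewrite // !inE (negPf h) (negPf h').
  rewrite big_cons big_seq1 /hil !cl_self // !cl_prime_neq ?(eq_sym 2) //.
  by rewrite /bil /= (negPf p2) /= nresN1 // eps4_nat andbb !addbF addbb.
rewrite (@hilsum_supp _ _ _ [:: 2; p; q]) //= ?inE ?negb_or ?(eq_sym 2) ?p2 ?q2 ?N2 ?pp ?pq ?pN ?qN ?pnq //.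
have qnp : q != p by rewrite eq_sym.
rewrite !big_cons big_nil /hil !cl_self // !cl_prime_neq ?(eq_sym 2) //.
rewrite /bil /= (negPf p2) (negPf q2) /= !eps4_nat !addbF.
by rewrite quadratic_reciprocity // addbb.
Qed.

Lemma hilsum_N1_prime N (p : nat) : (2 <= N)%N -> prime p -> (p <= N)%N ->
  hilsum N (-1) p = false.
Proof.
move=> N2 pp pN.
have [p2|p2] := eqVneq p 2.
  rewrite p2; rewrite (@hilsum_supp _ _ _ [:: 2]) //= ?N2 //.
    by rewrite big_seq1 /hil cl_self // clN1.
  move=> l pl; rewrite inE => h.
  by rewrite hil_unit // ?dvdzN1 // dvdzE /= dvdn_prime2.
have op := prime_neq2_odd pp p2.
rewrite (@hilsum_supp _ _ _ [:: 2; p]) //= ?inE 1?eq_sym ?p2 ?N2 ?pp ?pN //; last first.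
  move=> l pl; rewrite !inE negb_or => /andP[h h'].
  by rewrite hil_unit // ?dvdzN1 // dvdzE /= dvdn_prime2.
rewrite big_cons big_seq1 /hil !cl_self // !clN1 // cl_prime_neq ?(eq_sym 2) //.
by rewrite /bil /= (negPf p2) /= nresN1 // eps4_nat !addbF addbb.
Qed.

Lemma hilsum_N1_N1 N : (2 <= N)%N -> hilsum N (-1) (-1) = true.
Proof.
move=> N2; rewrite (@hilsum_supp _ _ _ [:: 2]) //= ?N2 //.
  by rewrite big_seq1 /hil clN1.
by move=> l pl; rewrite inE => h; rewrite hil_unit // dvdzN1.
Qed.

Lemma hilsumC N a b : hilsum N a b = hilsum N b a.
Proof. by apply: eq_bigr => l _; rewrite /hil bilC. Qed.

Lemma hilsumMr N a b c : a != 0 -> b != 0 ->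
  hilsum N c (a * b) = hilsum N c a (+) hilsum N c b.
Proof.
move=> a0 b0; rewrite /hilsum -big_split /= !big_seq; apply: eq_bigr => l.
by rewrite mem_filter => /andP[pl _]; rewrite hilMr.
Qed.

Lemma prime_boundM N a b : prime_bound N (a * b) -> prime_bound N a /\ prime_bound N b.
Proof.
by move=> h; split=> l pl la; apply: h => //; rewrite dvdz_primeM // la ?orbT.
Qed.

Lemma ltz0M (a b : int) : a != 0 -> b != 0 -> (a * b < 0) = (a < 0) (+) (b < 0).
Proof. by move=> a0 b0; case: (ltgtP a 0) a0 => //; case: (ltgtP b 0) b0 => //= *; nia. Qed.

(** The right-hand side is the symbol at the real place. Both sides are bilinear, so it is enough to
    check -1 and the primes. *)
Lemma hilbert_product N a b : (2 <= N)%N -> a != 0 -> b != 0 ->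
  prime_bound N a -> prime_bound N b -> hilsum N a b = (a < 0) && (b < 0).
Proof.
move=> N2 a0 b0; move: a a0.
have gen (c : int) : (prime_bound N c -> hilsum N c (-1) = (c < 0)) ->
   (forall q : nat, prime q -> (q <= N)%N -> prime_bound N c -> hilsum N c q = false) ->
   prime_bound N c -> prime_bound N b -> hilsum N c b = (c < 0) && (b < 0).
  move=> hN hq cN; move: b b0; apply: int_prime_ind.
  - by move=> _; rewrite hN // andbT.
  - by move=> q pq qN; rewrite hq ?andbF //; apply: qN.
  - move=> x y x0 y0 hx hy /prime_boundM[xN yN].
    by rewrite hilsumMr // hx // hy // ltz0M //; case: (c < 0).
apply: int_prime_ind.
- apply: gen => [_|q pq qN _]; first by rewrite hilsum_N1_N1.
  exact: hilsum_N1_prime.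
- move=> p pp; apply: gen => [pN|q pq qN pN].
    by rewrite hilsumC hilsum_N1_prime //; apply: pN.
  by rewrite hilsum_prime_prime //; apply: pN.
move=> x y x0 y0 hx hy /prime_boundM[xN yN] bN.
rewrite hilsumC hilsumMr // !(hilsumC N b) hx // hy // ltz0M //.
by case: (b < 0); rewrite ?andbF ?andbT.
Qed.

(** * Conics over the rationals *)

Lemma cl_unit_eqmod l (u v : int) : prime l -> l != 2 -> ~~ (l %| u)%Z ->
  (l %| u - v)%Z -> cl l u = cl l v.
Proof.
move=> pl l2 lu luv; have lv : ~~ (l %| v)%Z.
  by apply: contra lu => lv; rewrite -[u](subrK v) rpredD.
by rewrite !cl_unit // (negPf l2) /= (nres_eqmod _ luv).
Qed.

Section Norm.
Variable l : nat.
Hypotheses (l_prime : prime l) (l2 : l != 2).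

(** Reduction modulo [l] reveals the class of the norm. For [k = 1] it is that of [t ^+ 2] or, when
    [l] divides [t], that of [- u * l], where [hilN] applies. For [k = 0] either the norm is a unit
    or [u] is congruent to a nonzero square. *)
Lemma hil_norm_prim (k : bool) (u t x : int) : ~~ (l %| u)%Z ->
  ~~ ((l %| t)%Z && (l %| x)%Z) -> t ^+ 2 - u * (l ^ k)%:Z * x ^+ 2 != 0 ->
  hil l (u * (l ^ k)%:Z) (t ^+ 2 - u * (l ^ k)%:Z * x ^+ 2) = false.
Proof.
move=> lu ltx n0; have l0 : l%:Z != 0 by have := prime_gt0 l_prime; lia.
have u0 : u != 0 by apply: contraNneq lu => ->; apply: dvdz0.
case: k n0 => n0; rewrite ?expn1 ?expn0 ?mulr1 in n0 *.
  have [lt|lt] := boolP (l %| t)%Z; last first.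
    rewrite /hil (@cl_unit_eqmod l (t ^+ 2 - u * l%:Z * x ^+ 2) (t ^+ 2)) //.
    - by rewrite cl_sqr ?bil0r //; apply: contraNneq lt => ->; apply: dvdz0.
    - apply: contra lt => h; rewrite -(@dvdz_primeX l t 2) // -[t ^+ 2](subrK (u * l%:Z * x ^+ 2)).
      by rewrite rpredD // mulrAC dvdz_mull.
    - by rewrite addrAC subrr add0r rpredN mulrAC dvdz_mull.
  have lx : ~~ (l %| x)%Z by rewrite lt in ltx.
  have x0 : x != 0 by apply: contraNneq lx => ->; apply: dvdz0.
  have [t' tE] := dvdzP lt.
  pose m := l%:Z * t' ^+ 2 - u * x ^+ 2.
  have nE : t ^+ 2 - u * l%:Z * x ^+ 2 = m * l%:Z by rewrite tE /m; ring.
  have lux : ~~ (l %| - u * x ^+ 2)%Z.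
    by rewrite mulNr rpredN dvdz_primeM // dvdz_primeX // negb_or lu.
  have m0 : m != 0 by apply: contraNneq n0 => m0; rewrite nE m0 mul0r.
  have cm : cl l m = cl l (- u).
    rewrite -(@cl_unit_eqmod l (- u * x ^+ 2) m) //; last first.
      have -> : - u * x ^+ 2 - m = - (l%:Z * t' ^+ 2) by rewrite /m; ring.
      by rewrite rpredN dvdz_mulr.
    by rewrite clM ?oppr_eq0 ?expf_neq0 // cl_sqr // sqcD0.
  rewrite nE /hil [cl l (m * _)]clM // cm -clM ?oppr_eq0 // mulNr.
  by apply: hilN => //; rewrite mulf_neq0.
have [ln|ln] := boolP (l %| t ^+ 2 - u * x ^+ 2)%Z; last by rewrite hil_unit.
have lx : ~~ (l %| x)%Z.
  apply: contra ltx => lx; rewrite lx andbT -(@dvdz_primeX l t 2) //.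
  by rewrite -[t ^+ 2](subrK (u * x ^+ 2)) rpredD // dvdz_mull // dvdz_primeX.
have x0 : x != 0 by apply: contraNneq lx => ->; apply: dvdz0.
have cu : cl l u = cl l (t ^+ 2).
  have <- : cl l (u * x ^+ 2) = cl l u by rewrite clM ?expf_neq0 // cl_sqr // sqcD0.
  apply: cl_unit_eqmod => //; first by rewrite dvdz_primeM // dvdz_primeX // negb_or lu.
  by rewrite -opprB rpredN.
rewrite /hil cu cl_sqr ?bil0l //; apply: contraTneq ln => ->.
by rewrite expr0n sub0r rpredN dvdz_primeM // dvdz_primeX // negb_or lu.
Qed.

(** The square part of the power of [l] in [a] is absorbed into [x]; then common factors [l] of the
    two arguments are divided out by descent. *)
Lemma hil_norm (a t x : int) : a != 0 -> t ^+ 2 - a * x ^+ 2 != 0 ->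
  hil l a (t ^+ 2 - a * x ^+ 2) = false.
Proof.
move=> a0; have l0 : l%:Z != 0 by have := prime_gt0 l_prime; lia.
have lu := upart_unit l_prime a0; set u := upart l a in lu.
have [k [j aE]] : exists (k : bool) j, a = u * (l ^ k)%:Z * (l ^ j)%:Z ^+ 2.
  exists (odd (logn l `|a|)), (logn l `|a|)./2.
  rewrite {1}(upartE l a) -/u -mulrA; congr (_ * _).
  by rewrite -[in LHS](odd_double_half (logn l `|a|)) expnD PoszM -muln2 expnM.
have u0 : u != 0 by apply: contraNneq lu => ->; apply: dvdz0.
have lk i : (l ^ i)%:Z != 0 by rewrite lt0n_neq0 // expn_gt0 prime_gt0.
have -> : t ^+ 2 - a * x ^+ 2 = t ^+ 2 - u * (l ^ k)%:Z * ((l ^ j)%:Z * x) ^+ 2.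
  by rewrite {1}aE; ring.
have -> n : hil l a n = hil l (u * (l ^ k)%:Z) n.
  by rewrite /hil {1}aE clM ?cl_sqr ?sqcD0 // ?expf_neq0 ?mulf_neq0.
move: (_ * x) => y {x aE}.
have [n] := ubnP (`|t| + `|y|); elim: n t y => // n IH t y ty n0.
have [/andP[/dvdzP[t' tE] /dvdzP[y' yE]]|h] := boolP ((l %| t)%Z && (l %| y)%Z); last first.
  exact: hil_norm_prim.
have E : t ^+ 2 - u * (l ^ k)%:Z * y ^+ 2 = l%:Z ^+ 2 * (t' ^+ 2 - u * (l ^ k)%:Z * y' ^+ 2).
  by rewrite tE yE; ring.
have n0' : t' ^+ 2 - u * (l ^ k)%:Z * y' ^+ 2 != 0.
  by apply: contraNneq n0 => e; rewrite E e mulr0.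
rewrite E hil_sqrMr //; apply: IH => //.
have : (t' != 0) || (y' != 0).
  by apply: contraNT n0'; rewrite negb_or !negbK => /andP[/eqP-> /eqP->]; rewrite expr0n mulr0 subrr.
move=> ty'0; have s0 : (0 < `|t'| + `|y'|)%N by rewrite addn_gt0 !absz_gt0.
move: ty; rewrite tE yE !abszM /= -mulnDl ltnS; apply: leq_trans.
by rewrite ltn_Pmulr // prime_gt1.
Qed.
End Norm.

Definition conic_solvable (a b : int) : Prop :=
  exists x y z : int, [|| x != 0, y != 0 | z != 0] /\ a * x ^+ 2 + b * y ^+ 2 = z ^+ 2.

Lemma conic_hil_odd l a b : prime l -> l != 2 -> a != 0 -> b != 0 ->
  conic_solvable a b -> hil l a b = false.
Proof.
move=> pl l2 a0 b0 [x [y [z [xyz e]]]].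
have [y0|y0] := eqVneq y 0.
  have x0 : x != 0.
    apply: contraTneq xyz => x0; move/eqP: e.
    by rewrite x0 y0 eqxx !expr0n !mulr0 add0r eq_sym sqrf_eq0 negbK.
  have z0 : z != 0.
    by rewrite -sqrf_eq0 -e y0 expr0n mulr0 addr0 mulf_neq0 ?expf_neq0.
  have : cl l (a * x ^+ 2) = sqc0 by rewrite -(cl_sqr pl z0) -e y0 expr0n mulr0 addr0.
  rewrite clM ?expf_neq0 // cl_sqr // sqcD0 /hil => ->.
  exact: bil0l.
rewrite -(hil_sqrMr pl a y0 b0).
have E : y ^+ 2 * b = z ^+ 2 - a * x ^+ 2 by rewrite -e; ring.
by rewrite E hil_norm // -E mulf_neq0 ?expf_neq0.
Qed.

(* At [l = 2] this follows from the other primes by the product formula. *)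
Lemma conic_hil l a b : prime l -> a != 0 -> b != 0 ->
  conic_solvable a b -> hil l a b = false.
Proof.
move=> pl a0 b0 c; have [l2|l2] := eqVneq l 2; last exact: conic_hil_odd.
pose N := (`|a| + `|b| + 2)%N.
have bN d : d != 0 -> (`|d| <= `|a| + `|b|)%N -> prime_bound N d.
  move=> d0 dN p pp pd; rewrite dvdzE /= in pd.
  have := dvdn_leq _ pd; rewrite absz_gt0 d0 => /(_ isT); rewrite /N; lia.
have N2 : (2 <= N)%N by rewrite /N addn2.
have := hilbert_product N2 a0 b0 (bN a a0 ltac:(lia)) (bN b b0 ltac:(lia)).
rewrite (@hilsum_supp _ _ _ [:: 2]) //= ?N2 //; last first.
  by move=> p pp; rewrite inE => p2; apply: conic_hil_odd.
rewrite big_seq1 l2 => ->; apply/negbTE/negP => /andP[an bn].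
case: c => x [y [z [xyz e]]].
have := sqr_ge0 x; have := sqr_ge0 y; have := sqr_ge0 z => hz hy hx.
have x0 : x ^+ 2 = 0 by nia.
have y0 : y ^+ 2 = 0 by nia.
move: xyz; rewrite -(sqrf_eq0 x) -(sqrf_eq0 y) -(sqrf_eq0 z) -e x0 y0 !mulr0 addr0.
by rewrite eqxx.
Qed.

(** Chinese remainders: the smallest prime factor is split off, and it is coprime to the cofactor
    because [n] is squarefree. *)
Lemma sqrt_mod_squarefree (a : int) (n : nat) : (0 < n)%N ->
  (forall l, prime l -> ~~ (l ^ 2 %| n)%N) ->
  (forall l, prime l -> (l %| n)%N -> exists t : int, (l %| t ^+ 2 - a)%Z) ->
  exists t : int, (n %| t ^+ 2 - a)%Z.
Proof.
elim/ltn_ind: n => n IH n0 sf h; have [->|n1] := eqVneq n 1%N.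
  by exists 0; rewrite dvd1z.
have n2 : (1 < n)%N by rewrite ltn_neqAle eq_sym n1.
have pp := pdiv_prime n2; have /dvdnP[m e] := pdiv_dvd n; set p := pdiv n in pp e.
have m0 : (0 < m)%N by move: n0; rewrite e muln_gt0 => /andP[].
have [t1 ht1] := h p pp (pdiv_dvd n).
have [|l pl|l pl lm|t2 ht2] := IH m _ m0.
- by rewrite e ltn_Pmulr ?prime_gt1.
- by apply: contra (sf l pl) => lm; rewrite e dvdn_mulr.
- by apply: h => //; rewrite e dvdn_mulr.
have cpm : coprimez p m.
  rewrite coprimezE /= prime_coprime //.
  by apply: contra (sf p pp) => pm; rewrite e -mulnn dvdn_mul.
have modE (k : nat) (t t' : int) : (t = t' %[mod k])%Z -> (k %| t' ^+ 2 - a)%Z -> (k %| t ^+ 2 - a)%Z.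
  move=> /eqP; rewrite eqz_mod_dvd => d d'.
  have -> : t ^+ 2 - a = (t - t') * (t + t') + (t' ^+ 2 - a) by ring.
  by rewrite rpredD // dvdz_mulr.
exists (zchinese p m t1 t2); rewrite e PoszM Gauss_dvdz 1?coprimez_sym //.
by apply/andP; split; [apply: modE ht2; apply: zchinese_modr | apply: modE ht1; apply: zchinese_modl].
Qed.

Lemma sqrt_mod_small (a b : int) : b != 0 -> (exists t : int, (b %| t ^+ 2 - a)%Z) ->
  exists t : int, (b %| t ^+ 2 - a)%Z /\ (2 * `|t| <= `|b|)%N.
Proof.
move=> b0 [t h]; set r := (t %% b)%Z.
have r0 : 0 <= r by rewrite modz_ge0.
have rb : r < `|b| by rewrite ltz_mod.
have hr k : (b %| (r - k * b) ^+ 2 - a)%Z.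
  have -> : (r - k * b) ^+ 2 - a = t ^+ 2 - a + b * (- (t %/ b)%Z - k) * (t + (r - k * b)).
    by rewrite /r /modz; ring.
  by rewrite rpredD // -mulrA dvdz_mulr.
have [h2|h2] := lerP (2 * r) `|b|.
  exists r; split; last by lia.
  by have := hr 0; rewrite mul0r subr0.
exists (r - `|b|); split; last by lia.
by rewrite normrEsg; apply: hr.
Qed.

Lemma conic_solvableC a b : conic_solvable a b -> conic_solvable b a.
Proof.
move=> [x [y [z [xyz e]]]]; exists y, x, z; rewrite addrC; split=> //.
by rewrite orbCA.
Qed.

(* Descent on [|a| + |b|]: if [t^2 - a = b b'] with [|t| <= |b| / 2], then [b b'] is a norm
   from [Q(sqrt a)] and [b] can be replaced by [b']. *)
Lemma legendre_conic a b : a != 0 -> b != 0 -> ~~ ((a < 0) && (b < 0)) ->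
  (forall l, prime l -> l != 2 -> hil l a b = false) -> conic_solvable a b.
Proof.
have [n] := ubnP (`|a| + `|b|)%N; elim: n a b => // n IH a b.
wlog ab : a b / (`|a| <= `|b|)%N.
  move=> w abn a0 b0 s h; case/orP: (leq_total `|a| `|b|) => ab; first exact: w.
  apply/conic_solvableC/w; rewrite 1?addnC // 1?andbC // => l pl l2.
  by rewrite hilC h.
move=> abn a0 b0 s h.
(* A square factor [l ^ 2] of [b] is moved into the variables; after this case [b] is squarefree. *)
have [/hasP[l]|/hasPn sf] := boolP (has (fun l => l ^ 2 %| `|b|)%N (primes `|b|)).
  rewrite mem_primes => /and3P[pl _ _] lb.
  have /dvdzP[b' bE] : ((l ^ 2)%N%:Z %| b)%Z by rewrite dvdzE.
  have l1 := prime_gt1 pl.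
  have l0 : l%:Z != 0 by lia.
  have b0' : b' != 0 by apply: contraNneq b0 => b0'; rewrite bE b0' mul0r.
  have bE' : b = l%:Z ^+ 2 * b' by rewrite bE mulrC -mulnn PoszM expr2.
  have [|||x [y [z [xyz e]]]] := IH a b' _ a0 b0'.
  - move: abn; rewrite bE' abszM abszX /=; nia.
  - by apply: contra s => /andP[-> hb]; rewrite bE'; nia.
  - by move=> p pp p2; rewrite -(hil_sqrMr pp _ l0 b0') -bE' h.
  exists (l%:Z * x), y, (l%:Z * z); split; first by rewrite !mulf_eq0 (negPf l0).
  by rewrite !exprMn -e bE'; ring.
have [b1|b1] := leqP `|b| 1.
  have [a1|a1] := eqVneq a 1; first by exists 1, 0, 1; rewrite a1; split=> //; ring.
  have b1' : b = 1 by move: s; lia.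
  by exists 0, 1, 1; rewrite b1'; split=> //; ring.
have [t [/dvdzP[b' tE] tb]] : exists t : int, (b %| t ^+ 2 - a)%Z /\ (2 * `|t| <= `|b|)%N.
  apply: sqrt_mod_small => //.
  have [|l pl|l pl lb|t ht] := @sqrt_mod_squarefree a `|b|.
  - by rewrite absz_gt0.
  - apply/negP => lb; have := sf l; rewrite mem_primes pl absz_gt0 b0 lb.
    by rewrite (dvdn_trans (dvdn_exp _ (dvdnn l)) lb) // => /(_ isT).
  (* Every integer is a square modulo 2. At an odd [l] not dividing [a] the symbol is the residue
     bit of [a], because [b] has valuation 1. *)
  - have [l2|l2] := eqVneq l 2.
      have e2 : a ^+ 2 - a = a * (a - 1) by ring.
      by exists a; rewrite l2 e2 dvdz_primeM //; lia.
    have [la|la] := boolP (l %| a)%Z; first by exists 0; rewrite expr0n sub0r rpredN.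
    apply/nresP => //; have := h l pl l2.
    rewrite /hil /bil (cl_unit pl la) /cl (negPf l2) /=.
    suff -> : logn l `|b| = 1%N by move=> /= ->.
    apply/eqP; rewrite eqn_leq logn_gt0 mem_primes pl lb absz_gt0 b0 !andbT.
    rewrite leqNgt -pfactor_dvdn ?absz_gt0 //; apply/negP => lb2.
    have := sf l; rewrite mem_primes pl lb absz_gt0 b0 lb2 => /(_ isT) //.
  - by exists t; move: ht; rewrite !dvdzE.
have [b0'|b0'] := eqVneq b' 0.
  exists 1, 0, t; split; first by [].
  by move/eqP: tE; rewrite b0' mul0r subr_eq0 => /eqP ->; ring.
have nE : b * b' = t ^+ 2 - a * 1 ^+ 2 by rewrite expr1n mulr1 tE mulrC.
have [|||x [y [z [xyz e]]]] := IH a b' _ a0 b0'.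
(* [|b| |b'| <= t^2 + |a| <= b^2 / 4 + |b| < b^2], since [|b| >= 2]. *)
- have le1 : (`|b| * `|b'| <= `|t| ^ 2 + `|a|)%N.
    rewrite -abszM nE expr1n mulr1 -abszX; lia.
  suff : (`|b'| < `|b|)%N by lia.
  rewrite ltnNge; apply/negP => bb.
  have : (`|b| * `|b| <= `|b| * `|b'|)%N by rewrite leq_mul2l bb orbT.
  have : (4 * `|t| ^ 2 <= `|b| * `|b|)%N by rewrite -[4%N]/(2 ^ 2)%N -expnMn mulnn leq_exp2r.
  move: le1 ab b1; rewrite mulnn; move: `|b| `|b'| `|a| `|t| => B B' A T; nia.
- apply: contra s => /andP[aN bN]; rewrite aN /=.
  have : 0 <= t ^+ 2 by apply: sqr_ge0.
  nia.
- move=> l pl l2; have n0 : t ^+ 2 - a * 1 ^+ 2 != 0 by rewrite -nE mulf_neq0.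
  have := hil_norm pl l2 a0 n0; rewrite -nE hilMr // h //.
(* Coordinates of [(t + sqrt a) (z + x sqrt a)], whose norm is [b b' * b' y^2 = b (b' y)^2]. *)
exists (t * x + z), (b' * y), (t * z + a * x); split.
  apply: contraTT xyz; rewrite !negb_or !negbK => /and3P[/eqP e1].
  rewrite mulf_eq0 (negPf b0') /= => /eqP y0 /eqP e2.
  have zE : z = - (t * x) by rewrite -[z](addKr (t * x)) e1 addr0.
  have x0 : x = 0.
    have : (a * 1 ^+ 2 - t ^+ 2) * x = 0 by rewrite -e2 zE; ring.
    move/eqP; rewrite -opprB -nE mulNr oppr_eq0 !mulf_eq0 (negPf b0) (negPf b0') /=.
    by move/eqP.
  by rewrite zE y0 x0 mulr0 oppr0 eqxx.
have -> : b * (b' * y) ^+ 2 = b * b' * (b' * y ^+ 2) by ring.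
have -> : b' * y ^+ 2 = z ^+ 2 - a * x ^+ 2 by rewrite -e; ring.
rewrite nE; ring.
Qed.

(** * Integers with prescribed local square classes *)

Definition sqclasses : seq sqclass :=
  [seq (c.1, c.2, d) | c <- [:: (false, false); (false, true); (true, false); (true, true)],
                       d <- [:: false; true]].

Lemma mem_sqclasses c : c \in sqclasses.
Proof. by case: c => [[[] []] []]. Qed.

(* The bilinear form [bil] with its two possible shapes made explicit: [two] for
   [l = 2], and otherwise [n] for the class of [-1]. *)
Definition bilb (two n : bool) (c c' : sqclass) : bool :=
  if two then (c.1.2 && c'.1.2) (+) (c.1.1 && c'.2) (+) (c'.1.1 && c.2)
  else (c.1.1 && c'.1.1 && n) (+) (c.1.1 && c'.1.2) (+) (c'.1.1 && c.1.2).

(** Two linear conditions on [X] for a nondegenerate form over the field with two elements. They can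
    clash only when [P] and [D] are dependent: [P = 0] is harmless, [D = P] is consistent because
    [(P, -P)] is trivial, and [D = 0] requires [(P, Q)] to be trivial, which is the guard. The
    finite search replaces this argument. *)
Definition local_target_check (two n : bool) : bool :=
  let s := [seq c <- sqclasses | two || ~~ c.2] in
  let N := (false, if two then true else n, false) in
  all (fun P => all (fun Q => all (fun D =>
    (D != sqc0) || ~~ bilb two n P Q ==>
    has (fun X => (bilb two n X P == bilb two n P Q) &&
      (bilb two n X D == bilb two n D (sqcD N P) (+) bilb two n P Q)) s) s) s) s.

(* With [P], [Q], [D] the classes of [a], [b], [d], the equations express that the
   conics [a x^2 + X b y^2 = z^2] and [d a x^2 + d X y^2 = z^2] are solvable in [Q_l]. *)
Lemma local_target l (P Q D : sqclass) : prime l ->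
  (l != 2 -> [/\ P.2 = false, Q.2 = false & D.2 = false]) ->
  (D != sqc0) || ~~ bil l P Q ->
  exists X : sqclass, [/\ l != 2 -> X.2 = false, bil l X P = bil l P Q
    & bil l X D = bil l D (sqcD (cl l (-1)) P) (+) bil l P Q].
Proof.
move=> pl h2; rewrite clN1 // -[bil l]/(bilb (l == 2) (nres l (-1))).
have : local_target_check (l == 2) (nres l (-1)).
  by case: (l == 2); case: (nres l (-1)); vm_compute.
move/allP => /(_ P) => h.
have mem c : (l != 2 -> c.2 = false) -> c \in [seq c <- sqclasses | (l == 2) || ~~ c.2].
  move=> hc; rewrite mem_filter mem_sqclasses andbT.
  by have [//|l2] := eqVneq l 2; rewrite hc.
have [hP hQ hD] : [/\ l != 2 -> P.2 = false, l != 2 -> Q.2 = false & l != 2 -> D.2 = false].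
  by split=> /h2[].
move: (h (mem P hP)) => /allP/(_ Q (mem Q hQ))/allP/(_ D (mem D hD))/implyP{}h /h/hasP[X].
rewrite mem_filter => /andP[hX _] /andP[/eqP h3 /eqP h4].
by exists X; split=> // l2; move: hX; rewrite (negPf l2) /= => /negbTE.
Qed.

Lemma exists_residue (l : nat) (b : bool) : prime l -> odd l ->
  exists u : nat, ~~ (l %| u)%N /\ nres l u = b.
Proof.
move=> pl ol; case: b; last first.
  exists 1%N; split; first by rewrite dvdn1 neq_ltn prime_gt1 ?orbT.
  by have := nres_sqr pl 1; rewrite expr1n.
have [z hz] := finField_primitive_root 'F_l.
have l1 := prime_gt1 pl.
have z0 : z != 0 by rewrite (prim_root_eq0 hz) card_Fp // -lt0n; lia.
exists (z : nat).
have zE : (z : nat)%:Z%:~R = z by rewrite -[RHS]natr_Zp -pmulrn.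
split; first by have := Fp_intr_eq0 pl (z : nat)%:Z; rewrite zE dvdzE /= (negPf z0) => <-.
rewrite /nres zE; apply/negP => fz.
have := finField_euler (Fp_card_odd pl ol) z0.
rewrite fz /= => /eqP; rewrite expr0 -(prim_order_dvd hz) card_Fp //.
by move/dvdn_leq; lia.
Qed.

Lemma exists_crt (s : seq nat) (t : nat -> bool) (c : nat) :
  odd c -> all (fun l => prime l && odd l) s -> uniq s ->
  exists n : nat, (n = c %[mod 8])%N /\ forall l, l \in s -> ~~ (l %| n)%N /\ nres l n = t l.
Proof.
move=> oc; elim: s => [|p s IH] /=; first by exists c.
case/andP=> /andP[pp op] als /andP[ps us].
have [n [n8 hn]] := IH als us.
have [u [pu hu]] := exists_residue (t p) pp op.
pose m := (8 * \prod_(l <- s) l)%N.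
have cop : coprime m p.
  rewrite /m coprimeMl; apply/andP; split.
    by rewrite -[8%N]/(2 ^ 3)%N coprimeXl // coprime2n.
  rewrite big_seq; elim/big_ind: _ => [|x y cx cy|l ls]; rewrite ?coprime1n ?coprimeMl ?cx //.
  have /andP[pl _] := allP als l ls.
  by rewrite prime_coprime // dvdn_prime2 //; apply: contraNneq ps => <-.
exists (chinese m p n u); split.
  have := congr1 (modn^~ 8) (chinese_modl cop n u).
  by rewrite /= !modn_dvdm ?dvdn_mulr // => ->.
move=> l; rewrite inE.
have key k (x y : nat) : prime k -> (x = y %[mod k])%N -> ~~ (k %| y)%N -> nres k y = t k ->
    ~~ (k %| x)%N /\ nres k x = t k.
  move=> pk xy ky <-; split; first by rewrite /dvdn xy.
  apply: nres_eqmod => //; rewrite -eqz_mod_dvd; apply/eqP.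
  by rewrite !modz_nat xy.
case/orP=> [/eqP ->|ls]; first by apply: key pu hu => //; apply: chinese_modr.
have /andP[pl _] := allP als l ls; have [ln hl] := hn l ls.
apply: key ln hl => //.
have lm : (l %| m)%N by rewrite /m dvdn_mull // (big_rem l) //= dvdn_mulr.
by have := congr1 (modn^~ l) (chinese_modl cop n u); rewrite /= !modn_dvdm.
Qed.

(** Chinese remainders give an integer [n] with the required characters, and [quadratic_dirichlet] a
    prime sharing them. This prime exceeds [N] because it is coprime to [M], which 2 and all odd
    primes up to [N] divide. *)
Lemma exists_prime_prescribed (N : nat) (t : nat -> bool) (e w : bool) :
  exists r : nat, [/\ prime r, odd r, (N < r)%N,
    forall l, prime l -> l != 2 -> (l <= N)%N -> nres l r = t l
  & eps4 r = e /\ omega8 r = w].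
Proof.
pose s := [seq l <- iota 0 N.+1 | prime l && odd l].
have als : all (fun l => prime l && odd l) s by apply: filter_all.
have us : uniq s by rewrite filter_uniq ?iota_uniq.
have [c [oc ce cw]] : exists c : nat, [/\ odd c, eps4 c = e & omega8 c = w].
  by case: e; case: w; [exists 3%N | exists 7%N | exists 5%N | exists 1%N].
have [n [n8 hn]] := exists_crt t oc als us.
pose M := (8 * \prod_(l <- s) l)%N.
have M0 : (0 < M)%N.
  rewrite muln_gt0 /= big_seq; elim/big_ind: _ => // [x y x0 y0|l ls]; first by rewrite muln_gt0 x0.
  by have /andP[/prime_gt0] := allP als l ls.
have lM l : l \in s -> (l %| M)%N by move=> ls; rewrite /M dvdn_mull // (big_rem l) //= dvdn_mulr.
have M8 : (8 %| M)%N by rewrite dvdn_mulr.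
have on : odd n by rewrite (odd_eqmod8 n8).
have nM : coprime n M.
  rewrite coprimeMr; apply/andP; split.
    by rewrite -[8%N]/(2 ^ 3)%N coprimeXr // coprimen2.
  rewrite big_seq; elim/big_ind: _ => [|x y cx cy|l ls]; rewrite ?coprimen1 ?coprimeMr ?cx //.
  have /andP[pl _] := allP als l ls; have [ln _] := hn l ls.
  by rewrite coprime_sym prime_coprime.
pose R := Rdefinitions.R.
(* [None] and [Some None] are the characters modulo 4 and 8; indices outside [s] carry the constant
   1. *)
pose chi (i : option (option 'I_N.+1)) (m : nat) : R :=
  match i with
  | None => if odd m then (-1) ^+ eps4 m else 0
  | Some None => if odd m then (-1) ^+ omega8 m else 0
  | Some (Some l) => if (l : nat) \in s then (if (l %| m)%N then 0 else (-1) ^+ nres l m) else 1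
  end.
have o2 (m : nat) : odd m = ~~ (2 %| m%:Z)%Z by rewrite dvdzE /= dvdn2 negbK.
have sgn1 (b : bool) : (-1 : R) ^+ b = 1 \/ (-1 : R) ^+ b = -1 by case: b; [right|left].
have cop_odd m : coprime m M -> odd m.
  by move/coprime_dvdr => /(_ 2%N); rewrite coprimen2; apply; apply: dvdn_trans M8.
have cop_l m l : coprime m M -> l \in s -> ~~ (l %| m)%N.
  move=> mM ls; have /andP[pl _] := allP als _ ls.
  by rewrite -prime_coprime // coprime_sym (coprime_dvdr (lM l ls)).
have chiM i x y : chi i (x * y)%N = chi i x * chi i y.
  case: i => [[l|]|] /=.
  - case: ifP => ls; last by rewrite mulr1.
    have /andP[pl ol] := allP als _ ls.
    rewrite Euclid_dvdM //; case: (boolP (l %| x)%N) => lx; first by rewrite mul0r.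
    case: (boolP (l %| y)%N) => ly; first by rewrite mulr0.
    by rewrite PoszM nresM // signr_addb.
  - rewrite oddM; case: (boolP (odd x)) => ox; rewrite ?mul0r //=.
    case: (boolP (odd y)) => oy; rewrite ?mulr0 //.
    by rewrite PoszM omega8M -?o2 // signr_addb.
  - rewrite oddM; case: (boolP (odd x)) => ox; rewrite ?mul0r //=.
    case: (boolP (odd y)) => oy; rewrite ?mulr0 //.
    by rewrite PoszM eps4M -?o2 // signr_addb.
have chiT i m : coprime m M -> chi i m = 1 \/ chi i m = -1.
  move=> mM; have om := cop_odd m mM.
  case: i => [[l|]|] /=; rewrite ?om //; case: ifP => ls; last by left.
  by rewrite (negPf (cop_l m l mM ls)).
have chi_per i m : chi i (m + M)%N = chi i m.
  have mM8 : (m + M = m %[mod 8])%N by rewrite -modnDmr (eqP M8) addn0.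
  case: i => [[l|]|] /=; rewrite ?(odd_eqmod8 mM8).
  - case: ifP => // ls; have /andP[pl _] := allP als _ ls.
    rewrite dvdn_addl ?lM // (@nres_eqmod l pl (m + M)%N%:Z m) //.
    by rewrite PoszD addrAC subrr add0r; apply: lM.
  - by rewrite (omega8_eqmod8 mM8).
  - by rewrite (eps4_eqmod8 mM8).
have [r [pr rM hr]] := quadratic_dirichlet M0 chiM chiT chi_per nM.
have orr := cop_odd r rM.
have n1 (b b' : bool) : (-1 : R) ^+ b = (-1) ^+ b' -> b = b'.
  by apply: signr_bool_inj; rewrite pnatr_eq0.
have mems l : prime l -> l != 2 -> (l <= N)%N -> l \in s.
  by move=> pl l2 lN; rewrite mem_filter mem_iota add0n ltnS lN pl prime_neq2_odd.
exists r; split=> //.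
- rewrite ltnNge; apply/negP => rN.
  have r2 : r != 2 by apply: contraTneq orr => ->.
  by have := cop_l r r rM (mems r pr r2 rN); rewrite dvdnn.
- move=> l pl l2 lN; have ls := mems l pl l2 lN.
  have lN' : (l < N.+1)%N by [].
  have := hr (Some (Some (Ordinal lN'))); rewrite /= ls.
  have [ln <-] := hn l ls.
  by rewrite (negPf ln) (negPf (cop_l r l rM ls)) => /n1.
- have := hr None; have := hr (Some None); rewrite /= orr on => /n1 -> /n1 ->.
  by rewrite -ce -cw (eps4_eqmod8 n8) (omega8_eqmod8 n8).
Qed.

Lemma logn_prod_primes (s : seq nat) (f : nat -> nat) (l : nat) :
  uniq s -> all prime s -> prime l ->
  logn l (\prod_(p <- s) p ^ f p) = if l \in s then f l else 0%N.
Proof.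
move=> us als pl; elim: s us als => [|p s IH] /=; first by rewrite big_nil logn1.
case/andP=> ps us /andP[pp als].
have s0 : (0 < \prod_(p <- s) p ^ f p)%N.
  rewrite big_seq; elim/big_ind: _ => // [x y x0 y0|q qs]; first by rewrite muln_gt0 x0.
  by rewrite expn_gt0 prime_gt0 // (allP als).
rewrite big_cons lognM ?s0 ?expn_gt0 ?prime_gt0 // lognX logn_prime // IH // inE.
have [->|lp] := eqVneq l p; first by rewrite (negPf ps) muln1 addn0.
by rewrite muln0 add0n.
Qed.

(* The auxiliary prime [r] is the only prime beyond [N] dividing [m]. *)
Lemma hilbert_existence (N : nat) (sg : bool) (c : nat -> sqclass) : (2 <= N)%N ->
  (forall l, prime l -> l != 2 -> (c l).2 = false) ->
  exists (m : int) (r : nat), [/\ m != 0, (m < 0) = sg, prime r /\ (N < r)%N,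
    forall l, prime l -> (l <= N)%N -> cl l m = c l
  & forall l, prime l -> (N < l)%N -> l != r -> ~~ (l %| m)%Z].
Proof.
move=> N2 hc.
pose s := [seq l <- iota 0 N.+1 | prime l].
have als : all prime s by apply: filter_all.
have us : uniq s by rewrite filter_uniq ?iota_uniq.
have mems l : prime l -> (l <= N)%N -> l \in s.
  by move=> pl lN; rewrite mem_filter mem_iota add0n ltnS lN pl.
pose m0 := (\prod_(p <- s) p ^ (c p).1.1)%N.
have m00 : (0 < m0)%N.
  rewrite /m0 big_seq; elim/big_ind: _ => // [x y x0 y0|q qs]; first by rewrite muln_gt0 x0.
  by rewrite expn_gt0 prime_gt0 // (allP als).
pose m1 : int := (-1) ^+ sg * m0%:Z.
have m10 : m1 != 0 by rewrite mulf_neq0 ?signr_eq0 // -lt0n.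
have absm1 : `|m1|%N = m0 by rewrite /m1 abszMsign.
(* What [m1], which has the right sign and valuation parities, still lacks: a unit class at each
   prime up to [N], to be supplied by [r]. *)
pose d l := sqcD (c l) (cl l m1).
have d1 l : prime l -> (l <= N)%N -> (d l).1.1 = false.
  move=> pl lN; rewrite /d /sqcD /cl /= absm1 logn_prod_primes // mems //.
  by case: (c l).1.1.
have d2 l : prime l -> l != 2 -> (d l).2 = false.
  by move=> pl l2; rewrite /d /sqcD /cl /= hc // (negPf l2).
have [r [pr orr rN hr [hr2 hr2']]] :=
  exists_prime_prescribed N (fun l => (d l).1.2) (d 2).1.2 (d 2).2.
have r0 : r%:Z != 0 by rewrite eqz_nat -lt0n prime_gt0.
exists (m1 * r%:Z), r; split; first exact: mulf_neq0.
- have rp : 0 < r%:Z by rewrite ltz_nat prime_gt0.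
  rewrite pmulr_llt0 // /m1; case: (sg); rewrite ?expr1 ?expr0; move: m00; clear; lia.
- by [].
- move=> l pl lN; rewrite clM //.
  suff -> : cl l r = d l by rewrite /d sqcDC -[RHS]sqcD0 -(sqcDD (cl l m1)) ; case: (c l) (cl l m1) => [[x y] z] [[x' y'] z']; rewrite /sqcD /= !addbA.
  have lr : l != r by apply: contraTneq lN => ->; rewrite -ltnNge.
  have dE : d l = ((d l).1.1, (d l).1.2, (d l).2) by case: (d l) => [[]].
  rewrite cl_prime_neq // dE d1 //.
  have [l2|l2] := eqVneq l 2; first by rewrite l2 hr2 hr2'.
  by rewrite d2 // hr.
- move=> l pl lN lr; rewrite dvdz_primeM // negb_or !dvdzE /= absm1 (dvdn_prime2 pl pr) lr andbT.
  have := logn_prod_primes (fun p => (c p).1.1 : nat) us als pl.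
  rewrite -/m0 mem_filter mem_iota add0n ltnS [(l <= N)%N]leqNgt lN andbF => /eqP.
  by rewrite -leqn0 leqNgt logn_gt0 mem_primes pl m00.
Qed.

(** * Quaternion algebras over the rationals and their quadratic extensions *)

Lemma prime_bound_abs N (a : int) : a != 0 -> (`|a| <= N)%N -> prime_bound N a.
Proof.
move=> a0 aN l pl; rewrite dvdzE /= => la; apply: leq_trans aN.
by apply: dvdn_leq la; rewrite absz_gt0.
Qed.

(** The product formula yields the symbol at [r], the one prime left out by the hypothesis. *)
Lemma conic_of_local r A B : prime r -> A != 0 -> B != 0 -> ~~ ((A < 0) && (B < 0)) ->
  (forall l, prime l -> l != r -> hil l A B = false) -> conic_solvable A B.
Proof.
move=> pr A0 B0 AB h; apply: legendre_conic => // l pl _.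
have [->|lr] := eqVneq l r; last exact: h.
pose N := (`|A| + `|B| + r + 2)%N.
have N2 : (2 <= N)%N by rewrite /N addn2.
have bA : prime_bound N A by apply: prime_bound_abs => //; rewrite /N; lia.
have bB : prime_bound N B by apply: prime_bound_abs => //; rewrite /N; lia.
have := hilbert_product N2 A0 B0 bA bB; rewrite (negPf AB).
rewrite (@hilsum_supp _ _ _ [:: r]) ?big_seq1 //=.
  by rewrite pr andbT /N; lia.
by move=> k pk; rewrite inE; apply: h.
Qed.

Lemma conics_exist (a b d : int) : 0 < a -> b != 0 -> d != 0 ->
  (forall l, prime l -> (cl l d != sqc0) || ~~ hil l a b) ->
  exists m : int, [/\ m != 0, conic_solvable a (m * b) & conic_solvable (d * a) (d * m)].
Proof.
move=> a_gt0 b0 d0 hloc.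
have a0 : a != 0 by rewrite gt_eqF.
pose N := (`|a| + `|b| + `|d| + 2)%N.
have N2 : (2 <= N)%N by rewrite /N addn2.
have bN x : x != 0 -> (`|x| <= `|a| + `|b| + `|d|)%N -> prime_bound N x.
  by move=> x0 xN; apply: prime_bound_abs => //; rewrite /N; lia.
have ba := bN a a0 ltac:(lia); have bb := bN b b0 ltac:(lia); have bd := bN d d0 ltac:(lia).
(* The last equation is the triviality of the symbol of [d * a] and [d * X], expanded with
   [(d, d) = (d, -1)] and the preceding equation. *)
pose good l X := [&& (l != 2) ==> ~~ X.2, bil l X (cl l a) == hil l a b &
  bil l X (cl l d) == bil l (cl l d) (sqcD (cl l (-1)) (cl l a)) (+) hil l a b].
pose c l := odflt sqc0 [pick X : sqclass | good l X].
have hc l : prime l -> good l (c l).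
  move=> pl; rewrite /c; case: pickP => // no.
  have [|X [h1 h2 h3]] := @local_target l (cl l a) (cl l b) (cl l d) pl _ (hloc l pl).
    by move=> l2; rewrite /cl /= (negPf l2).
  have := no X; rewrite /good /hil h2 h3 !eqxx !andbT.
  by case: (l != 2) h1 => //= -> .
(* Since [m] has the sign of [d], the product [d * m] is positive and the second conic has real
   points. *)
have [|m [r [m0 sm [pr rN] hm hm']]] := @hilbert_existence N (d < 0) c N2.
  by move=> l pl l2; have /and3P[] := hc l pl; rewrite l2 /= => /negbTE.
have unit l x : prime l -> (N < l)%N -> prime_bound N x -> ~~ (l %| x)%Z.
  by move=> pl lN h; apply/negP => /(h l pl); rewrite leqNgt lN.
have l_neq2 l : (N < l)%N -> l != 2 by move=> lN; rewrite neq_ltn (leq_ltn_trans N2 lN) orbT.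
exists m; split=> //; apply: (conic_of_local pr); rewrite ?mulf_neq0 //.
- by rewrite (lt_gtF a_gt0).
- move=> l pl lr; have [lN|lN] := leqP l N.
    have /and3P[_ /eqP h _] := hc l pl.
    by rewrite hilMr // /hil hm // bilC h /hil addbb.
  by rewrite hil_unit ?l_neq2 ?(unit l a) // dvdz_primeM // negb_or hm' ?unit.
- rewrite !ltz0M // (lt_gtF a_gt0) addbF sm.
  by case: (d < 0).
move=> l pl lr; have [lN|lN] := leqP l N; last first.
  by rewrite hil_unit ?l_neq2 // dvdz_primeM // negb_or ?hm' ?unit.
have /and3P[_ /eqP h1 /eqP h2] := hc l pl.
rewrite hilMl // !hilMr // hil_self // /hil hm // !(bilC _ _ (c l)) h1 h2 bilDr /hil.
rewrite (bilC _ (cl l d) (cl l a)).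
by case: (bil _ _ _); case: (bil _ _ _); case: (bil _ _ _).
Qed.

(** With [e] the common value, [(a e, b e)] and [(a b e, dl e)] are symbols of solvable conics; as
    [dl] is a square at [l], their product is [(a, b)]. If [e = 0], positivity forces [x = y = 0],
    which puts [- a b] in the class of [dl], and [(a, b) = (a, - a b)] is trivial. *)
Lemma ternary_hil l (a b dl x y z w : int) : prime l -> 0 < a -> 0 < b -> dl != 0 ->
  cl l dl = sqc0 -> [|| x != 0, y != 0, z != 0 | w != 0] ->
  a * x ^+ 2 + b * y ^+ 2 = a * b * z ^+ 2 + dl * w ^+ 2 -> hil l a b = false.
Proof.
move=> pl a_gt0 b_gt0 dl0 cdl nz E.
have a0 : a != 0 by rewrite gt_eqF.
have b0 : b != 0 by rewrite gt_eqF.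
have [e eE] : exists e, e = a * x ^+ 2 + b * y ^+ 2 by exists (a * x ^+ 2 + b * y ^+ 2).
rewrite -eE in E.
have [e0|e0] := eqVneq e 0.
  have hx := sqr_ge0 x; have hy := sqr_ge0 y.
  have x0 : x ^+ 2 = 0 by move: e0; rewrite eE; nia.
  have y0 : y ^+ 2 = 0 by move: e0; rewrite eE; nia.
  move: nz; move/eqP: x0; rewrite sqrf_eq0 => -> /=; move/eqP: y0; rewrite sqrf_eq0 => -> /= zw.
  rewrite e0 in E; have E2 : - a * b * z ^+ 2 = dl * w ^+ 2 by apply: (addrI (a * b * z ^+ 2)); rewrite -E; ring.
  have z0 : z != 0.
    apply: contraTneq zw => z0; rewrite z0 eqxx /= negbK.
    by move/eqP: E2; rewrite z0 expr0n mulr0 eq_sym mulf_eq0 (negPf dl0) /= sqrf_eq0.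
  have w0 : w != 0.
    have : dl * w ^+ 2 != 0 by rewrite -E2 !mulf_neq0 ?oppr_eq0.
    by apply: contraNneq => ->; rewrite expr0n mulr0.
  have := clM pl dl0 (expf_neq0 2 w0); rewrite -E2 cdl cl_sqr // sqcD0.
  rewrite clM ?mulf_neq0 ?oppr_eq0 ?expf_neq0 // cl_sqr // sqcD0 clM ?oppr_eq0 // => h.
  have -> : hil l a b = bil l (cl l a) (sqcD (cl l (- a)) (cl l b)).
    by rewrite bilDr -/(hil l a (- a)) hilN.
  by rewrite h bil0r.
have c1 : conic_solvable (a * e) (b * e).
  exists x, y, e; split; last by rewrite expr2 [X in _ = X * _]eE; ring.
  by rewrite e0 !orbT.
have c2 : conic_solvable (a * b * e) (dl * e).
  exists z, w, e; split; last by rewrite expr2 [X in _ = X * _]E; ring.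
  by rewrite e0 !orbT.
have h1 := conic_hil pl (mulf_neq0 a0 e0) (mulf_neq0 b0 e0) c1.
have h2 := conic_hil pl (mulf_neq0 (mulf_neq0 a0 b0) e0) (mulf_neq0 dl0 e0) c2.
move: h1 h2; rewrite !(hilMl, hilMr) ?mulf_neq0 //.
rewrite /hil cdl !bil0r (bilC _ (cl l e) (cl l b)).
by case: (bil l (cl l a) (cl l b)); case: (bil l (cl l a) (cl l e)); case: (bil l (cl l b) (cl l e)); case: (bil l (cl l e) (cl l e)).
Qed.

(** * The norm form and its null vectors *)

Section QuaternionNorm.
Variables (F : fieldType) (a b : F).
Local Notation H := (quaternion a b).

Definition quat_norm (u : H) : F :=
  qre u ^+ 2 - a * qi u ^+ 2 - b * qj u ^+ 2 + a * b * qk u ^+ 2.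
Definition quat_conj (u : H) : H := Quat (qre u) (- qi u) (- qj u) (- qk u).

Lemma quat_mul_conj (u : H) : u * quat_conj u = (quat_norm u)%:A.
Proof. by case: u => x y z t; congr Quat => /=; rewrite /quat_norm /=; ring. Qed.

Lemma quat_conj_mul (u : H) : quat_conj u * u = (quat_norm u)%:A.
Proof. by case: u => x y z t; congr Quat => /=; rewrite /quat_norm /=; ring. Qed.

Lemma quat_conj_eq0 (u : H) : (quat_conj u == 0) = (u == 0).
Proof.
apply/eqP/eqP => [|->]; last by congr Quat; rewrite oppr0.
case: u => x y z t [-> /eqP + /eqP + /eqP]; rewrite !oppr_eq0.
by move=> /eqP-> /eqP-> /eqP->.
Qed.

Lemma quat_divisionP :
  division_algebra (quaternion a b) <-> forall u : H, quat_norm u = 0 -> u = 0.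
Proof.
split=> [div u n0|h u u0].
  apply/eqP; apply: contraT => u0; have [v [_ vu]] := div u u0.
  have : v * (u * quat_conj u) = 0 by rewrite quat_mul_conj n0 scale0r mulr0.
  rewrite mulrA vu mul1r => /eqP; rewrite quat_conj_eq0 => /eqP e.
  by rewrite e eqxx in u0.
have n0 : quat_norm u != 0 by apply: contraNneq u0 => /h ->.
exists ((quat_norm u)^-1 *: quat_conj u).
by rewrite -scalerAr -scalerAl quat_mul_conj quat_conj_mul scalerA mulVf // scale1r.
Qed.

End QuaternionNorm.

(** In general the second conic divided by [d = s ^+ 2] makes [m] a norm from [K(sqrt a)], and the
    first does so for [m b]; the product of the two elements exhibits [b] times a square as a norm.
    If [Y1] or [Y2] vanishes, [a] is a square in [K] and the span of 1 and [i] contains a null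
    vector. *)
Lemma quat_norm_isotropic (K : fieldType) (a b m d : int) (s : K) :
  [pchar K] =i pred0 -> s ^+ 2 = d%:~R -> d != 0 -> m != 0 ->
  conic_solvable a (m * b) -> conic_solvable (d * a) (d * m) ->
  exists u : quaternion (a%:~R : K) (b%:~R : K), u != 0 /\ quat_norm u = 0.
Proof.
move=> K0 sd d0 m0 [x1 [y1 [z1 [n1 e1]]]] [x2 [y2 [z2 [n2 e2]]]].
have inj (n : int) : (n%:~R == 0 :> K) = (n == 0).
  have /pcharf0P h := K0.
  by case: n => k; rewrite ?NegzE ?mulrNz ?oppr_eq0 -pmulrn h.
have s0 : s != 0 by rewrite -sqrf_eq0 sd inj.
have {}e1 := congr1 (fun n : int => n%:~R : K) e1.
have {}e2 := congr1 (fun n : int => n%:~R : K) e2.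
rewrite /= !(rmorphD, rmorphXn, rmorphM) /= in e1 e2.
rewrite -!inj in n1 n2 m0 d0.
rewrite -sd in e2 d0.
move: (x1%:~R) (y1%:~R) (z1%:~R) (x2%:~R) (y2%:~R) (z2%:~R) (a%:~R) (b%:~R) (m%:~R)
  n1 e1 n2 e2 m0 => {x1 y1 z1 x2 y2 z2}X1 Y1 Z1 X2 Y2 Z2 A B M n1 e1 n2 e2 m0.
have quat0 (x y z : K) : [|| x != 0, y != 0 | z != 0] -> Quat x y z 0 != 0 :> quaternion A B.
  by apply: contraTneq => -[-> -> ->]; rewrite eqxx.
have [Y10|Y10] := eqVneq Y1 0.
  exists (Quat Z1 X1 0 0); split.
    by apply: quat0; rewrite eqxx orbF orbC; move: n1; rewrite Y10 eqxx.
  by rewrite /quat_norm /= -e1 Y10; ring.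
pose W := Z2 / s.
have {}e2 : A * X2 ^+ 2 + M * Y2 ^+ 2 = W ^+ 2.
  apply: (mulfI d0); have -> : s ^+ 2 * W ^+ 2 = Z2 ^+ 2 by rewrite /W; field.
  by rewrite -e2; ring.
have [Y20|Y20] := eqVneq Y2 0.
  exists (Quat W X2 0 0); split.
    apply: quat0; rewrite eqxx orbF orbC; move: n2; rewrite Y20 eqxx /=.
    by rewrite /W mulf_eq0 invr_eq0 (negPf s0) orbF.
  by rewrite /quat_norm /= -e2 Y20; ring.
exists (Quat (Z1 * W + A * X1 * X2) (Z1 * X2 + X1 * W) (M * Y1 * Y2) 0); split.
  by apply: quat0; rewrite !mulf_neq0 ?orbT.
rewrite /quat_norm /=.
have -> : (Z1 * W + A * X1 * X2) ^+ 2 - A * (Z1 * X2 + X1 * W) ^+ 2 - B * (M * Y1 * Y2) ^+ 2 + A * B * 0 ^+ 2 =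
  (Z1 ^+ 2 - A * X1 ^+ 2) * (W ^+ 2 - A * X2 ^+ 2) - B * (M * Y1 * Y2) ^+ 2 by ring.
by rewrite -e1 -e2; ring.
Qed.

Lemma unitz_abs (n : int) : n \is a GRing.unit -> `|n|%N = 1%N.
Proof.
by move/mulrV/(congr1 absz); rewrite abszM => /eqP; rewrite muln_eq1 => /andP[/eqP].
Qed.

Lemma squarefreez_neq0 d : squarefreez d -> d != 0.
Proof. by move=> sf; apply/eqP => d0; have := sf 0; rewrite d0 dvdz0 => /(_ isT). Qed.

Lemma squarefreez_logn d l : squarefreez d -> prime l -> (logn l `|d| <= 1)%N.
Proof.
move=> sf pl; rewrite leqNgt -pfactor_dvdn ?absz_gt0 ?squarefreez_neq0 //.
apply/negP => h; have := sf l%:Z; rewrite dvdzE abszX => /(_ h).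
by move/unitz_abs => /= l1; have := prime_gt1 pl; rewrite l1.
Qed.

Section QuadraticField.
Variables (d : int) (K : fieldExtType rat).
Hypotheses (d_sqfree : squarefreez d) (d_neq1 : d != 1).
Variable s : K.
Hypotheses (sd : s ^+ 2 = d%:~R) (Ks : <<1; s>>%VS = fullv).

Lemma rat_not_sqrt (r : rat) : r ^+ 2 <> d%:~R.
Proof.
move=> e.
have e2 : numq r ^+ 2 = d * denq r ^+ 2.
  apply: (@intr_inj rat); rewrite !(rmorphXn, rmorphM) /= -e -exprMn.
  by rewrite numqE.
have cop : coprimez (numq r ^+ 2) (denq r ^+ 2).
  by rewrite coprimezXl // coprimezXr // coprimezE coprime_num_den.
have : (denq r ^+ 2 %| 1)%Z.
  by rewrite -(@Gauss_dvdzr _ (numq r ^+ 2)) 1?coprimez_sym // mulr1 e2 dvdz_mull.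
have v0 := denq_gt0 r.
rewrite dvdz1 abszX => /eqP v1.
have v1' : denq r = 1 by move: v1; nia.
rewrite v1' expr1n mulr1 in e2.
have u1 : `|numq r|%N = 1%N by apply/unitz_abs/d_sqfree; rewrite e2 dvdzz.
by move/eqP: d_neq1; apply; rewrite -e2; have := u1; nia.
Qed.

Lemma quadratic_span (x : K) : exists a b : rat, x = a%:A + b%:A * s.
Proof.
have : x \in <<1; s>>%VS by rewrite Ks memvf.
case/Fadjoin_polyP => p /polyOver1P[q ->] ->.
elim/poly_ind: q => [|q c [a [b e]]].
  by exists 0, 0; rewrite rmorph0 horner0 scale0r mul0r addr0.
exists (b * d%:~R + c), a.
rewrite rmorphD rmorphM /= map_polyX map_polyC hornerMXaddC e /=.
have dK : (d%:~R : K) = (d%:~R : rat)%:A by exact: (esym (rmorph_int (in_alg K) d)).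
by rewrite mulrDl -mulrA -expr2 sd dK scalerDl [b%:A * _]mulr_algl scalerA -addrA addrC.
Qed.

Local Notation f := (in_alg K).

Lemma quadratic_free (u v : rat) : f u + f v * s = 0 -> u = 0 /\ v = 0.
Proof.
have [->|v0] := eqVneq v 0.
  by rewrite rmorph0 mul0r addr0 => /eqP; rewrite fmorph_eq0 => /eqP.
move=> e; case: (@rat_not_sqrt (u / v)); apply: (fmorph_inj f).
rewrite rmorph_int -sd rmorphXn rmorphM fmorphV /=.
have fv0 : f v != 0 by rewrite fmorph_eq0.
have -> : s = - (f u / f v).
  by apply: (mulfI fv0); rewrite -[LHS](addKr (f u)) e addr0; field.
by rewrite sqrrN.
Qed.

(* Write a null vector of [H_K] as [u + v s] with [u], [v] over [Q]: then
   [N u = - d N v] and [u * conj v] is a pure quaternion of norm [- d (N v)^2]. *)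
Lemma isotropic_ternary (A B : int) (u : quaternion (A%:~R : K) (B%:~R : K)) :
  u != 0 -> quat_norm u = 0 ->
  exists (dl : rat) (x y z w : rat), [/\ dl = d%:~R \/ dl = 1,
    [|| x != 0, y != 0, z != 0 | w != 0] &
    A%:~R * x ^+ 2 + B%:~R * y ^+ 2 = A%:~R * B%:~R * z ^+ 2 + dl * w ^+ 2].
Proof.
case: u => x0 x1 x2 x3 u0 N0; pose D : rat := d%:~R.
have [a0 [b0 E0]] := quadratic_span x0; have [a1 [b1 E1]] := quadratic_span x1.
have [a2 [b2 E2]] := quadratic_span x2; have [a3 [b3 E3]] := quadratic_span x3.
pose A' : rat := A%:~R; pose B' : rat := B%:~R.
pose Na := a0 ^+ 2 - A' * a1 ^+ 2 - B' * a2 ^+ 2 + A' * B' * a3 ^+ 2.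
pose Nb := b0 ^+ 2 - A' * b1 ^+ 2 - B' * b2 ^+ 2 + A' * B' * b3 ^+ 2.
pose T := a0 * b0 - A' * a1 * b1 - B' * a2 * b2 + A' * B' * a3 * b3.
have [hN /eqP] : Na + D * Nb = 0 /\ 2%:R * T = 0.
  apply: quadratic_free; rewrite -N0 /quat_norm /= E0 E1 E2 E3.
  have [g gE] : exists g : {rmorphism rat -> K}, forall x, x%:A = g x by exists f.
  have -> : A%:~R = g A' by rewrite rmorph_int.
  have -> : B%:~R = g B' by rewrite rmorph_int.
  have sD : g D = s ^+ 2 by rewrite rmorph_int sd.
  rewrite !gE /Na /Nb /T.
  rewrite !(rmorphD, rmorphN, rmorphXn, rmorphM, rmorph1) sD.
  ring.
rewrite mulf_eq0 pnatr_eq0 /= => /eqP hT.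
(* If [Nb] vanishes then so does [Na], and one of the two rational quaternions is a nonzero null
   vector; its equation has [dl = 1]. *)
have [Nb0|Nb0] := eqVneq Nb 0.
  have Na0 : Na = 0 by move: hN; rewrite Nb0 mulr0 addr0.
  exists 1; have [a_nz|a_z] := boolP [|| a1 != 0, a2 != 0, a3 != 0 | a0 != 0].
    exists a1, a2, a3, a0; split=> //; first by right.
    by rewrite -/A' -/B' -[RHS]subr0 -Na0 /Na; ring.
  exists b1, b2, b3, b0; split; first by right.
    move: a_z; rewrite !negb_or !negbK => /and4P[/eqP z1 /eqP z2 /eqP z3 /eqP z0].
    apply: contraNT u0; rewrite !negb_or !negbK => /and4P[/eqP w1 /eqP w2 /eqP w3 /eqP w0].
    by rewrite E0 E1 E2 E3 z0 z1 z2 z3 w0 w1 w2 w3 scale0r mul0r addr0.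
  by rewrite -/A' -/B' -[RHS]subr0 -Nb0 /Nb; ring.
(* The first three values are the coordinates of the pure quaternion and [T] is its vanishing real
   part; the equation is multiplicativity of the norm. *)
exists D; exists (a1 * b0 - a0 * b1 + B' * (a2 * b3) - B' * (a3 * b2)),
  (a2 * b0 - a0 * b2 - A' * (a1 * b3) + A' * (a3 * b1)),
  (a3 * b0 - a0 * b3 - a1 * b2 + a2 * b1), Nb; split; first by left.
  by rewrite Nb0 !orbT.
rewrite -/A' -/B'; have -> : D * Nb ^+ 2 = - (Na * Nb) + T ^+ 2.
  have -> : Na = - (D * Nb) by apply/eqP; rewrite -addr_eq0 hN.
  by rewrite hT; ring.
by rewrite /Na /Nb /T; ring.
Qed.
End QuadraticField.

Lemma clear_denominators (x y z w : rat) :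
  exists (m x' y' z' w' : int), [/\ m != 0, x'%:~R = m%:~R * x, y'%:~R = m%:~R * y,
    z'%:~R = m%:~R * z & w'%:~R = m%:~R * w :> rat].
Proof.
exists (denq x * denq y * denq z * denq w), (numq x * denq y * denq z * denq w),
  (denq x * numq y * denq z * denq w), (denq x * denq y * numq z * denq w),
  (denq x * denq y * denq z * numq w).
split; first by rewrite !mulf_neq0 ?denq_neq0.
all: by rewrite !rmorphM /= !numqE; ring.
Qed.

Lemma quaternion_division_local (d : int) (K : fieldExtType rat) (A B : int) :
  squarefreez d -> d != 1 -> is_quadratic_field d K -> 0 < A -> 0 < B ->
  division_algebra (quaternion (A%:~R : K) (B%:~R : K)) <->
  exists l, [/\ prime l, cl l d = sqc0 & hil l A B].
Proof.
move=> sf d1 [s sd Ks] A0 B0; have d0 := squarefreez_neq0 sf.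
split=> [/quat_divisionP div|[l [pl cd hl]]].
  apply: contrapT => no.
  have [|m [m0 c1 c2]] := @conics_exist A B d A0 (lt0r_neq0 B0) d0.
    move=> l pl; rewrite -negb_and; apply/negP => /andP[/eqP cd hl].
    by apply: no; exists l.
  have [|u [u0 nu]] := quat_norm_isotropic _ sd d0 m0 c1 c2.
    by move=> p; rewrite (fmorph_pchar (in_alg K)) pchar_num.
  by rewrite (div u nu) eqxx in u0.
apply/quat_divisionP => u nu; apply/eqP; apply: contraT => u0.
have [dl [x [y [z [w [hdl nz E]]]]]] := isotropic_ternary sf d1 sd Ks u0 nu.
have [m [x' [y' [z' [w' [m0 ex ey ez ew]]]]]] := clear_denominators x y z w.
have [dl' [dl'0 cdl' edl]] : exists dl' : int, [/\ dl' != 0, cl l dl' = sqc0 & dl = dl'%:~R].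
  by case: hdl => ->; [exists d | exists 1; rewrite cl1].
have mR : (m%:~R : rat) != 0 by rewrite intr_eq0.
have nzE (i : int) (t : rat) : i%:~R = m%:~R * t -> (i != 0) = (t != 0).
  by move=> e; rewrite -(intr_eq0 rat) e mulf_eq0 (negPf mR).
have := @ternary_hil l A B dl' x' y' z' w' pl A0 B0 dl'0 cdl'.
rewrite hl (nzE _ _ ex) (nzE _ _ ey) (nzE _ _ ez) (nzE _ _ ew) nz => /(_ isT) h.
suff : A * x' ^+ 2 + B * y' ^+ 2 = A * B * z' ^+ 2 + dl' * w' ^+ 2 by move/h.
apply: (@intr_inj rat); rewrite !(rmorphD, rmorphXn, rmorphM) /= ex ey ez ew -edl.
by rewrite !exprMn !(mulrCA _ (m%:~R ^+ 2)) -!mulrDr E.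
Qed.

(** * The conditions of the theorem *)

Lemma legendreE (m : int) (l : nat) : prime l ->
  legendre m l = if (l %| m)%Z then 0 else (-1) ^+ nres l m.
Proof.
move=> pl; rewrite /legendre; case: ifP => // _.
suff -> : [exists x : 'I_l, ((x : nat)%:Z ^+ 2 == m %[mod l])%Z] = ~~ nres l m.
  by case: (nres l m).
apply/existsP/(nresP _ pl) => [[x]|[t]]; first by rewrite eqz_mod_dvd; exists x.
have l0 : l%:Z != 0 by have := prime_gt0 pl; lia.
have tl : (`|(t %% l)%Z| < l)%N by have := ltz_mod t l0; have := modz_ge0 t l0; lia.
rewrite -eqz_mod_dvd => h; exists (Ordinal tl) => /=.
by rewrite gez0_abs ?modz_ge0 // modzXm.
Qed.

Lemma legendre_eq1 (m : int) (l : nat) : prime l ->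
  (legendre m l == 1) = ~~ (l %| m)%Z && ~~ nres l m.
Proof. by move=> pl; rewrite legendreE //; case: ifP => // _; case: (nres l m). Qed.

(** The possible factor 4 of the discriminant is a square prime to [l]. If [l] divides [d], the
    valuation is exactly 1 and both sides fail. *)
Lemma cl_sqfree_odd (d : int) (l : nat) : squarefreez d -> prime l -> l != 2 ->
  (cl l d == sqc0) = (legendre (quadratic_disc d) l == 1).
Proof.
move=> sf pl l2; rewrite legendre_eq1 //.
have d0 := squarefreez_neq0 sf.
have ol := prime_neq2_odd pl l2.
have l2' : ~~ (l %| 2)%Z by rewrite dvdzE /= dvdn_prime2.
have e : (l %| quadratic_disc d)%Z = (l %| d)%Z.
  rewrite /quadratic_disc; case: ifP => // _.
  by rewrite (_ : 4 = 2 * 2) // !dvdz_primeM // (negPf l2').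
have n4 : ~~ (l %| d)%Z -> nres l (quadratic_disc d) = nres l d.
  move=> ld; rewrite /quadratic_disc; case: ifP => // _.
  have h : ~~ (l %| 2 ^+ 2)%Z by rewrite dvdz_primeX.
  by rewrite (_ : 4 = 2 ^+ 2) // nresM // nres_sqr.
rewrite e; have [ld|ld] /= := boolP (l %| d)%Z; last first.
  by rewrite n4 // cl_unit // (negPf l2) /=; case: (nres l d).
apply/negP => /eqP [h _ _].
have := squarefreez_logn sf pl; move: h.
have : (0 < logn l `|d|)%N by rewrite logn_gt0 mem_primes pl absz_gt0 d0.
by case: (logn l `|d|) => [|[|]].
Qed.

Lemma cl_sqfree_2 (d : int) : squarefreez d -> (cl 2 d == sqc0) = (d == 1 %[mod 8])%Z.
Proof.
move=> sf; have d0 := squarefreez_neq0 sf.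
have [ld|ld] := boolP (2 %| d)%Z; last first.
  rewrite cl_unit //= /eps4 /omega8; have := oddz_mod2 ld => d2.
  have : (d %% 8)%Z = 1 \/ (d %% 8)%Z = 3 \/ (d %% 8)%Z = 5 \/ (d %% 8)%Z = 7 by lia.
  have : (d %% 4)%Z = ((d %% 8)%Z %% 4)%Z by lia.
  by move=> -> [->|[->|[->|->]]].
have -> : (d == 1 %[mod 8])%Z = false by lia.
apply/negP => /eqP [h _ _].
have := squarefreez_logn sf (isT : prime 2); move: h.
have : (0 < logn 2 `|d|)%N by rewrite logn_gt0 mem_primes absz_gt0 d0.
by case: (logn 2 `|d|) => [|[|]].
Qed.

Lemma division_conditionsP (d : int) (p q : nat) : squarefreez d -> prime p -> prime q ->
  (exists l, [/\ prime l, cl l d = sqc0 & hil l p q]) <->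
  division_conditions d p q \/ division_conditions d q p.
Proof.
move=> sf pp pq.
pose L l := cl l d == sqc0.
(* At an odd prime other than [p] and [q] both entries are units, so the symbol is trivial. *)
have supp : (exists l, [/\ prime l, cl l d = sqc0 & hil l p q]) <->
    [|| L 2 && hil 2 p q, L p && hil p p q | L q && hil q p q].
  split=> [[l [pl /eqP cd hl]]|].
    have h : L l && hil l p q by rewrite /L cd hl.
    have [l2|l2] := eqVneq l 2; first by rewrite l2 in h; rewrite h.
    have [lp|lp] := eqVneq l p; first by rewrite lp in h; rewrite h orbT.
    have [lq|lq] := eqVneq l q; first by rewrite lq in h; rewrite h !orbT.
    by move: hl; rewrite hil_unit // dvdzE /= dvdn_prime2.
  by case/or3P => /andP[/eqP cd h]; [exists 2%N|exists p|exists q].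
apply: (iff_trans supp) => {supp}.
wlog qp : p q pp pq / (q != 2 -> p != 2).
  move=> w; have [q2|q2] := eqVneq q 2; first by apply: w => //; rewrite q2.
  have [p2|p2] := eqVneq p 2; last exact: w.
  have [|h1 h2] := w q p pq pp; first by rewrite p2.
  have -> : [|| L 2 && hil 2 p q, L p && hil p p q | L q && hil q p q] =
      [|| L 2 && hil 2 q p, L q && hil q q p | L p && hil p q p].
    by rewrite !(hilC _ p q) [X in _ || X]orbC.
  by split=> [/h1[]|h]; [right|left|apply: h2; case: h; [right|left]].
have L2 : L 2 = (d == 1 %[mod 8])%Z by apply: cl_sqfree_2.
have Lodd l : prime l -> l != 2 -> L l = (legendre (quadratic_disc d) l == 1).
  exact: cl_sqfree_odd.
have [q2|q2] := eqVneq q 2.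
  rewrite q2; have [p2|p2] := eqVneq p 2.
    rewrite p2 /hil cl_self // /bil /= !andbF; split=> //.
    by case=> -[[[]]|[_ []]|[[]]].
  have op := prime_neq2_odd pp p2.
  have hp2 : hil 2 p 2 = omega8 p.
    by rewrite /hil cl_self // cl_prime_neq 1?eq_sym // /bil /= andbF.
  have hpp : hil p p 2 = omega8 p.
    by rewrite /hil cl_self // cl_prime_neq // /bil /= (negPf p2) /= addbF nres2 // omega8_nat.
  have hqp : ~ division_conditions d 2 p.
    by case=> [[[]]|[e _ _]|[[]]] //; rewrite e in op.
  rewrite hp2 hpp omega8_nat L2 Lodd // orbCA orbb; split=> [h|[|//]].
    left; constructor 2; split=> //.
      by move: h; case/orP=> /andP[_ /orP[]/eqP ->]; by [left|right].
    by case/orP: h => /andP[/eqP h _]; [left|right].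
  case=> [[[]]|[_ h1 h2]|[[]]] //.
  have -> /= : (p %% 8 == 3)%N || (p %% 8 == 5)%N by case: h1 => ->.
  by rewrite !andbT; case: h2 => ->; rewrite eqxx ?orbT.
have p2 := qp q2.
have op := prime_neq2_odd pp p2; have oq := prime_neq2_odd pq q2.
have h2 : hil 2 p q = eps4 p && eps4 q.
  by rewrite /hil !cl_prime_neq ?(eq_sym 2) // /bil /= !addbF.
have e1 := odd_eq1mod4; have e3 := odd_eq3mod4.
have D1 : (d = 1 %[mod 8])%Z <-> L 2 by rewrite L2; split=> /eqP.
have DL l : prime l -> l != 2 -> legendre (quadratic_disc d) l = 1 <-> L l.
  by move=> pl l2; rewrite Lodd //; split=> /eqP.
have no2 : forall x y : nat, y != 2 -> ~ division_condition2 d x y.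
  by move=> x y y2 [e _ _]; rewrite e in y2.
have {no2} RE : division_conditions d p q \/ division_conditions d q p <->
   (division_condition1 d p q \/ division_condition3 d p q) \/
   (division_condition1 d q p \/ division_condition3 d q p).
  split=> [[[h|/(no2 _ _ q2)//|h]|[h|/(no2 _ _ p2)//|h]]|[[h|h]|[h|h]]].
  - by left; left.
  - by left; right.
  - by right; left.
  - by right; right.
  - by left; constructor 1.
  - by left; constructor 3.
  - by right; constructor 1.
  - by right; constructor 3.
apply: iff_trans (iff_sym RE) => {RE}.
(* For [p = q] only condition 3 can hold: the Legendre symbol of [p] at itself is 0, which meets the
   clauses [<> 1], and [(p, p) = (p, -1)]. *)
have [pq'|npq] := eqVneq p q.
  rewrite -pq'; have hp : hil p p p = eps4 p.
    by rewrite /hil cl_self // /bil /= (negPf p2) /= !addbF nresN1 // eps4_nat.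
  rewrite -pq' in h2; rewrite h2 hp andbb orbb -andb_orl.
  have lpp : legendre p p <> 1.
    by rewrite legendreE // dvdzz.
  have no1 : ~ division_condition1 d p p by case=> -[_ _]; rewrite eqxx.
  split=> [/andP[h e]|].
    left; right; split=> //; first by split; apply/e3.
    by left; split=> //; rewrite (DL p) // D1; case/orP: h => ->; [right|left].
  case=> -[/no1//|[_ [/(e3 _ op) -> _] h]]; rewrite andbT;
  by case: h => -[_ [/(DL p pp p2)|/D1] ->]; rewrite ?orbT.
have qnp : q != p by rewrite eq_sym.
have pndq : ~~ (p %| q%:Z)%Z by rewrite dvdzE /= dvdn_prime2.
have qndp : ~~ (q %| p%:Z)%Z by rewrite dvdzE /= dvdn_prime2.
have hp : hil p p q = nres p q.
  by rewrite /hil cl_self // cl_prime_neq // /bil /= (negPf p2) /= addbF.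
have hq : hil q p q = nres q p.
  by rewrite /hil cl_self // cl_prime_neq // /bil /= (negPf q2).
have QR := quadratic_reciprocity pp op pq oq npq.
rewrite -!eps4_nat in QR.
have lpq : legendre q p <> 1 <-> nres p q.
  by rewrite legendreE // (negPf pndq); case: (nres p q).
have lqp : legendre p q <> 1 <-> nres q p.
  by rewrite legendreE // (negPf qndp); case: (nres q p).
have lpq' : legendre q p = -1 <-> nres p q.
  by rewrite legendreE // (negPf pndq); case: (nres p q).
have lqp' : legendre p q = -1 <-> nres q p.
  by rewrite legendreE // (negPf qndp); case: (nres q p).
have c1 : division_condition1 d p q <->
    nres q p && (~~ eps4 p || ~~ eps4 q) && (L p || L q).
  split=> [[_ /lqp' -> h h']|/andP[/andP[/lqp' h hh] hh']].
    rewrite /=; apply/andP; split.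
      by case: h => [/(e1 _ op)|/(e1 _ oq)] ->; rewrite ?orbT.
    by case: h' => [/(DL p pp p2)|/(DL q pq q2)] ->; rewrite ?orbT.
  split=> //.
    by case/orP: hh => g; [left; apply/e1|right; apply/e1].
  by case/orP: hh' => g; [left; apply/DL|right; apply/DL].
have c1' : division_condition1 d q p <->
    nres p q && (~~ eps4 p || ~~ eps4 q) && (L p || L q).
  split=> [[_ /lpq' -> h h']|/andP[/andP[/lpq' h hh] hh']].
    rewrite /=; apply/andP; split.
      by case: h => [/(e1 _ oq)|/(e1 _ op)] ->; rewrite ?orbT.
    by case: h' => [/(DL q pq q2)|/(DL p pp p2)] ->; rewrite ?orbT.
  split=> //.
    by case/orP: hh => g; [right; apply/e1|left; apply/e1].
  by case/orP: hh' => g; [right; apply/DL|left; apply/DL].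
have c3 : division_condition3 d p q <->
    eps4 p && eps4 q && (nres p q && (L p || L 2) || nres q p && (L q || L 2)).
  split=> [[_ [/(e3 _ op) -> /(e3 _ oq) ->] h]|/andP[/andP[ep eq] h]].
    rewrite /=; case: h => -[].
      by move=> /lpq -> [/(DL p pp p2)|/D1] ->; rewrite ?orbT.
    by move=> /lqp -> [/(DL q pq q2)|/D1] ->; rewrite ?orbT.
  split=> //; first by split; apply/e3.
  case/orP: h => /andP[h /orP[]h'].
  - by left; split; [apply/lpq|left; apply/DL].
  - by left; split; [apply/lpq|right; apply/D1].
  - by right; split; [apply/lqp|left; apply/DL].
  - by right; split; [apply/lqp|right; apply/D1].
have c3' : division_condition3 d q p <-> division_condition3 d p q.
  have sym x y : division_condition3 d x y -> division_condition3 d y x.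
    by case=> [[ox oy] [ex ey] h]; split=> //; case: h; [right|left].
  by split; apply: sym.
(* If both primes are 3 modulo 4, the symbol at 2 is nontrivial and exactly one residue bit is set;
   otherwise the symbol at 2 is trivial and the two bits agree. *)
have -> : [|| L 2 && hil 2 p q, L p && hil p p q | L q && hil q p q] =
    (nres q p && (~~ eps4 p || ~~ eps4 q) && (L p || L q)) ||
    eps4 p && eps4 q && (nres p q && (L p || L 2) || nres q p && (L q || L 2)).
  move: QR; rewrite h2 hp hq; case: (nres p q); case: (nres q p); case: (eps4 p); case: (eps4 q) => //= _;
  by case: (L 2); case: (L p); case: (L q).
(* Under this hypothesis the two Legendre symbols agree, which makes condition 1 symmetric in [p]
   and [q]. *)
have nn : ~~ eps4 p || ~~ eps4 q -> nres p q = nres q p.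
  by move: QR; case: (nres p q); case: (nres q p); case: (eps4 p); case: (eps4 q).
split=> [/orP[/c1|/c3]|[[/c1 ->|/c3 ->]|[/c1' h|/c3' /c3 ->]]]; rewrite ?orbT //.
- by left; left.
- by left; right.
- by move: h => /andP[/andP[h h'] ->]; rewrite -(nn h') h h'.
Qed.

Theorem theorem3p16 (d : int) (K : fieldExtType rat) (p q : nat)
    (d_sqfree : squarefreez d) (d_neq1 : d != 1)
    (K_quad : is_quadratic_field d K)
    (p_prime : prime p) (q_prime : prime q) :
  division_algebra (quaternion (p%:R : K) (q%:R : K)) <->
  division_conditions d p q \/ division_conditions d q p.
Proof.
have p0 : 0 < p%:Z by have := prime_gt0 p_prime; lia.
have q0 : 0 < q%:Z by have := prime_gt0 q_prime; lia.
apply: iff_trans (quaternion_division_local d_sqfree d_neq1 K_quad p0 q0) _.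
exact: division_conditionsP.
Qed.
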